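(* Let $\alpha\in(1,2]$, let $m\ge 0$ be an integer, let $\alpha>\alpha_1>\dots>\alpha_m>0$ with $\alpha-\alpha_m\le 1$, and let $c>0$, $c_j>0$ for $j=1,\dots,m$. Let $w(x,t)$ be the propagation function associated with these parameters. Then $$w(x,t)\ge 0,\qquad w_t(x,t)\ge 0,\qquad -w_x(x,t)\ge 0,\qquad x,t>0.$$
   Context: If $m=0$, the sums over $j$ are empty and the conditions on the $\alpha_j$ and $c_j$ are void. Put $g(s)=c s^{\alpha}+\sum_{j=1}^m c_j s^{\alpha_j}$. Let $D_t^\beta$ denote the Caputo derivative of order $\beta>0$ in time, and $H$ the Heaviside unit step function. The propagation function $w(x,t)$ is the solution of $$cD_t^{\alpha}w(x,t)+\sum_{j=1}^m c_j D_t^{\alpha_j}w(x,t)=w_{xx}(x,t),\quad x,t>0,$$ $$w(x,0)=w_t(x,0)=0,\ x>0;\qquad w(0,t)=H(t),\quad w\to 0\ \text{as } x\to\infty,\ t>0,$$ obtained by the Laplace transform in time: for each $x>0$, $w(x,\cdot)$ is the function with $$\int_0^\infty e^{-st}w(x,t)\,\mathrm{d}t=\frac1s\exp\left(-x\sqrt{g(s)}\right),\quad s>0.$$ In the two classical cases ($m=0$, $\alpha=2$) and ($m=1$, $\alpha=2$, $\alpha_1=1$), where $w$ has a jump discontinuity, the derivatives $w_t$, $w_x$ are understood as generalized functions and the inequalities as non-negativity of generalized functions (measures). *)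

(* Defs.v *)
From HB Require Import structures.
From mathcomp Require Import all_boot all_order all_algebra.
From mathcomp Require Import all_classical all_reals all_analysis.

Set Implicit Arguments.
Unset Strict Implicit.
Unset Printing Implicit Defensive.

Import Order.TTheory GRing.Theory Num.Theory.
Import numFieldNormedType.Exports.

Local Open Scope classical_set_scope.
Local Open Scope ring_scope.

(* alpha_1, ..., alpha_m are the values of a : 'I_m -> R, with indices shifted
   by one; likewise for the coefficients c_1, ..., c_m. *)
Definition symbol_g (R : realType) (alpha c : R) (m : nat)
    (a cs : 'I_m -> R) (s : R) : R :=
  c * s `^ alpha + \sum_(j < m) cs j * s `^ a j.

(* A Laplace transform determines w x only up to a null set of times. Right
   continuity selects one representative; it only matters at the jump which
   w x has in the classical cases (where it amounts to H 0 = 1), since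
   otherwise w x has a continuous version. Values of w outside the open
   quadrant x, t > 0 are irrelevant. *)
Definition is_propagation_function (R : realType) (alpha c : R) (m : nat)
    (a cs : 'I_m -> R) (w : R -> R -> R) : Prop :=
  forall x : R, 0 < x ->
    (forall t : R, 0 < t -> w x t' @[t' --> t^'+] --> w x t) /\
    (forall s : R, 0 < s ->
      (@lebesgue_measure R).-integrable `]0%R, +oo[
        (fun t => (expR (- s * t) * w x t)%:E) /\
      (\int[@lebesgue_measure R]_(t in `]0%R, +oo[)
          (expR (- s * t) * w x t)%:E)%E
        = (s^-1 * expR (- x * Num.sqrt (symbol_g alpha c a cs s)))%:E).

Definition classical_case (R : realType) (alpha : R) (m : nat)
    (a : 'I_m -> R) : Prop :=
  alpha = 2 /\ (m = 0%N \/ (m = 1%N /\ forall j, a j = 1)).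

Definition open_quadrant (R : realType) : set (R * R) :=
  [set z | 0 < z.1 /\ 0 < z.2].

Definition dir_x (R : realType) : R * R := (1, 0).
Definition dir_t (R : realType) : R * R := (0, 1).

Fixpoint class_C (R : realType) (k : nat) (f : R * R -> R) : Prop :=
  if k is k'.+1 then
    [/\ forall z, derivable f z (dir_x R),
        forall z, derivable f z (dir_t R),
        class_C k' (fun z => 'D_(dir_x R) f z) &
        class_C k' (fun z => 'D_(dir_t R) f z)]
  else continuous f.

Definition test_function (R : realType) (phi : R * R -> R) : Prop :=
  (forall k, class_C k phi) /\
  exists K : set (R * R),
    [/\ compact K, K `<=` @open_quadrant R & forall z, ~ K z -> phi z = 0].

Definition lebesgue2 (R : realType) :
    {measure set (measurableTypeR R * measurableTypeR R) -> \bar R} :=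
  (@lebesgue_measure R \x @lebesgue_measure R)%E.

Definition locally_integrable2 (R : realType) (u : R * R -> R) : Prop :=
  forall K : set (R * R), compact K -> K `<=` @open_quadrant R ->
    (@lebesgue2 R).-integrable K (fun z => (u z)%:E).

(* The pairing <D_v u, phi> := - <u, D_v phi> defining the generalized
   derivative of u in the direction v on the open quadrant. *)
Definition gen_deriv (R : realType) (u : R * R -> R) (v : R * R)
    (phi : R * R -> R) : R :=
  - (\int[@lebesgue2 R]_(z in @open_quadrant R) (u z * 'D_v phi z)).

Definition gen_nonneg (R : realType) (T : (R * R -> R) -> R) : Prop :=
  forall phi, test_function phi -> (forall z, 0 <= phi z) -> 0 <= T phi.

(* Main.v *)
Require Import Defs.
From HB Require Import structures.
From mathcomp Require Import all_boot all_order all_algebra.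
From mathcomp Require Import all_classical all_reals all_analysis.
From mathcomp Require Import measurable_realfun ring lra.

Set Implicit Arguments.
Unset Strict Implicit.
Unset Printing Implicit Defensive.

Import Order.TTheory GRing.Theory Num.Theory.
Import numFieldNormedType.Exports.

Local Open Scope classical_set_scope.
Local Open Scope ring_scope.

(** Put [psi = sqrt g], so that [w x] has the Laplace transform
    [exp (- x psi (s)) / s].

    Signs. Complete monotonicity is expressed by finite differences ([cm]). A
    right continuous function whose Laplace transform is completely monotone is
    non-negative ([laplace_ge0]). This applies to [w x] and to its increments
    in [x] and [t], whose transforms are products of [1 / s],
    [exp (- x psi)], [(1 - exp (- y psi)) / s] and [(1 - exp (- d s)) / s].
    As [exp (- x psi)] is the limit of the powers [(1 + (x / n) psi)^(- n)], it
    is enough that [1 / (1 + y psi)] and [(1 - 1 / (1 + y psi)) / s] are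
    completely monotone for [y > 0] ([inv_1psi_cm]). They are because
    [1 / (1 + y psi)] is a Stieltjes function ([inv_1psi_stieltjes]): on the ray
    [arg s = theta], [0 < theta < pi], the terms of [g (s)] have arguments
    between [alpha_m theta] and [alpha theta] ([alpha theta] alone
    if [m = 0]). Since [alpha - alpha_m <= 1], they lie in a common half-plane and do
    not cancel, so that [psi] extends analytically, with argument between
    [alpha_m theta / 2] and [alpha theta / 2 <= theta] ([log_root]). Hence
    [Im psi >= 0] above the negative axis, [- Im (1 / (1 + y psi))] is a
    non-negative density there, and a Poisson formula ([strip_poisson])
    recovers [1 / (1 + y psi)] from it.

    It follows that [w] is non-negative, non-increasing in [x] and
    non-decreasing in [t]. It remains to give a meaning to the derivatives.

    Outside of the classical cases some exponent of [g] lies strictly between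
    [1] and [2]. Then [Re psi] grows like a positive power along the imaginary
    axis ([boundary_values]), and the inversion integral
      [(2 / pi) \int sin (t r) Re (exp (- x psi (i r))) dr / r]
    can be differentiated in [x] and [t] under the integral sign. Its
    Laplace transform is the right one, again by the Poisson formula, so it
    equals [w] by uniqueness ([laplace_unique]).

    In the classical cases [w] is tested against smooth functions. Being monotone
    in both variables and right continuous in [t] it is measurable and locally
    bounded, and Fubini's theorem reduces the claim to one variable: if [g] is
    non-decreasing and [p >= 0] has compact support, then
    [\int g p' <= 0] ([nondecr_weak_derivative]). *)

(** * Completely monotone functions *)

Section CompleteMonotonicity.
Context {R : realType}.
Implicit Types (F G : R -> R) (n : nat).

(** Each difference may use its own step, which makes products tractable
    ([cmnM]); for smooth [F] this is [(-1)^k F^(k) >= 0] for [k <= n]. *)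
Fixpoint cmn n F : Prop :=
  (forall s, 0 < s -> 0 <= F s) /\
  (if n is n'.+1 then forall h, 0 < h -> cmn n' (fun s => F s - F (s + h))
   else True).

Definition cm F := forall n, cmn n F.

Lemma cmn_ge0 n F : cmn n F -> forall s, 0 < s -> 0 <= F s.
Proof. by case: n => [|n] []. Qed.

Lemma cmn_eq n F G : (forall s, 0 < s -> F s = G s) -> cmn n F -> cmn n G.
Proof.
elim: n F G => [|n IH] F G FG [F0 FS]; split=> //.
- by move=> s s0; rewrite -FG// F0.
- by move=> s s0; rewrite -FG// F0.
- move=> h h0; apply: IH (FS h h0) => s s0.
  by rewrite !FG// addr_gt0.
Qed.

Lemma cmnS n F : cmn n.+1 F -> cmn n F.
Proof.
elim: n F => [|n IH] F [F0 FS]; split=> //.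
by move=> h h0; apply: IH; apply: FS.
Qed.

Lemma cmn_cst n a : 0 <= a -> cmn n (fun=> a).
Proof.
elim: n a => [|n IH] a a0; split=> // h h0.
by rewrite subrr; apply: IH.
Qed.

Lemma cmnD n F G : cmn n F -> cmn n G -> cmn n (fun s => F s + G s).
Proof.
elim: n F G => [|n IH] F G [F0 FS] [G0 GS]; split=> //.
- by move=> s s0; rewrite addr_ge0 ?F0 ?G0.
- by move=> s s0; rewrite addr_ge0 ?F0 ?G0.
- move=> h h0; apply: cmn_eq (IH _ _ (FS h h0) (GS h h0)) => s s0 /=.
  by ring.
Qed.

Lemma cmn_sum n (I : Type) (r : seq I) (F : I -> R -> R) :
  (forall i, cmn n (F i)) -> cmn n (fun s => \sum_(i <- r) F i s).
Proof.
move=> cF; elim: r => [|i r IH].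
  by apply: cmn_eq (@cmn_cst n 0 (lexx _)) => s _; rewrite big_nil.
by apply: cmn_eq (cmnD (cF i) IH) => s _; rewrite big_cons.
Qed.

Lemma cmn_shift n F d : 0 <= d -> cmn n F -> cmn n (fun s => F (s + d)).
Proof.
move=> d0; elim: n F => [|n IH] F [F0 FS]; split=> //.
- by move=> s s0; apply: F0; rewrite ltr_pwDl.
- by move=> s s0; apply: F0; rewrite ltr_pwDl.
- move=> h h0; apply: cmn_eq (IH _ (FS h h0)) => s s0 /=.
  by rewrite addrAC.
Qed.

(** The Leibniz rule for differences:
    F G - F(. + h) G(. + h) = (F - F(. + h)) G + F(. + h) (G - G(. + h)). *)
Lemma cmnM n F G : cmn n F -> cmn n G -> cmn n (fun s => F s * G s).
Proof.
elim: n F G => [|n IH] F G.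
  by move=> [F0 _] [G0 _]; split=> // s s0; rewrite mulr_ge0 ?F0 ?G0.
move=> cF cG; split.
  by move=> s s0; rewrite mulr_ge0 ?(cmn_ge0 cF) ?(cmn_ge0 cG).
move=> h h0.
have FG1 : cmn n (fun s => (F s - F (s + h)) * G s).
  by apply: IH; [exact: (cF.2 h h0)|exact: cmnS].
have FG2 : cmn n (fun s => F (s + h) * (G s - G (s + h))).
  by apply: IH; [apply: (cmn_shift (ltW h0)); exact: cmnS|exact: (cG.2 h h0)].
by apply: cmn_eq (cmnD FG1 FG2) => s s0 /=; ring.
Qed.

Lemma cmnZ n a F : 0 <= a -> cmn n F -> cmn n (fun s => a * F s).
Proof. by move=> a0; apply: cmnM; exact: cmn_cst. Qed.

Lemma cmnX n F k : cmn n F -> cmn n (fun s => F s ^+ k).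
Proof.
move=> cF; elim: k => [|k IH].
  by apply: cmn_eq (@cmn_cst n 1 ler01) => s _; rewrite expr0.
by apply: cmn_eq (cmnM cF IH) => s _; rewrite exprS.
Qed.

(** [1 / (s + r) - 1 / (s + h + r) = h / ((s + r) (s + r + h))]. *)
Lemma cmn_inv n r : 0 <= r -> cmn n (fun s => (s + r)^-1).
Proof.
elim: n r => [|n IH] r r0.
  by split=> // s s0; rewrite invr_ge0 addr_ge0// ltW.
split; first by move=> s s0; rewrite invr_ge0 addr_ge0// ltW.
move=> h h0.
apply: cmn_eq (cmnZ (ltW h0) (cmnM (IH _ r0) (IH _ (addr_ge0 r0 (ltW h0))))).
move=> s s0 /=; field.
by apply/andP; split; apply: lt0r_neq0; lra.
Qed.

Lemma cmn_lim n {T : Type} (U : set_system T) {FU : ProperFilter U}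
    (F_ : T -> R -> R) F :
  (\forall k \near U, cmn n (F_ k)) ->
  (forall s, 0 < s -> F_ k s @[k --> U] --> F s) -> cmn n F.
Proof.
elim: n F_ F => [|n IH] F_ F cF_ F_F.
  split=> // s s0; apply: (cvgr_to_ge (F_F s s0)).
  by apply: filterS cF_ => k /cmn_ge0; exact.
split.
  move=> s s0; apply: (cvgr_to_ge (F_F s s0)).
  by apply: filterS cF_ => k /cmn_ge0; exact.
move=> h h0; apply: (IH (fun k s => F_ k s - F_ k (s + h))).
  by apply: filterS cF_ => k [_]; exact.
by move=> s s0; apply: cvgB; apply: F_F => //; rewrite addr_gt0.
Qed.

Lemma cmn_int n d (T : measurableType d) (mu : {measure set T -> \bar R})
    (B : set T) (k : T -> R -> R) : measurable B ->
  (forall s, 0 < s -> mu.-integrable B (fun v => (k v s)%:E)) ->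
  (forall v, B v -> cmn n (k v)) ->
  cmn n (fun s => \int[mu]_(v in B) k v s).
Proof.
move=> mB; elim: n k => [|n IH] k ik ck.
  by split=> // s s0; apply: Rintegral_ge0 => v Bv; apply: (cmn_ge0 (ck v Bv)).
split.
  by move=> s s0; apply: Rintegral_ge0 => v Bv; apply: (cmn_ge0 (ck v Bv)).
move=> h h0.
apply: (@cmn_eq _ (fun s => \int[mu]_(v in B) (k v s - k v (s + h)))).
  by move=> s s0; rewrite RintegralB//; apply: ik => //; rewrite addr_gt0.
apply: (IH (fun v s => k v s - k v (s + h))).
  move=> s s0; have sh0 : 0 < s + h by rewrite addr_gt0.
  rewrite (_ : (fun v => _) = (fun v => (k v s)%:E - (k v (s + h))%:E)%E).
    by apply: integrableB; [exact: mB|exact: ik|exact: ik].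
  by apply/funext => v; rewrite EFinB.
by move=> v Bv; apply: (ck v Bv).2.
Qed.

(** Squeezed between [exp (- a)] and [exp (- a / (1 + a / n))]. *)
Lemma cvg_expR_inv (a : R) : 0 <= a ->
  ((1 + a / n.+1%:R)^-1 ^+ n.+1) @[n --> \oo] --> expR (- a).
Proof.
move=> a0.
have an0 n : 0 <= a / n.+1%:R by rewrite divr_ge0.
have up : expR (- (a / (1 + a / n.+1%:R))) @[n --> \oo] --> expR (- a).
  apply: continuous_cvg; first exact: continuous_expR.
  apply: cvgN.
  rewrite -[X in _ --> X]divr1.
  apply: cvgM; first exact: cvg_cst.
  apply: cvgV; first exact: oner_neq0.
  rewrite -[X in _ --> X]addr0; apply: cvgD; first exact: cvg_cst.
  rewrite -[X in _ --> X](mulr0 a); apply: cvgM; first exact: cvg_cst.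
  exact: cvg_harmonic.
apply: (squeeze_cvgr _ _ up); last exact: (cvg_cst (expR (- a))).
near=> n; have := an0 n.
have [u au] : exists u, a = n.+1%:R * u.
  by exists (a / n.+1%:R); rewrite mulrCA divff ?mulr1// pnatr_eq0.
have -> : a / n.+1%:R = u by rewrite au mulrAC divff ?mul1r// pnatr_eq0.
rewrite au => u0; apply/andP; split.
- rewrite -mulrN expRM_natl lerXn2r ?nnegrE ?expR_ge0 ?invr_ge0//; first lra.
  rewrite expRN lef_pV2 ?posrE ?expR_gt0//; first exact: expR_ge1Dx.
  lra.
- rewrite -mulrA -mulrN expRM_natl.
  rewrite lerXn2r ?nnegrE ?expR_ge0 ?invr_ge0//; first lra.
  (* 1 - v <= exp (- v) at v = u / (1 + u) *)
  apply: le_trans (expR_ge1Dx _).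
  rewrite le_eqVlt; apply/orP; left; apply/eqP; field; lra.
Unshelve. all: end_near. Qed.

(** [exp (- x psi)] is the limit of [(1 + (x / n) psi)^(- n)], a power of a
    completely monotone function. *)
Lemma cm_expR (psi : R -> R) (x : R) : 0 <= x ->
  (forall s, 0 < s -> 0 <= psi s) ->
  (forall y, 0 < y -> cm (fun s => (1 + y * psi s)^-1)) ->
  cm (fun s => expR (- x * psi s)).
Proof.
rewrite le_eqVlt => /predU1P[<- _ _ n|x0 psi0 cpsi n].
  apply: cmn_eq (@cmn_cst n 1 ler01) => s _.
  by rewrite oppr0 mul0r expR0.
apply: (@cmn_lim n _ \oo _
  (fun k s => (1 + (x / k.+1%:R) * psi s)^-1 ^+ k.+1)).
  by apply: nearW => k; apply: cmnX; apply: cpsi; rewrite divr_gt0.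
move=> s s0; rewrite mulNr.
have := @cvg_expR_inv (x * psi s) (mulr_ge0 (ltW x0) (psi0 s s0)).
by under eq_fun do rewrite mulrAC.
Qed.

(** With [q = (1 + (x / n) psi)^-1], the approximation [(1 - q ^ n) / s] is
    [(1 - q) / s] times the geometric sum [1 + q + ... + q ^ (n - 1)]. *)
Lemma cm_1mexpR_div (psi : R -> R) (x : R) : 0 < x ->
  (forall s, 0 < s -> 0 <= psi s) ->
  (forall y, 0 < y -> cm (fun s => (1 + y * psi s)^-1)) ->
  (forall y, 0 < y -> cm (fun s => (1 - (1 + y * psi s)^-1) / s)) ->
  cm (fun s => (1 - expR (- x * psi s)) / s).
Proof.
move=> x0 psi0 cpsi cpsi' n.
apply: (@cmn_lim n _ \oo _
  (fun k s => (1 - (1 + (x / k.+1%:R) * psi s)^-1 ^+ k.+1) / s)).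
  apply: nearW => k; have xk0 : 0 < x / k.+1%:R by rewrite divr_gt0.
  apply: cmn_eq (cmnM (cpsi' _ xk0 n) (cmn_sum (index_enum 'I_k.+1)
    (fun i => cmnX i (cpsi _ xk0 n)))) => s s0 /=.
  set q := (1 + _)^-1; rewrite mulrAC; congr (_ / _).
  by rewrite -opprB mulNr -subrX1 opprB.
move=> s s0; rewrite mulNr.
apply: cvgM; last exact: cvg_cst.
apply: cvgB; first exact: cvg_cst.
have := @cvg_expR_inv (x * psi s) (mulr_ge0 (ltW x0) (psi0 s s0)).
by under eq_fun do rewrite mulrAC.
Qed.

Lemma cm_inv_id : cm (fun s : R => s^-1).
Proof.
by move=> n; apply: cmn_eq (cmn_inv n (lexx 0)) => s _; rewrite addr0.
Qed.

Lemma cm_1mexpR_id (d : R) : 0 < d -> cm (fun s : R => (1 - expR (- d * s)) / s).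
Proof.
move=> d0; apply: cm_1mexpR_div => //.
- by move=> s /ltW.
- move=> y y0 n; have yV0 : 0 <= y^-1 by rewrite invr_ge0 ltW.
  apply: cmn_eq (cmnZ yV0 (cmn_inv n yV0)) => s s0 /=; field.
  by apply/andP; split; apply: lt0r_neq0; nra.
- move=> y y0 n; have yV0 : 0 <= y^-1 by rewrite invr_ge0 ltW.
  apply: cmn_eq (cmn_inv n yV0) => s s0 /=; field.
  by rewrite !lt0r_neq0//; nra.
Qed.

End CompleteMonotonicity.

(** * Positivity from the Laplace transform *)
Section RealIntegrable.
Context d {T : measurableType d} {R : realType}.
Variables (mu : {measure set T -> \bar R}) (D : set T).
Hypothesis mD : measurable D.
Implicit Types f g : T -> R.

Lemma integrable_EFin_eq f g : {in D, f =1 g} ->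
  mu.-integrable D (fun x => (f x)%:E) -> mu.-integrable D (fun x => (g x)%:E).
Proof. by move=> fg; apply: eq_integrable => // x xD; rewrite fg. Qed.

Lemma integrable_EFinB f g : mu.-integrable D (fun x => (f x)%:E) ->
  mu.-integrable D (fun x => (g x)%:E) ->
  mu.-integrable D (fun x => (f x - g x)%:E).
Proof.
move=> fi gi; exact: (integrableB mD fi gi).
Qed.

Lemma integrable_EFinZl k f : mu.-integrable D (fun x => (f x)%:E) ->
  mu.-integrable D (fun x => (k * f x)%:E).
Proof.
move=> fi; exact: (integrableZl mD k fi).
Qed.

Lemma integrable_EFin_le f g : measurable_fun D f ->
  (forall x, D x -> `|f x| <= g x) ->
  mu.-integrable D (fun x => (g x)%:E) -> mu.-integrable D (fun x => (f x)%:E).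
Proof.
move=> mf fg; apply: le_integrable => //; first exact/measurable_EFinP.
by move=> x Dx; rewrite lee_fin (le_trans (fg x Dx))// ler_norm.
Qed.

Lemma integrable_EFin_norm f : mu.-integrable D (fun x => (f x)%:E) ->
  mu.-integrable D (fun x => (`|f x|)%:E).
Proof. exact: integrable_norm. Qed.

Lemma integrable_EFin_measurable f : mu.-integrable D (fun x => (f x)%:E) ->
  measurable_fun D f.
Proof. by move/measurable_int/measurable_EFinP. Qed.

End RealIntegrable.

Section LaplacePositivity.
Context {R : realType}.
Notation mu := (@lebesgue_measure R).
Notation Rpos := `]0%R, +oo[%classic.

(** Taking a difference of the transform multiplies [f] by [1 - exp (- h t)]. *)
Lemma laplace_cmn_ge0 (f F : R -> R) n h s :
  (forall s, 0 < s -> mu.-integrable Rpos (fun t => (expR (- s * t) * f t)%:E)) ->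
  (forall s, 0 < s -> \int[mu]_(t in Rpos) (expR (- s * t) * f t) = F s) ->
  cmn n F -> 0 < h -> 0 < s ->
  mu.-integrable Rpos
    (fun t => (expR (- s * t) * ((1 - expR (- h * t)) ^+ n * f t))%:E) /\
  0 <= \int[mu]_(t in Rpos) (expR (- s * t) * ((1 - expR (- h * t)) ^+ n * f t)).
Proof.
move=> fi fF cF h0 s0; elim: n f F fi fF cF => [|n IH] f F fi fF cF.
  have E0 : (fun t => expR (- s * t) * ((1 - expR (- h * t)) ^+ 0 * f t)) =
      (fun t => expR (- s * t) * f t).
    by apply/funext => t; rewrite expr0 mul1r.
  rewrite E0; split; last by rewrite fF//; exact: (cmn_ge0 cF).
  by apply: integrable_EFin_eq (fi s s0) => // t _; rewrite expr0 mul1r.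
have dE r : (fun t => expR (- r * t) * ((1 - expR (- h * t)) * f t)) =
    (fun t => expR (- r * t) * f t - expR (- (r + h) * t) * f t).
  by apply/funext => t; rewrite opprD [in RHS]mulrDl expRD; ring.
have E1 : (fun t => expR (- s * t) * ((1 - expR (- h * t)) ^+ n.+1 * f t)) =
    (fun t => expR (- s * t) * ((1 - expR (- h * t)) ^+ n *
       ((1 - expR (- h * t)) * f t))).
  by apply/funext => t; rewrite exprSr -mulrA.
have [] := IH (fun t => (1 - expR (- h * t)) * f t) (fun r => F r - F (r + h)).
- move=> r r0; apply: (@integrable_EFin_eq _ _ _ mu Rpos _
    (fun t => expR (- r * t) * f t - expR (- (r + h) * t) * f t)) => //.
    by move=> t _; have /(congr1 (@^~ t)) := dE r.
  by apply: integrable_EFinB => //; apply: fi; rewrite // addr_gt0.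
- move=> r r0; rewrite dE.
  by rewrite RintegralB ?fF ?addr_gt0//; apply: fi; rewrite // addr_gt0.
- exact: (cF.2 h h0).
- move=> H1 H2; split; last by rewrite E1.
  by apply: integrable_EFin_eq H1 => // t _; rewrite -[LHS]/((fun t => _) t) -E1.
Qed.

(** If [f] were negative just to the right of [t0], the integrals of [f]
    against the powers of [4 y (1 - y)], [y = exp (- h t)], which peaks at a
    point chosen inside the interval where [f < 0], would become negative;
    complete monotonicity of the transform says that they are all
    non-negative. *)
Lemma laplace_ge0 (f F : R -> R) t0 : 0 < t0 ->
  f t @[t --> t0^'+] --> f t0 ->
  (forall s, 0 < s -> mu.-integrable Rpos (fun t => (expR (- s * t) * f t)%:E)) ->
  (forall s, 0 < s -> \int[mu]_(t in Rpos) (expR (- s * t) * f t) = F s) ->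
  cm F -> 0 <= f t0.
Proof.
move=> t00 ft0 fi fF cF; rewrite leNgt; apply/negP => ft0N.
pose delta := - (f t0 / 2); have delta0 : 0 < delta by rewrite /delta; lra.
have [eta eta0 fdelta] : exists2 eta : R, 0 < eta &
    forall t, t0 < t < t0 + eta -> f t <= - delta.
  have ftd : f t0 < - delta by rewrite /delta; lra.
  have [eta /= eta0 H] := cvgr_lt _ ft0 _ ftd.
  exists eta => // t /andP[tt0 teta]; apply: ltW; apply: H => //=.
  by rewrite distrC ger0_norm; lra.
(* 4 y (1 - y) is largest at y = 1 / 2; h is such that y t1 = 1 / 2 *)
pose t1 := t0 + eta / 2.
have t10 : 0 < t1 by rewrite /t1; lra.
pose h := ln 2 / t1.
have ln20 : 0 < ln 2 :> R by apply: ln_gt0; lra.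
have h0 : 0 < h by rewrite divr_gt0.
pose y t := expR (- h * t).
pose p t := 4 * (y t * (1 - y t)).
have pE t : p t = 1 - (1 - 2 * y t) ^+ 2 by rewrite /p; ring.
have y_dec t t' : t < t' -> y t' < y t.
  by move=> tt'; rewrite /y ltr_expR ltr_nM2l// oppr_lt0.
have y1 : y t1 = 2^-1.
  rewrite /y /h mulNr mulfVK ?lt0r_neq0//.
  by rewrite expRN lnK// posrE.
have y_lt1 t : 0 < t -> y t < 1.
  by move=> tpos; rewrite /y -expR0 ltr_expR mulNr oppr_lt0 mulr_gt0.
have y_gt0 t : 0 < y t by rewrite expR_gt0.
have p_gt0 t : 0 < t -> 0 < p t.
  by move=> tpos; rewrite /p !mulr_gt0// subr_gt0 y_lt1.
pose q := Num.max (p t0) (p (t0 + eta)).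
have q0 : 0 < q by rewrite lt_max p_gt0.
have q1 : q < 1.
  have yt0 : y t1 < y t0 by apply: y_dec; rewrite /t1; lra.
  have yt0e : y (t0 + eta) < y t1 by apply: y_dec; rewrite /t1; lra.
  rewrite gt_max !pE; apply/andP; split; rewrite ltrBlDr ltrDl exprn_even_gt0//=.
    by rewrite y1 in yt0; lra.
  by rewrite y1 in yt0e; lra.
have p_out t : 0 < t -> ~~ (t0 < t < t0 + eta) -> p t <= q.
  have yt0 : y t1 < y t0 by apply: y_dec; rewrite /t1; lra.
  have yt0e : y (t0 + eta) < y t1 by apply: y_dec; rewrite /t1; lra.
  rewrite y1 in yt0 yt0e.
  move=> tpos; rewrite negb_and -!leNgt => /orP[tt0|tt0]; rewrite le_max.
  - apply/orP; left; rewrite !pE lerD2l lerN2.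
    have : y t0 <= y t.
      by move: tt0; rewrite le_eqVlt => /predU1P[->//|/y_dec/ltW].
    by nra.
  - apply/orP; right; rewrite !pE lerD2l lerN2.
    have : y t <= y (t0 + eta).
      by move: tt0; rewrite le_eqVlt => /predU1P[->//|/y_dec/ltW].
    by nra.
(* the kernel is at most q outside of the interval, at least q' > q near t1 *)
pose q' := (1 + q) / 2.
have q'q : q < q' by rewrite /q'; lra.
have q'0 : 0 < q' by rewrite (lt_trans q0).
have [e e0 pe] : exists2 e : R, 0 < e &
    forall t, t1 < t < t1 + e -> q' <= p t.
  have pc : p t @[t --> t1] --> p t1.
    apply: cvgM; first exact: cvg_cst.
    have yc : y t @[t --> t1] --> y t1.
      rewrite /y; apply: continuous_cvg; first exact: continuous_expR.
      by apply: cvgM; [exact: cvg_cst|exact: cvg_id].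
    by apply: cvgM => //; apply: cvgB => //; exact: cvg_cst.
  have : q' < p t1 by rewrite pE y1 /q'; lra.
  move/(cvgr_gt _ pc) => [e /= e0 H].
  exists e => // t /andP[tt1 te]; apply: ltW; apply: H => //=.
  by rewrite distrC ger0_norm; lra.
pose e' := Num.min e (eta / 2).
have e'0 : 0 < e' by rewrite lt_min e0; lra.
pose J := `]t1, (t1 + e')[%classic : set R.
have mJ : measurable J by exact: measurable_itv.
have JRpos : J `<=` Rpos.
  by move=> t; rewrite /J /= !in_itv/= => /andP[tt1 _]; rewrite andbT; lra.
have iJ : mu.-integrable Rpos (fun t => (\1_J t)%:E).
  apply: (@integrableS _ _ _ mu setT) => //.
  exact: (@integrable_indic_itv R t1 (t1 + e') false true).
have intJ : \int[mu]_(t in Rpos) \1_J t = e'.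
  have muJ : mu J = e'%:E.
    by rewrite lebesgue_measure_itv/= lte_fin ltrDl e'0 -EFinB addrAC subrr add0r.
  by rewrite /Rintegral integral_indic// setIidl// [X in fine X]muJ.
have ip : mu.-integrable Rpos (fun t => (p t * `|f t|)%:E).
  have [H _] := laplace_cmn_ge0 fi fF (cF 1%N) h0 h0.
  apply: (@integrable_EFin_eq _ _ _ mu Rpos _ (fun t => 4 *
      `|expR (- h * t) * ((1 - expR (- h * t)) ^+ 1 * f t)|)) => //.
    move=> t; rewrite inE /= in_itv/= andbT => tpos.
    rewrite !normrM ger0_norm ?expR_ge0// ger0_norm ?subr_ge0; last first.
      by apply: ltW; apply: y_lt1.
    by rewrite /p /y expr1; ring.
  by apply: integrable_EFinZl => //; exact: integrable_EFin_norm.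
pose C := \int[mu]_(t in Rpos) (p t * `|f t|).
have main M : 0 <= q ^+ M * C - delta * q' ^+ M.+1 * e'.
  have Mh0 : 0 < M.+1%:R * h by rewrite mulr_gt0.
  have [H1 H2] := laplace_cmn_ge0 fi fF (cF M.+1) h0 Mh0.
  rewrite -intJ -!RintegralZl//.
  have i2 : mu.-integrable Rpos (fun t => (4 ^+ M.+1 *
       (expR (- (M.+1%:R * h) * t) * ((1 - expR (- h * t)) ^+ M.+1 * f t)))%:E).
    exact: integrable_EFinZl.
  rewrite -RintegralB; [|by []|exact: integrable_EFinZl|exact: integrable_EFinZl].
  apply: le_trans (le_Rintegral _ i2 _ _); last 3 first.
  - by [].
  - by apply: integrable_EFinB => //; exact: integrable_EFinZl.
  - move=> t; rewrite /= in_itv/= andbT => tpos.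
    have -> : 4 ^+ M.+1 * (expR (- (M.+1%:R * h) * t) *
        ((1 - expR (- h * t)) ^+ M.+1 * f t)) = p t ^+ M.+1 * f t.
      rewrite (_ : - (M.+1%:R * h) * t = M.+1%:R * (- h * t)); last by ring.
      by rewrite expRM_natl /p /y !exprMn -!mulrA.
    have fN : - `|f t| <= f t <= `|f t| by rewrite -ler_norml.
    have [tin|tout] := boolP (t0 < t < t0 + eta).
      have ftd := fdelta t tin.
      have base : 0 <= q ^+ M * (p t * `|f t|).
        by apply: mulr_ge0; [exact/exprn_ge0/ltW|exact/mulr_ge0/normr_ge0/ltW/p_gt0].
      have pM0 : 0 <= p t ^+ M.+1 by rewrite exprn_ge0// ltW// p_gt0.
      rewrite indicE; case: (boolP (t \in J)) => tJ.
        have pq : q' ^+ M.+1 <= p t ^+ M.+1.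
          rewrite lerXn2r ?nnegrE; [|exact: ltW|exact/ltW/p_gt0|].
            by [].
          apply: pe; move: tJ; rewrite inE /J /= in_itv/= => /andP[-> te].
          by rewrite (lt_le_trans te)// lerD2l ge_min lexx.
        rewrite mulr1; nra.
      rewrite mulr0 subr0; nra.
    have tJ : t \notin J.
      apply: contra tout; rewrite inE /J /= in_itv/= => /andP[tt1 te].
      apply/andP; split; first by rewrite (lt_trans _ tt1)// /t1; lra.
      rewrite (lt_le_trans te)// /t1 -addrA lerD2l.
      have : e' <= eta / 2 by rewrite ge_min lexx orbT.
      by lra.
    rewrite indicE (negbTE tJ) mulr0 subr0 exprSr -mulrA.
    have pq := p_out t tpos tout.
    have pM : p t ^+ M <= q ^+ M.
      by rewrite lerXn2r ?nnegrE//; apply/ltW => //; exact: p_gt0.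
    have pt0 := p_gt0 t tpos.
    apply: (@le_trans _ _ (p t ^+ M * (p t * `|f t|))).
      apply: ler_wpM2l; first exact/exprn_ge0/ltW.
      by apply: ler_wpM2l; [exact: ltW|exact: ler_norm].
    by rewrite ler_wpM2r// mulr_ge0// ltW.
  - by rewrite RintegralZl// mulr_ge0.
have rlt1 : `|q / q'| < 1.
  by rewrite ger0_norm ?ltr_pdivrMr ?mul1r//; apply: divr_ge0; exact: ltW.
have pos : 0 < delta * q' * e' := mulr_gt0 (mulr_gt0 delta0 q'0) e'0.
have [M _ /(_ M (leqnn M)) /=] := cvgr_lt _ (cvg_geometric C rlt1) _ pos.
rewrite expr_div_n mulrA ltr_pdivrMr ?exprn_gt0// => H.
have := main M; rewrite exprSr; move: H.
by rewrite mulrC; lra.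
Qed.

End LaplacePositivity.

(** * Holomorphic functions of one complex variable *)
Section RealCalculus.
Context {R : realType}.
Implicit Types (f g : R -> R) (x a b : R).

Lemma is_derive1_eq f x a b : is_derive x 1 f a -> a = b -> is_derive x 1 f b.
Proof. by move=> ? <-. Qed.

Lemma is_derive1_cst k x : is_derive x 1 (fun _ : R => k) (0 : R).
Proof. exact: is_derive_cst. Qed.

Lemma is_derive1_id x : is_derive x 1 (fun y : R => y) (1 : R).
Proof. exact: is_derive_id. Qed.

Lemma is_derive1D f g x a b : is_derive x 1 f a -> is_derive x 1 g b ->
  is_derive x 1 (fun y => f y + g y) (a + b).
Proof. by move=> ? ?; exact: is_deriveD. Qed.

Lemma is_derive1N f x a : is_derive x 1 f a ->
  is_derive x 1 (fun y => - f y) (- a).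
Proof. by move=> ?; exact: is_deriveN. Qed.

Lemma is_derive1M f g x a b : is_derive x 1 f a -> is_derive x 1 g b ->
  is_derive x 1 (fun y => f y * g y) (a * g x + f x * b).
Proof.
move=> fa gb.
rewrite (_ : (fun y => f y * g y) = f * g)//.
apply: (is_derive1_eq (is_deriveM fa gb)).
by rewrite /GRing.scale/= addrC [a * _]mulrC.
Qed.

Lemma is_derive1_comp' (phi f : R -> R) x a b : is_derive (f x) 1 phi b ->
  is_derive x 1 f a -> is_derive x 1 (fun y => phi (f y)) (b * a).
Proof. by move=> ? ?; exact: is_derive1_comp. Qed.

Lemma is_derive1V f x a : f x != 0 -> is_derive x 1 f a ->
  is_derive x 1 (fun y => (f y)^-1) (- a / (f x) ^+ 2).
Proof.
move=> fx0 fa; apply: (is_derive1_eq (is_deriveV fx0 fa)).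
by rewrite /GRing.scale/= mulrC mulNr mulrN -exprVn.
Qed.

Lemma is_derive1_expR f x a : is_derive x 1 f a ->
  is_derive x 1 (fun y => expR (f y)) (expR (f x) * a).
Proof. by move=> ?; apply: (is_derive1_comp' (phi := expR)). Qed.

Lemma is_derive1_cos f x a : is_derive x 1 f a ->
  is_derive x 1 (fun y => cos (f y)) (- sin (f x) * a).
Proof. by move=> ?; apply: (is_derive1_comp' (phi := cos)). Qed.

Lemma is_derive1_sin f x a : is_derive x 1 f a ->
  is_derive x 1 (fun y => sin (f y)) (cos (f x) * a).
Proof. by move=> ?; apply: (is_derive1_comp' (phi := sin)). Qed.

Lemma is_derive1_lnf f x a : 0 < f x -> is_derive x 1 f a ->
  is_derive x 1 (fun y => ln (f y)) ((f x)^-1 * a).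
Proof.
by move=> ? ?; apply: (is_derive1_comp' (phi := (@ln R))); exact: is_derive1_ln.
Qed.

Lemma is_derive1_atanf f x a : is_derive x 1 f a ->
  is_derive x 1 (fun y => atan (f y)) ((1 + (f x) ^+ 2)^-1 * a).
Proof. by move=> ?; apply: (is_derive1_comp' (phi := atan)). Qed.

End RealCalculus.

Section ComplexFunctions.
Context {R : realType}.
Implicit Types (U V A B : R -> R -> R).

(** [U + i V] satisfies the Cauchy-Riemann equations at [v + i h], with complex
    derivative [A + i B]. Continuity of the derivative is included so that
    integrals over segments can be differentiated. *)
Record holo U V A B (v h : R) : Prop := Holo {
  holo_Uv : is_derive v 1 (fun v => U v h) (A v h) ;
  holo_Vv : is_derive v 1 (fun v => V v h) (B v h) ;
  holo_Uh : is_derive h 1 (U v) (- B v h) ;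
  holo_Vh : is_derive h 1 (V v) (A v h) ;
  holo_cU : {for (v, h), continuous (fun z : R * R => U z.1 z.2)} ;
  holo_cV : {for (v, h), continuous (fun z : R * R => V z.1 z.2)} ;
  holo_cA : {for (v, h), continuous (fun z : R * R => A z.1 z.2)} ;
  holo_cB : {for (v, h), continuous (fun z : R * R => B z.1 z.2)} }.

Lemma contD (f g : R * R -> R) z : {for z, continuous f} ->
  {for z, continuous g} -> {for z, continuous (fun z => f z + g z)}.
Proof. exact: cvgD. Qed.

Lemma contN (f : R * R -> R) z : {for z, continuous f} ->
  {for z, continuous (fun z => - f z)}.
Proof. exact: cvgN. Qed.

Lemma contM (f g : R * R -> R) z : {for z, continuous f} ->
  {for z, continuous g} -> {for z, continuous (fun z => f z * g z)}.
Proof. exact: cvgM. Qed.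

Lemma contcst (k : R) (z : R * R) : {for z, continuous (fun _ : R * R => k)}.
Proof. exact: cvg_cst. Qed.

Lemma contV (f : R * R -> R) z : f z != 0 -> {for z, continuous f} ->
  {for z, continuous (fun z => (f z)^-1)}.
Proof. by move=> f0 cf; exact: (cvgV f0 cf). Qed.

Lemma contcomp (phi : R -> R) (f : R * R -> R) z : {for f z, continuous phi} ->
  {for z, continuous f} -> {for z, continuous (fun z => phi (f z))}.
Proof. by move=> cphi cf; exact: (continuous_cvg _ cphi cf). Qed.

Lemma contfst (z : R * R) : {for z, continuous (fun z : R * R => z.1)}.
Proof. exact: cvg_fst. Qed.

Lemma contsnd (z : R * R) : {for z, continuous (fun z : R * R => z.2)}.
Proof. exact: cvg_snd. Qed.

Lemma contexpR (f : R * R -> R) z : {for z, continuous f} ->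
  {for z, continuous (fun z => expR (f z))}.
Proof. by apply: contcomp; exact: continuous_expR. Qed.

Lemma contcos (f : R * R -> R) z : {for z, continuous f} ->
  {for z, continuous (fun z => cos (f z))}.
Proof. by apply: contcomp; exact: continuous_cos. Qed.

Lemma contsin (f : R * R -> R) z : {for z, continuous f} ->
  {for z, continuous (fun z => sin (f z))}.
Proof. by apply: contcomp; exact: continuous_sin. Qed.

Lemma contatan (f : R * R -> R) z : {for z, continuous f} ->
  {for z, continuous (fun z => atan (f z))}.
Proof. by apply: contcomp; exact: continuous_atan. Qed.

Lemma contln (f : R * R -> R) z : 0 < f z -> {for z, continuous f} ->
  {for z, continuous (fun z => ln (f z))}.
Proof. by move=> f0; apply: contcomp; exact: continuous_ln. Qed.

Ltac deriv := cbv beta; match goal with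
  | |- is_derive _ _ (fun x => @?f x + @?g x) _ =>
      notypeclasses refine (is_derive1D _ _); deriv
  | |- is_derive _ _ (fun x => - @?f x) _ =>
      notypeclasses refine (is_derive1N _); deriv
  | |- is_derive _ _ (fun x => @?f x * @?g x) _ =>
      notypeclasses refine (is_derive1M _ _); deriv
  | |- is_derive _ _ (fun x => (@?f x)^-1) _ =>
      notypeclasses refine (is_derive1V _ _); [|deriv]
  | |- is_derive _ _ (fun x => expR (@?f x)) _ =>
      notypeclasses refine (is_derive1_expR _); deriv
  | |- is_derive _ _ (fun x => cos (@?f x)) _ =>
      notypeclasses refine (is_derive1_cos _); deriv
  | |- is_derive _ _ (fun x => sin (@?f x)) _ =>
      notypeclasses refine (is_derive1_sin _); deriv
  | |- is_derive _ _ (fun x => atan (@?f x)) _ =>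
      notypeclasses refine (is_derive1_atanf _); deriv
  | |- is_derive _ _ (fun x => ln (@?f x)) _ =>
      notypeclasses refine (is_derive1_lnf _ _); [|deriv]
  | |- is_derive _ _ ( *%R ?k) _ =>
      notypeclasses refine (is_derive1M (is_derive1_cst k _) (is_derive1_id _))
  | |- is_derive _ _ (fun x => x) _ => notypeclasses refine (is_derive1_id _)
  | |- is_derive _ _ (fun _ => ?k) _ => notypeclasses refine (is_derive1_cst _ _)
  | |- is_derive _ _ _ _ => eassumption
  end.

Ltac conti := cbv beta; match goal with
  | |- {for _, continuous (fun x => @?f x + @?g x)} => refine (contD _ _); conti
  | |- {for _, continuous (fun x => - @?f x)} => refine (contN _); conti
  | |- {for _, continuous (fun x => @?f x * @?g x)} => refine (contM _ _); conti
  | |- {for _, continuous (fun x => (@?f x)^-1)} => refine (contV _ _); [|conti]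
  | |- {for _, continuous (fun x => expR (@?f x))} => refine (contexpR _); conti
  | |- {for _, continuous (fun x => cos (@?f x))} => refine (contcos _); conti
  | |- {for _, continuous (fun x => sin (@?f x))} => refine (contsin _); conti
  | |- {for _, continuous (fun x => atan (@?f x))} => refine (contatan _); conti
  | |- {for _, continuous (fun x => ln (@?f x))} => refine (contln _ _); [|conti]
  | |- {for _, continuous fst} => exact: contfst
  | |- {for _, continuous snd} => exact: contsnd
  | |- {for _, continuous (fun _ => ?k)} => exact: contcst
  | |- _ => assumption
  end.

Lemma holo_cst (a b : R) v h :
  holo (fun _ _ => a) (fun _ _ => b) (fun _ _ => 0) (fun _ _ => 0) v h.
Proof.
split; try conti; apply: is_derive1_eq; try exact: is_derive1_cst.
all: by rewrite ?oppr0.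
Qed.

Lemma holo_lin (mu c : R) v h :
  holo (fun v _ => mu * v + c) (fun _ h => mu * h)
       (fun _ _ => mu) (fun _ _ => 0) v h.
Proof.
split; try conti; (notypeclasses refine (is_derive1_eq _ _); [by deriv|by rewrite /=; ring]).
Qed.

Lemma holoD U1 V1 A1 B1 U2 V2 A2 B2 v h :
  holo U1 V1 A1 B1 v h -> holo U2 V2 A2 B2 v h ->
  holo (fun v h => U1 v h + U2 v h) (fun v h => V1 v h + V2 v h)
       (fun v h => A1 v h + A2 v h) (fun v h => B1 v h + B2 v h) v h.
Proof.
move=> [? ? ? ? ? ? ? ?] [? ? ? ? ? ? ? ?].
split; try conti; (notypeclasses refine (is_derive1_eq _ _); [by deriv|by rewrite /=; ring]).
Qed.

Lemma holoM U1 V1 A1 B1 U2 V2 A2 B2 v h :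
  holo U1 V1 A1 B1 v h -> holo U2 V2 A2 B2 v h ->
  holo (fun v h => U1 v h * U2 v h - V1 v h * V2 v h)
       (fun v h => U1 v h * V2 v h + V1 v h * U2 v h)
       (fun v h => A1 v h * U2 v h - B1 v h * V2 v h +
          (U1 v h * A2 v h - V1 v h * B2 v h))
       (fun v h => A1 v h * V2 v h + B1 v h * U2 v h +
          (U1 v h * B2 v h + V1 v h * A2 v h)) v h.
Proof.
move=> [? ? ? ? ? ? ? ?] [? ? ? ? ? ? ? ?].
split; try conti; (notypeclasses refine (is_derive1_eq _ _); [by deriv|by rewrite /=; ring]).
Qed.

Lemma holo_expR U V A B v h : holo U V A B v h ->
  holo (fun v h => expR (U v h) * cos (V v h))
       (fun v h => expR (U v h) * sin (V v h))
       (fun v h => expR (U v h) * (A v h * cos (V v h) - B v h * sin (V v h)))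
       (fun v h => expR (U v h) * (A v h * sin (V v h) + B v h * cos (V v h)))
       v h.
Proof.
move=> [? ? ? ? ? ? ? ?].
split; try conti; (notypeclasses refine (is_derive1_eq _ _); [by deriv|by rewrite /=; ring]).
Qed.

Lemma holoV U V A B v h : U v h * U v h + V v h * V v h != 0 ->
  holo U V A B v h ->
  holo (fun v h => U v h / (U v h * U v h + V v h * V v h))
       (fun v h => - V v h / (U v h * U v h + V v h * V v h))
       (fun v h => (- A v h * (U v h * U v h - V v h * V v h)
                    - 2 * B v h * U v h * V v h) /
           ((U v h * U v h + V v h * V v h) * (U v h * U v h + V v h * V v h)))
       (fun v h => (2 * A v h * U v h * V v h -
                    B v h * (U v h * U v h - V v h * V v h)) /
           ((U v h * U v h + V v h * V v h) * (U v h * U v h + V v h * V v h)))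
       v h.
Proof.
move=> n0 [? ? ? ? ? ? ? ?].
split; try (cbv beta; conti; by rewrite /= ?mulf_neq0).
all: notypeclasses refine (is_derive1_eq _ _); [by deriv|].
all: by rewrite /=; field.
Qed.

Lemma holo_log U V A B v h : 0 < U v h -> holo U V A B v h ->
  holo (fun v h => 2^-1 * ln (U v h * U v h + V v h * V v h))
       (fun v h => atan (V v h / U v h))
       (fun v h => (A v h * U v h + B v h * V v h) /
           (U v h * U v h + V v h * V v h))
       (fun v h => (B v h * U v h - A v h * V v h) /
           (U v h * U v h + V v h * V v h)) v h.
Proof.
move=> U0 [? ? ? ? ? ? ? ?].
have n0 : 0 < U v h * U v h + V v h * V v h.
  by rewrite ltr_pwDl ?mulr_gt0// -expr2 sqr_ge0.
have Un0 : U v h != 0 by rewrite lt0r_neq0.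
have n0' : U v h * U v h + V v h * V v h != 0 by rewrite lt0r_neq0.
have n1 : 1 + (V v h / U v h) ^+ 2 != 0.
  by rewrite lt0r_neq0// ltr_pwDl// sqr_ge0.
split; try (cbv beta; conti; by []).
all: notypeclasses refine (is_derive1_eq _ _); [by deriv|].
all: rewrite /=; field; rewrite ?Un0 ?n0' //=.
Qed.

End ComplexFunctions.

Section Rectangle.
Context {R : realType}.
Notation mu := (@lebesgue_measure R).
Implicit Types (U V A B : R -> R -> R).

Lemma holo_cts1 (U : R -> R -> R) v h :
  {for (v, h), continuous (fun z : R * R => U z.1 z.2)} ->
  {for v, continuous (fun v => U v h)}.
Proof.
move=> cU.
by apply: (@continuous2_cvg _ _ _ _ (nbhs v) _ id (fun=> h) U v h cU);
  [exact: cvg_id|exact: cvg_cst].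
Qed.

Lemma rect_bounded (f : R * R -> R) a b c d :
  (forall v h, a <= v <= b -> c <= h <= d -> {for (v, h), continuous f}) ->
  exists2 M, 0 <= M &
    forall v h, a <= v <= b -> c <= h <= d -> `|f (v, h)| <= M.
Proof.
move=> cf.
have cpt : compact (`[a, b] `*` `[c, d] : set (R * R)).
  by apply: compact_setX; exact: segment_compact.
have cont : {within (`[a, b] `*` `[c, d] : set (R * R)), continuous f}.
  apply: continuous_in_subspaceT => -[v h]; rewrite inE /= !in_itv/= => -[? ?].
  exact: cf.
have [M [_ HM]] := compact_bounded (continuous_compact cont cpt).
exists `|M + 1|; first exact: normr_ge0.
move=> v h vab hcd; apply: (HM `|M + 1|).
  by rewrite (lt_le_trans _ (ler_norm _))// ltrDl.
by exists (v, h) => //=; split; rewrite /= in_itv.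
Qed.

Lemma holo_integrable U V A B a b h :
  (forall v, a <= v <= b -> holo U V A B v h) ->
  mu.-integrable `[a, b] (fun v => (V v h)%:E).
Proof.
move=> H; apply: (@continuous_compact_integrable R (fun v => V v h)).
  exact: segment_compact.
apply: continuous_in_subspaceT => v; rewrite inE /= in_itv/= => vab.
exact: (holo_cts1 (holo_cV (H v vab))).
Qed.

(** The rate at which the integral of [Im (U + i V)] over a horizontal segment
    changes with its height is, by the Cauchy-Riemann equations, the difference
    of [U] at the ends of the segment. *)
Lemma holo_segment_integral U V A B a b c1 c2 c d K :
  a < b -> c1 < c -> c < d -> d < c2 ->
  (forall v h, a <= v <= b -> c1 <= h <= c2 -> holo U V A B v h) ->
  (forall h, c <= h <= d -> `|U a h| <= K /\ `|U b h| <= K) ->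
  `| \int[mu]_(v in `[a, b]) V v d - \int[mu]_(v in `[a, b]) V v c |
    <= (K + K) * (d - c).
Proof.
move=> ab c1c cd dc2 H KU.
have [M M0 HM] : exists2 M, 0 <= M &
    forall v h, a <= v <= b -> c1 <= h <= c2 -> `|A v h| <= M.
  apply: (@rect_bounded (fun z => A z.1 z.2)) => v h vab hc.
  exact: (holo_cA (H v h vab hc)).
pose F h := \int[mu]_(v in `[a, b]) V v h.
have in_c h : h \in `]c1, c2[ -> c1 <= h <= c2.
  by rewrite in_itv/= => /andP[/ltW -> /ltW ->].
have intV h : `]c1, c2[%classic h -> mu.-integrable `[a, b] (EFin \o (fun v => V v h)).
  move=> hc; apply: (@holo_integrable U V A B a b h) => v vab; apply: H => //.
  exact: in_c.
have derV h v : `]c1, c2[%classic h -> `[a, b]%classic v ->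
    is_derive h 1 (V v) (A v h).
  move=> hc; rewrite /= in_itv/= => vab.
  by apply: holo_Vh; apply: H => //; exact: in_c.
have intM : mu.-integrable `[a, b] (EFin \o (fun _ : R => M)).
  apply: (@continuous_compact_integrable R (fun _ => M)).
    exact: segment_compact.
  by apply: continuous_subspaceT => ?; exact: cvg_cst.
have p1E h v : `]c1, c2[%classic h -> `[a, b]%classic v ->
    partial1of2 (fun h v => V v h) h v = A v h.
  by move=> hc vab; rewrite partial1of2E; apply: derive_val; exact: derV.
have p1M h v : `]c1, c2[%classic h -> `[a, b]%classic v ->
    `|partial1of2 (fun h v => V v h) h v| <= M.
  move=> hc vab; rewrite p1E//; apply: HM; last exact: in_c.
  by move: vab; rewrite /= in_itv.
have derF h : h \in `]c1, c2[ -> is_derive h 1 F (U b h - U a h).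
  move=> hc.
  have dV x y : `]c1, c2[%classic x -> `[a, b]%classic y ->
      derivable ((fun h v => V v h) ^~ y) x 1.
    by move=> xc yab; have [] := derV x y xc yab.
  have mab : measurable (`[a, b]%classic : set R) by exact: measurable_itv.
  split.
    exact: (@derivable_under_integral R _ _ mu (fun h v => V v h) _ mab h c1 c2
      hc intV dV (fun=> M) (fun _ => M0) intM p1M).
  rewrite -derive1E (@differentiation_under_integral R _ _ mu
    (fun h v => V v h) _ mab h c1 c2 hc intV dV (fun=> M) (fun _ => M0) intM p1M).
  rewrite (@eq_Rintegral _ _ _ mu _ (fun v => A v h)); last first.
    by move=> v; rewrite inE => vab; apply: p1E.
  have hc' := in_c _ hc.
  rewrite /Rintegral (@continuous_FTC2 R _ (fun v => U v h) a b ab)//.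
  - apply: continuous_in_subspaceT => v; rewrite inE /= in_itv/= => vab.
    exact: (holo_cts1 (holo_cA (H v h vab hc'))).
  - have cU v : a <= v <= b -> {for v, continuous (fun v => U v h)}.
      by move=> vab; exact: (holo_cts1 (holo_cU (H v h vab hc'))).
    split.
    + move=> v; rewrite in_itv/= => /andP[/ltW av /ltW vb].
      have vab : a <= v <= b by rewrite av.
      by have [] := holo_Uv (H v h vab hc').
    + by apply: cvg_at_right_filter; apply: cU; rewrite lexx ltW.
    + by apply: cvg_at_left_filter; apply: cU; rewrite lexx ltW.
  - move=> v; rewrite in_itv/= => /andP[/ltW av /ltW vb].
    have vab : a <= v <= b by rewrite av.
    by rewrite derive1E; apply: derive_val; exact: holo_Uv (H v h vab hc').
have cd_in h : c <= h <= d -> h \in `]c1, c2[.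
  by rewrite in_itv/= => /andP[? ?]; apply/andP; split; lra.
have derF' h : h \in `]c, d[ -> is_derive h 1 F (U b h - U a h).
  rewrite in_itv/= => /andP[/ltW ch /ltW hd].
  by apply: derF; apply: cd_in; rewrite ch.
have cF : {within `[c, d], continuous F}.
  apply: derivable_within_continuous => h; rewrite in_itv/= => hcd.
  by have [] := derF h (cd_in h hcd).
have [h] := MVT cd derF' cF.
rewrite in_itv/= => /andP[/ltW ch /ltW hd] E.
rewrite -[X in `|X|]/(F d - F c) E normrM [X in _ * X]ger0_norm; last lra.
rewrite ler_wpM2r ?subr_ge0 ?(ltW cd)// (le_trans (ler_normB _ _))//.
have hcd : c <= h <= d by rewrite ch.
by have [Ka Kb] := KU h hcd; rewrite lerD.
Qed.

End Rectangle.

(** * Translations and hyperbolic functions *)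
Section Translation.
Context {R : realType}.
Notation mu := (@lebesgue_measure R).

Let tr (d : R) : measurableTypeR R -> measurableTypeR R := fun x => x + d.

Let measurable_tr d : measurable_fun setT (tr d).
Proof. by apply: measurable_funD. Qed.

Lemma lebesgue_measure_shift (d : R) (A : set R) : measurable A ->
  pushforward mu (tr d) A = mu A.
Proof.
move=> mA; apply/esym/lebesgue_measure_unique => //= _ [[a b]] _ <-.
rewrite /pushforward.
have -> : tr d @^-1` `]a, b]%classic = `]a - d, b - d]%classic.
  by apply/seteqP; split => x /=; rewrite !in_itv/= ltrBlDr lerBrDr.
rewrite !lebesgue_measure_itv/= !lte_fin ltrD2r.
by case: ifP => // _; congr (_%:E); ring.
Qed.

Lemma integrable_shift (f : R -> R) (d : R) :
  mu.-integrable setT (fun x => (f x)%:E) ->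
  mu.-integrable setT (fun x : R => (f (x + d))%:E).
Proof.
move=> fi; have mf := measurable_int _ fi.
have mfd : measurable_fun setT (fun x : R => (f (x + d))%:E).
  exact: (measurableT_comp mf (measurable_tr d)).
apply/integrableP; split; first exact: mfd.
move/integrableP : fi => [_]; apply: le_lt_trans.
rewrite le_eqVlt; apply/orP; left; apply/eqP.
transitivity (\int[pushforward mu (tr d)]_x `|(f x)%:E|)%E.
  rewrite ge0_integral_pushforward//=; apply/measurable_EFinP.
  by apply: measurableT_comp => //; exact/measurable_EFinP.
by apply: eq_measure_integral => A mA _; exact: lebesgue_measure_shift.
Qed.

Lemma Rintegral_shift (f : R -> R) (d : R) :
  mu.-integrable setT (fun x => (f x)%:E) ->
  \int[mu]_(x in [set: R]) f (x + d) = \int[mu]_(x in [set: R]) f x.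
Proof.
move=> fi; have mf := measurable_int _ fi.
have fid := integrable_shift d fi.
rewrite /Rintegral; congr fine.
transitivity (\int[pushforward mu (tr d)]_x (f x)%:E)%E; last first.
  by apply: eq_measure_integral => A mA _; exact: lebesgue_measure_shift.
by rewrite integral_pushforward.
Qed.

Lemma cvg_Rintegral_segment (f : R -> R) (v0 : R) :
  mu.-integrable setT (fun x => (f x)%:E) ->
  \int[mu]_(x in `[v0 - n%:R, v0 + n%:R]) f x @[n --> \oo] --> \int[mu]_x f x.
Proof.
move=> fi; have mf := measurable_int _ fi.
rewrite /Rintegral; apply: fine_cvg.
rewrite fineK; last exact: integrable_fin_num.
pose D n := (`[v0 - n%:R, v0 + n%:R]%classic : set R).
rewrite (_ : (fun n => _) =
    (fun n => \int[mu]_x (((fun x => (f x)%:E) \_ (D n)) x))%E); last first.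
  by apply/funext => n; rewrite integral_mkcond.
apply: (@dominated_cvg _ _ _ mu setT measurableT _ _ (fun x => (`|f x|)%:E)).
- by move=> n; apply/(measurable_restrictT _ _).1 => //; [exact: measurable_itv|exact: measurable_funTS].
- move=> x _; apply: cvg_near_cst; near=> n.
  rewrite patchE mem_set// /D /= in_itv/=.
  have : `|x - v0| <= n%:R by near: n; exact: nbhs_infty_ger.
  by rewrite ler_norml => /andP[? ?]; apply/andP; split; lra.
- by [].
- exact: integrable_EFin_norm.
- move=> n x _; rewrite patchE; case: ifP => // _.
  by rewrite abse0 lee_fin.
Unshelve. all: by end_near. Qed.

End Translation.

Section Hyperbolic.
Context {R : realType}.
Notation mu := (@lebesgue_measure R).

Definition sh (x : R) := (expR x - expR (- x)) / 2.
Definition ch (x : R) := (expR x + expR (- x)) / 2.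

Lemma ch_gt0 x : 0 < ch x.
Proof. by rewrite divr_gt0// addr_gt0 ?expR_gt0. Qed.

Lemma ch2_sh2 x : ch x ^+ 2 = 1 + sh x ^+ 2.
Proof.
apply/eqP; rewrite -subr_eq; apply/eqP.
by rewrite -[RHS](expRxMexpNx_1 x) /ch /sh; field.
Qed.

Lemma ch_even x : ch (- x) = ch x.
Proof. by rewrite /ch opprK addrC. Qed.

Lemma continuous_ch : continuous ch.
Proof.
move=> x; apply: cvgM; last exact: cvg_cst.
apply: cvgD; first exact: continuous_expR.
by apply: continuous_cvg; [exact: continuous_expR|exact: opp_continuous].
Qed.

Lemma continuous_sech : continuous (fun x => (ch x)^-1).
Proof.
by move=> x; apply: cvgV; [rewrite lt0r_neq0// ch_gt0|exact: continuous_ch].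
Qed.

Lemma cvgy_expR : (@expR R) x @[x --> +oo] --> +oo.
Proof.
apply/cvgryPge => A; near=> x; apply: le_trans (expR_ge1Dx x).
have : A <= x by near: x; apply: nbhs_pinfty_ge; exact: num_real.
by lra.
Unshelve. all: by end_near. Qed.

Lemma integral_sech : (\int[mu]_(x in [set: R]) ((ch x)^-1)%:E = pi%:E)%E.
Proof.
have sech0 x : 0 <= (ch x)^-1 by rewrite invr_ge0 ltW ?ch_gt0.
rewrite ge0_symfun_integralT//; first last.
- by move=> x /=; rewrite ch_even.
- exact: continuous_sech.
have -> : [set x : R | 0 <= x] = `[0, +oo[%classic by rewrite set_itvcy.
pose F (x : R) := 2 * atan (expR x).
have dF (x : R) : is_derive x 1 F (ch x)^-1.
  rewrite /F; notypeclasses refine (is_derive1_eq (is_derive1M (is_derive1_cst 2 x)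
    (is_derive1_atanf (is_derive1_expR (is_derive1_id x)))) _).
  rewrite /= /ch expRN; have e0 := expR_gt0 x.
  have e2 : expR x * expR x + 1 != 0 by rewrite lt0r_neq0// addr_gt0// mulr_gt0.
  by field; rewrite lt0r_neq0// e2 addrC e2.
rewrite (@ge0_continuous_FTC2y R _ F 0 (2 * (pi / 2))).
- rewrite -EFinB -EFinM /F expR0 atan1; congr (_%:E).
  by rewrite -[4%:R]/(4 : R); field.
- by [].
- by apply: continuous_subspaceT; exact: continuous_sech.
- apply: cvgM; first exact: cvg_cst.
  by apply: cvg_comp; [exact: cvgy_expR|exact: cvgy_atan].
- by move=> x _; have [] := dF x.
- apply: cvg_at_right_filter.
  by apply/differentiable_continuous/derivable1_diffP; have [] := dF 0.
- by move=> x _; rewrite derive1E; exact: derive_val.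
Qed.

Lemma integrable_sech : mu.-integrable setT (fun x => ((ch x)^-1)%:E).
Proof.
apply/integrableP; split.
  by apply/measurable_EFinP; apply: continuous_measurable_fun; exact: continuous_sech.
under eq_integral do rewrite gee0_abs ?lee_fin ?invr_ge0 ?ltW ?ch_gt0//.
by rewrite integral_sech ltry.
Qed.

Lemma sh_ge x : 0 <= x -> x <= sh x.
Proof.
move=> x0.
have dsh (y : R) : is_derive y 1 sh (ch y).
  notypeclasses refine (is_derive1_eq (is_derive1M (is_derive1D
    (is_derive1_expR (is_derive1_id y)) (is_derive1N (is_derive1_expR
    (is_derive1N (is_derive1_id y))))) (is_derive1_cst 2^-1 y)) _).
  by rewrite /= /ch; field.
have csh : {within `[0, x], continuous sh}.
  by apply: derivable_within_continuous => y _; have [] := dsh y.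
have [y _] := @MVT_segment R sh ch 0 x x0 (fun y _ => dsh y) csh.
have -> : sh 0 = 0 by rewrite /sh oppr0 subrr mul0r.
rewrite !subr0 => ->; rewrite ler_peMl//.
have := ch2_sh2 y; have := ch_gt0 y; have := sqr_ge0 (sh y).
by nra.
Qed.

Lemma sqr_sh_ge x : x ^+ 2 <= sh x ^+ 2.
Proof.
wlog x0 : x / 0 <= x.
  move=> H; have [/H//|x0] := leP 0 x.
  have -> : x ^+ 2 = (- x) ^+ 2 by rewrite sqrrN.
  have -> : sh x ^+ 2 = sh (- x) ^+ 2.
    by rewrite /sh opprK -sqrrN; congr (_ ^+ 2); field.
  by apply: H; rewrite oppr_ge0 ltW.
by rewrite lerXn2r ?nnegrE ?sh_ge// (le_trans x0)// sh_ge.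
Qed.

End Hyperbolic.

(** * The Poisson formula in a strip *)
Section StripPoisson.
Context {R : realType}.
Notation mu := (@lebesgue_measure R).
Implicit Types (U V A B : R -> R -> R).

(* su + i sv = sinh (v + i h - v0), of squared modulus sq; its reciprocal is
   kre + i kim below *)
Let su (v0 v h : R) := sh (v - v0) * cos h.
Let sv (v0 v h : R) := ch (v - v0) * sin h.
Let sq (v0 v h : R) := su v0 v h * su v0 v h + sv v0 v h * sv v0 v h.

Lemma is_derive_sh (x : R) : is_derive x 1 sh (ch x).
Proof.
notypeclasses refine (is_derive1_eq (is_derive1M (is_derive1D
  (is_derive1_expR (is_derive1_id x)) (is_derive1N (is_derive1_expR
  (is_derive1N (is_derive1_id x))))) (is_derive1_cst 2^-1 x)) _).
by rewrite /= /ch; field.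
Qed.

Lemma is_derive_ch (x : R) : is_derive x 1 ch (sh x).
Proof.
notypeclasses refine (is_derive1_eq (is_derive1M (is_derive1D
  (is_derive1_expR (is_derive1_id x)) (is_derive1_expR
  (is_derive1N (is_derive1_id x)))) (is_derive1_cst 2^-1 x)) _).
by rewrite /= /sh; field.
Qed.

Lemma continuous_sh : continuous (@sh R).
Proof.
move=> x; apply/differentiable_continuous/derivable1_diffP.
by have [] := is_derive_sh x.
Qed.

Lemma holo_sinh v0 v h :
  holo (su v0) (sv v0) (fun v h => ch (v - v0) * cos h)
    (fun v h => sh (v - v0) * sin h) v h.
Proof.
have dB : is_derive v 1 (fun v : R => v - v0) (1 : R).
  notypeclasses refine (is_derive1_eq (is_derive1D (is_derive1_id v)
    (is_derive1_cst (- v0) v)) _).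
  by rewrite addr0.
have dsh := is_derive1_comp' (f := fun v => v - v0) (is_derive_sh (v - v0)) dB.
have dch := is_derive1_comp' (f := fun v => v - v0) (is_derive_ch (v - v0)) dB.
have dc := is_derive_cos h; have ds := is_derive_sin h.
have cB : {for (v, h), continuous (fun z : R * R => z.1 - v0)}.
  by refine (contD _ _); [exact: contfst|exact: contcst].
have csh : {for (v, h), continuous (fun z : R * R => sh (z.1 - v0))}.
  exact: (contcomp (phi := sh) (@continuous_sh _) cB).
have cch : {for (v, h), continuous (fun z : R * R => ch (z.1 - v0))}.
  exact: (contcomp (phi := ch) (@continuous_ch _ _) cB).
have cc := contcos (f := snd) (@contsnd R (v, h)).
have cs := contsin (f := snd) (@contsnd R (v, h)).
split.
- notypeclasses refine (is_derive1_eq (is_derive1M dsh (is_derive1_cst _ _)) _).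
  by rewrite /=; ring.
- notypeclasses refine (is_derive1_eq (is_derive1M dch (is_derive1_cst _ _)) _).
  by rewrite /=; ring.
- notypeclasses refine (is_derive1_eq (is_derive1M (is_derive1_cst _ _) dc) _).
  by rewrite /=; ring.
- notypeclasses refine (is_derive1_eq (is_derive1M (is_derive1_cst _ _) ds) _).
  by rewrite /=; ring.
- exact: contM.
- exact: contM.
- exact: contM.
- exact: contM.
Qed.

Lemma sqE v0 v h : sq v0 v h = sh (v - v0) ^+ 2 + sin h ^+ 2.
Proof.
rewrite /sq /su /sv; have := ch2_sh2 (v - v0); have := cos2Dsin2 h.
set c := ch _; set s := sh _; move=> E1 E2.
transitivity (s ^+ 2 * cos h ^+ 2 + c ^+ 2 * sin h ^+ 2); first by ring.
have -> : cos h ^+ 2 = 1 - sin h ^+ 2 by rewrite -E1 addrK.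
by rewrite E2; ring.
Qed.

Let kre v0 v h := su v0 v h / sq v0 v h.
Let kim v0 v h := - sv v0 v h / sq v0 v h.

Lemma kernel_le v0 v h m : 0 < m -> m ^+ 2 <= sq v0 v h ->
  `|kre v0 v h| <= m^-1 /\ `|kim v0 v h| <= m^-1.
Proof.
move=> m0 msq; have q0 : 0 < sq v0 v h by rewrite (lt_le_trans _ msq)// exprn_gt0.
have aux x : x ^+ 2 <= sq v0 v h -> `|x / sq v0 v h| <= m^-1.
  move=> xq; rewrite normrM [X in _ * X]ger0_norm ?invr_ge0 ?(ltW q0)//.
  rewrite ler_pdivrMr// mulrC ler_pdivlMr//.
  have : `|x| ^+ 2 <= sq v0 v h by rewrite real_normK// num_real.
  have := normr_ge0 x; have := sqr_ge0 (`|x| - m); nra.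
split; apply: aux; rewrite ?sqrrN /sq -!expr2.
  by rewrite lerDl sqr_ge0.
by rewrite lerDr sqr_ge0.
Qed.

Lemma sin_ge_half (h : R) : 0 <= h <= 1 -> h / 2 <= sin h.
Proof.
move=> /andP[h0 h1].
have dsin (y : R) : y \in `]0, h[ -> is_derive y 1 sin (cos y).
  by move=> _; exact: is_derive_sin.
have csin : {within `[0, h], continuous sin}.
  by apply: continuous_subspaceT; exact: continuous_sin.
have [y] := @MVT_segment R sin cos 0 h h0 dsin csin.
rewrite in_itv/= => /andP[y0 yh]; rewrite sin0 !subr0 => ->.
rewrite mulrC ler_wpM2r//.
have dcos (x : R) : x \in `]0, y[ -> is_derive x 1 cos (- sin x).
  by move=> _; exact: is_derive_cos.
have ccos : {within `[0, y], continuous cos}.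
  by apply: continuous_subspaceT; exact: continuous_cos.
(* cos y = 1 - 2 sin (y / 2) ^ 2 and |sin (y / 2)| <= y / 2 <= 1 / 2 *)
have y20 : 0 <= y / 2 by lra.
have ds2 (x : R) : x \in `]0, y / 2[ -> is_derive x 1 sin (cos x).
  by move=> _; exact: is_derive_sin.
have cs2 : {within `[0, y / 2], continuous sin}.
  by apply: continuous_subspaceT; exact: continuous_sin.
have [z _] := @MVT_segment R sin cos 0 (y / 2) y20 ds2 cs2.
rewrite sin0 !subr0 => E.
have -> : cos y = 1 - 2 * sin (y / 2) ^+ 2.
  have -> : cos y = cos (y / 2 + y / 2) by congr cos; field.
  rewrite cosD; have := cos2Dsin2 (y / 2).
  by rewrite !expr2 => H; lra.
have c1 : cos z ^+ 2 <= 1 by rewrite -(cos2Dsin2 z) lerDl sqr_ge0.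
rewrite E exprMn.
have : (y / 2) ^+ 2 <= 4^-1.
  by have : y <= 1 by [apply: le_trans yh _]; nra.
have := sqr_ge0 (cos z); have := sqr_ge0 (y / 2).
by nra.
Qed.

Section PoissonFormula.
Variables (U V A B : R -> R -> R) (h1 C v0 : R).
Hypotheses (h1_pi : pi / 2 < h1)
  (UV_holo : forall v h, 0 <= h < h1 -> holo U V A B v h)
  (V_real : forall v, V v 0 = 0)
  (U_le : forall v h, 0 <= h <= pi / 2 -> `|U v h| <= C)
  (V_le : forall v h, 0 <= h <= pi / 2 -> `|V v h| <= C).

(* Subtracting the value at v0 before multiplying by the kernel leaves a bounded
   function PU + i PV near the pole. *)
Let U0 := U v0 0.
Let PU v h := (U v h + - U0) * kre v0 v h - (V v h + 0) * kim v0 v h.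
Let PV v h := (U v h + - U0) * kim v0 v h + (V v h + 0) * kre v0 v h.

Let pi2 : 0 < pi / 2 :> R. Proof. by rewrite divr_gt0// pi_gt0. Qed.

Let C0 : 0 <= C.
Proof. by apply: le_trans (U_le v0 (h := 0) _); rewrite ?normr_ge0 ?lexx ?ltW. Qed.

Let P_holo : exists A' B', forall v h, 0 <= h < h1 -> sq v0 v h != 0 ->
  holo PU PV A' B' v h.
Proof.
eexists; eexists => v h hh s0.
exact: (holoM (holoD (UV_holo v hh) (holo_cst (- U0) 0 v h))
  (holoV s0 (holo_sinh v0 v h))).
Qed.

Let P_le v h a m : 0 < m -> m ^+ 2 <= sq v0 v h ->
  `|U v h - U0| <= a -> `|V v h| <= a ->
  `|PU v h| <= 2 * a / m /\ `|PV v h| <= 2 * a / m.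
Proof.
move=> m0 msq Ua Va; have [kr ki] := kernel_le m0 msq.
have a0 : 0 <= a := le_trans (normr_ge0 _) Va.
have bound x y : `|x| <= a -> `|y| <= m^-1 -> `|x * y| <= a / m.
  by move=> xa ym; rewrite normrM ler_pM.
rewrite (_ : 2 * a / m = a / m + a / m); last by ring.
rewrite /PU /PV addr0; split.
  by rewrite (le_trans (ler_normB _ _))// lerD// bound.
by rewrite (le_trans (ler_normD _ _))// lerD// bound.
Qed.

(* This Lipschitz bound compensates the simple pole of the kernel. *)
Let P_lipschitz N : 0 < N -> exists2 M, 0 <= M & forall v h,
  v0 - N <= v <= v0 + N -> 0 <= h <= Num.min 1 (pi / 2) ->
  `|U v h - U0| <= M * (`|v - v0| + h) /\ `|V v h| <= M * (`|v - v0| + h).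
Proof.
move=> N0; set e := Num.min 1 (pi / 2).
have e0 : 0 < e by rewrite lt_min ltr01 pi2.
have eh1 h : 0 <= h <= e -> 0 <= h < h1.
  move=> /andP[-> he] /=; rewrite (le_lt_trans he)// (le_lt_trans _ h1_pi)//.
  by rewrite ge_min lexx orbT.
have [MA MA0 HA] := @rect_bounded R (fun z => A z.1 z.2) (v0 - N) (v0 + N) 0 e
  (fun v h _ hh => holo_cA (UV_holo v (eh1 h hh))).
have [MB MB0 HB] := @rect_bounded R (fun z => B z.1 z.2) (v0 - N) (v0 + N) 0 e
  (fun v h _ hh => holo_cB (UV_holo v (eh1 h hh))).
pose M := Num.max MA MB.
have M0 : 0 <= M by rewrite le_max MA0.
exists M => // v h vN hh.
have z_in : 0 <= (0 : R) <= e by rewrite lexx ltW.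
have vert (F G : R -> R) : (forall y : R, 0 <= y <= h -> is_derive y 1 F (G y)) ->
    (forall y, 0 <= y <= h -> `|G y| <= M) -> `|F h - F 0| <= M * h.
  move=> dF GM; have /andP[h0 _] := hh.
  have dF' (y : R) : y \in `]0, h[ -> is_derive y 1 F (G y).
    by rewrite in_itv/= => /andP[/ltW y0 /ltW yh]; apply: dF; rewrite y0.
  have cF : {within `[0, h], continuous F}.
    apply: derivable_within_continuous => y; rewrite in_itv/= => /dF.
    by case.
  have [y yh ->] := MVT_segment h0 dF' cF.
  rewrite subr0 normrM [X in _ * X]ger0_norm// ler_wpM2r//; apply: GM.
  by move: yh; rewrite in_itv.
have hor : `|U v 0 - U0| <= M * `|v - v0|.
  have dU (y : R) : is_derive y 1 (fun v => U v 0) (A y 0).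
    exact: (holo_Uv (UV_holo y (eh1 0 z_in))).
  have cU a b : {within `[a, b], continuous (fun v => U v 0)}.
    by apply: derivable_within_continuous => y _; have [] := dU y.
  have AM y : v0 - N <= y <= v0 + N -> `|A y 0| <= M.
    by move=> yN; rewrite le_max (HA y 0).
  have [vv0|/ltW vv0] := leP v0 v.
    have [y] := @MVT_segment R (fun v => U v 0) (A^~ 0) v0 v vv0
      (fun y _ => dU y) (cU _ _).
    rewrite in_itv/= => /andP[y1 y2] ->; rewrite normrM ler_wpM2r// AM//.
    by case/andP: vN => ? ?; apply/andP; split; lra.
  have [y] := @MVT_segment R (fun v => U v 0) (A^~ 0) v v0 vv0
    (fun y _ => dU y) (cU _ _).
  rewrite in_itv/= => /andP[y1 y2] E; rewrite distrC E normrM distrC ler_wpM2r// AM//.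
  by case/andP: vN => ? ?; apply/andP; split; lra.
have he y : 0 <= y <= h -> 0 <= y <= e.
  by move=> /andP[-> yh]; case/andP: hh => _ /(le_trans yh).
split.
- have := vert (U v) (fun y => - B v y).
  move=> /(_ (fun y yh => holo_Uh (UV_holo v (eh1 y (he y yh))))) H.
  rewrite (_ : U v h - U0 = (U v h - U v 0) + (U v 0 - U0)); last by ring.
  rewrite (le_trans (ler_normD _ _))// addrC mulrDr lerD// H// => y yh.
  by rewrite normrN le_max (HB v y)// ?orbT//; exact: he.
- have := vert (V v) (fun y => A v y).
  move=> /(_ (fun y yh => holo_Vh (UV_holo v (eh1 y (he y yh))))).
  rewrite V_real subr0 => H.
  rewrite (@le_trans _ _ (M * h))//; last by rewrite ler_wpM2l// lerDr.
  apply: H => y yh.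
  by rewrite le_max (HA v y)//; exact: he.
Qed.

Let sq_gt0 v h : 0 < h < pi -> 0 < sq v0 v h.
Proof.
by move=> hh; rewrite sqE ltr_wpDl ?sqr_ge0// exprn_gt0// sin_gt0_pi.
Qed.

(** The integral of [PV] over the segment at height [delta] tends to zero with
    [delta], as [PV] vanishes on the real axis and stays bounded; raising the
    segment to height [pi / 2] costs at most the contribution of the ends, where
    the kernel is of the order of [1 / sinh N]. *)
Let P_segment_integral N : 0 < N ->
  `| \int[mu]_(v in `[v0 - N, v0 + N]) PV v (pi / 2) |
    <= (2 * (2 * C) / sh N + 2 * (2 * C) / sh N) * (pi / 2).
Proof.
move=> N0; set K := 2 * (2 * C) / sh N.
have [A' [B' PH]] := P_holo.
have [M M0 HM] := P_lipschitz N0; set e := Num.min 1 (pi / 2) in HM.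
have e0 : 0 < e by rewrite lt_min ltr01 pi2.
have e1 : e <= 1 by rewrite ge_min lexx.
have epi : e <= pi / 2 by rewrite ge_min lexx orbT.
have shN : 0 < sh N by rewrite (lt_le_trans N0)// sh_ge// ltW.
have K0 : 0 <= K by rewrite /K divr_ge0 ?(ltW shN)// !mulr_ge0.
pose delta k : R := e / k.+2%:R.
have delta0 k : 0 < delta k by rewrite divr_gt0.
have deltae k : delta k < e.
  by rewrite ltr_pdivrMr// ltr_pMr// (_ : 1 = 1%:R)// ltr_nat.
have delta_cvg : delta k @[k --> \oo] --> 0.
  rewrite -(mulr0 e); apply: cvgM; first exact: cvg_cst.
  by have := @cvg_harmonic R; rewrite -(cvg_shiftS (@harmonic R)).
pose c2 := (pi / 2 + Num.min h1 pi) / 2.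
have pi_min : pi / 2 < Num.min h1 pi.
  by rewrite lt_min h1_pi/= ltr_pdivrMr// ltr_pMr ?pi_gt0// ltr1n.
have c2pi : pi / 2 < c2 by rewrite /c2; lra.
have c2h : c2 < Num.min h1 pi by rewrite /c2; lra.
have PH' c v h : 0 < c -> c <= h <= c2 -> holo PU PV A' B' v h.
  move=> c0 /andP[ch' hc2]; move: c2h; rewrite lt_min => /andP[c2h1 c2pi'].
  apply: PH; first by apply/andP; split; lra.
  by rewrite lt0r_neq0// sq_gt0//; apply/andP; split; lra.
have PHint h : 0 < h -> h <= pi / 2 ->
    mu.-integrable `[v0 - N, v0 + N] (fun v => (PV v h)%:E).
  move=> h0 hp; apply: (@holo_integrable R PU PV A' B') => v _.
  by apply: (PH' h) => //; rewrite lexx (le_trans hp)// ltW.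
have step k : `| \int[mu]_(v in `[v0 - N, v0 + N]) PV v (pi / 2) -
    \int[mu]_(v in `[v0 - N, v0 + N]) PV v (delta k)| <= (K + K) * (pi / 2).
  have dk := delta0 k; have dp : delta k < pi / 2.
    exact: lt_le_trans (deltae k) epi.
  apply: (@le_trans _ _ ((K + K) * (pi / 2 - delta k))); last first.
    by apply: ler_wpM2l; [exact: addr_ge0|rewrite gerBl ltW].
  apply: (@holo_segment_integral R PU PV A' B' _ _ (delta k / 2) c2) => //.
  - lra.
  - lra.
  - by move=> v h _; apply: PH'; lra.
  - move=> h /andP[dh hp].
    have hh : 0 <= h <= pi / 2 by rewrite hp andbT; lra.
    have Ub v : `|U v h - U0| <= 2 * C.
      rewrite (le_trans (ler_normB _ _))// mulr_natl mulr2n lerD// U_le//.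
      by rewrite lexx ltW.
    have Vb v : `|V v h| <= 2 * C.
      by rewrite (le_trans (V_le _ hh))// ler_peMl// ler1n.
    have end_sq v : sh (v - v0) ^+ 2 = sh N ^+ 2 -> sh N ^+ 2 <= sq v0 v h.
      by move=> E; rewrite sqE E lerDl sqr_ge0.
    split; apply: (P_le shN _ (Ub _) (Vb _)).1; apply: end_sq.
      by rewrite addrAC subrr add0r /sh opprK -sqrrN; congr (_ ^+ 2); field.
    by rewrite addrAC subrr add0r.
have lim0 : \int[mu]_(v in `[v0 - N, v0 + N]) PV v (delta k) @[k --> \oo] --> 0.
  rewrite /Rintegral (_ : (0 : R) = fine 0%E)//; apply: fine_cvg.
  have mD : measurable (`[v0 - N, v0 + N]%classic : set R) by exact: measurable_itv.
  have i8 : mu.-integrable `[v0 - N, v0 + N] (fun _ : R => (8 * M)%:E).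
    apply: (@continuous_compact_integrable R (fun _ => 8 * M)).
      exact: segment_compact.
    by apply: continuous_subspaceT => ?; exact: cvg_cst.
  have mk k : measurable_fun `[v0 - N, v0 + N]%classic
      (fun v => (PV v (delta k))%:E).
    apply: (@measurable_int _ _ _ mu); apply: PHint; first exact: delta0.
    exact: le_trans (ltW (deltae k)) epi.
  (* pointwise convergence fails only at the pole, v = v0 *)
  have aecvg : {ae mu, forall v, `[v0 - N, v0 + N]%classic v ->
      (PV v (delta k))%:E @[k --> \oo] --> 0%:E}.
    exists [set v0]; split; [exact: measurable_set1|exact: lebesgue_measure_set1|].
    move=> v /=; apply: contra_notP => /eqP vv0 _.
    apply: cvg_EFin; first exact: nearW.
    have s0 : sq v0 v 0 != 0.
      rewrite sqE sin0 expr0n addr0.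
      rewrite lt0r_neq0// (lt_le_trans _ (sqr_sh_ge _))//.
      by rewrite exprn_even_gt0//= subr_eq0.
    have z_in : 0 <= (0 : R) < h1 by rewrite lexx (lt_trans pi2).
    have Pv0 : PV v 0 = 0.
      by rewrite /PV V_real /kim /sv sin0 mulr0 oppr0 mul0r mulr0 !add0r mul0r.
    rewrite -Pv0; apply: (@continuous_cvg _ _ _ _ _ delta (PV v)) => //.
    apply/differentiable_continuous/derivable1_diffP.
    by have [] := holo_Vh (PH v 0 z_in s0).
  have aele : {ae mu, forall v k, `[v0 - N, v0 + N]%classic v ->
      (`|(PV v (delta k))%:E| <= (8 * M)%:E)%E}.
    apply: aeW => v k; rewrite /= in_itv/= => vN; rewrite lee_fin.
    have dk : 0 <= delta k <= e by rewrite !ltW.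
    have [Ub Vb] := HM v _ vN dk.
    set x := `|v - v0| in Ub Vb.
    have x0 : 0 <= x := normr_ge0 _; have d0 := delta0 k.
    have m0 : 0 < (x + delta k) / 4 by rewrite divr_gt0// ltr_wpDl.
    have -> : 8 * M = 2 * (M * (x + delta k)) / ((x + delta k) / 4).
      by field; rewrite lt0r_neq0// ltr_wpDl.
    apply: (P_le m0 _ Ub Vb).2.
    rewrite sqE; have := sqr_sh_ge (v - v0).
    have : delta k / 2 <= sin (delta k).
      by apply: sin_ge_half; rewrite ltW//= (le_trans _ e1)// ltW.
    have -> : (v - v0) ^+ 2 = x ^+ 2 by rewrite /x real_normK// num_real.
    move=> sd sx; apply: le_trans (lerD sx (_ : (delta k / 2) ^+ 2 <= _)); last first.
      by rewrite lerXn2r ?nnegrE//; [lra|apply: le_trans sd; lra].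
    have := sqr_ge0 (x - delta k); have := sqr_ge0 x; nra.
  have [_ _] := @dominated_convergence _ _ _ mu _ mD
    (fun k v => (PV v (delta k))%:E) (fun=> 0%:E) (fun=> (8 * M)%:E) mk
    (measurable_cst _) aecvg i8 aele.
  by rewrite integral0.
have lim1 : `| \int[mu]_(v in `[v0 - N, v0 + N]) PV v (pi / 2) -
    \int[mu]_(v in `[v0 - N, v0 + N]) PV v (delta k)| @[k --> \oo] -->
    `| \int[mu]_(v in `[v0 - N, v0 + N]) PV v (pi / 2) - 0|.
  by apply: cvg_norm; apply: cvgB => //; exact: cvg_cst.
rewrite subr0 in lim1.
by apply: (cvgr_to_le lim1); exact: nearW.
Qed.

(** The Poisson formula for the half-plane [Re s > 0] in the coordinate
    [zeta = ln s]: the kernel [1 / sinh (zeta - v0)] has its only pole at [v0],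
    and on the line [Im zeta = pi / 2] it becomes [- i / ch (v - v0)]. *)
Lemma strip_poisson :
  mu.-integrable setT (fun v => (U v (pi / 2) / ch (v - v0))%:E) /\
  \int[mu]_(v in [set: R]) (U v (pi / 2) / ch (v - v0)) =
  U v0 0 * pi.
Proof.
pose f v := (U v (pi / 2) - U0) / ch (v - v0).
have isech : mu.-integrable setT (fun v : R => ((ch (v - v0))^-1)%:E).
  exact: (integrable_shift (- v0) (@integrable_sech R)).
have p_in : 0 <= (pi / 2 : R) < h1 by rewrite h1_pi (ltW pi2).
have p_in' : 0 <= (pi / 2 : R) <= pi / 2 by rewrite lexx (ltW pi2).
have cU : continuous (fun v => U v (pi / 2)).
  by move=> v; exact: (holo_cts1 (holo_cU (UV_holo v p_in))).
have csech : continuous (fun v : R => (ch (v - v0))^-1).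
  move=> v; apply: (@continuous_cvg _ _ _ _ _ (fun v : R => v - v0)
    (fun x => (ch x)^-1)); first exact: continuous_sech.
  by apply: cvgB; [exact: cvg_id|exact: cvg_cst].
have iU : mu.-integrable setT (fun v => (U v (pi / 2) / ch (v - v0))%:E).
  apply: (@integrable_EFin_le _ _ _ mu setT measurableT _
      (fun v => C * (ch (v - v0))^-1)).
  - apply: continuous_measurable_fun => v; apply: cvgM; [exact: cU|exact: csech].
  - move=> v _; have c0 : 0 <= (ch (v - v0))^-1 by rewrite invr_ge0 ltW// ch_gt0.
    by rewrite normrM [X in _ * X]ger0_norm// ler_wpM2r// U_le.
  - exact: integrable_EFinZl.
split=> //.
have if_ : mu.-integrable setT (fun v => (f v)%:E).
  apply: (@integrable_EFin_eq _ _ _ mu setT measurableT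
    (fun v => U v (pi / 2) / ch (v - v0) - U0 * (ch (v - v0))^-1)).
    by move=> v _; rewrite /f mulrBl.
  by apply: integrable_EFinB => //; exact: integrable_EFinZl.
have PVf v : PV v (pi / 2) = -1 * f v.
  have c0 := ch_gt0 (v - v0).
  rewrite /PV /kre /kim /sq /su /sv /f cos_pihalf sin_pihalf.
  by field; rewrite lt0r_neq0.
have f0 : \int[mu]_(v in [set: R]) f v = 0.
  pose D := (2 * (2 * C) + 2 * (2 * C)) * (pi / 2).
  have D0 : 0 <= D.
    by rewrite /D mulr_ge0 ?(ltW pi2)// addr_ge0 ?mulr_ge0.
  have lim0 : D / n%:R @[n --> \oo] --> 0.
    rewrite -(mulr0 D); apply: cvgM; first exact: cvg_cst.
    by rewrite -(cvg_shiftS (fun k => k%:R^-1 : R)); exact: (@cvg_harmonic R).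
  have lim1 := cvg_Rintegral_segment v0 if_.
  apply: (cvg_unique _ lim1) => //=.
  apply/cvgr0Pnorm_le => eps eps0.
  near=> n; have Dn : D / n%:R <= eps.
    by near: n; exact: (cvgr_le _ lim0).
  have n0 : 0 < n%:R :> R by rewrite ltr0n; near: n; exact: nbhs_infty_gt.
  apply: le_trans Dn; have := P_segment_integral n0.
  have -> : \int[mu]_(v in `[v0 - n%:R, v0 + n%:R]) PV v (pi / 2) =
      -1 * \int[mu]_(v in `[v0 - n%:R, v0 + n%:R]) f v.
    rewrite -RintegralZl//; last by apply: integrableS if_.
    by apply: eq_Rintegral => v _; exact: PVf.
  rewrite normrM normrN1 mul1r => /le_trans; apply.
  rewrite -mulrDl mulrAC /D ler_wpM2l// lef_pV2 ?posrE ?sh_ge ?ltW//.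
  by rewrite (lt_le_trans n0)// sh_ge// ltW.
have : \int[mu]_(v in [set: R]) f v =
    \int[mu]_(v in [set: R]) (U v (pi / 2) / ch (v - v0)) -
    U0 * \int[mu]_(v in [set: R]) (ch (v - v0))^-1.
  rewrite -RintegralZl// -RintegralB//; last exact: integrable_EFinZl.
  by apply: eq_Rintegral => v _; rewrite /f mulrBl.
rewrite f0 => /esym/eqP; rewrite subr_eq0 => /eqP ->; congr (_ * _).
rewrite (@Rintegral_shift R (fun v => (ch v)^-1) (- v0) (@integrable_sech R)).
by rewrite /Rintegral integral_sech.
Unshelve. all: by end_near. Qed.

End PoissonFormula.
End StripPoisson.

(** * The square root of a sum of powers *)
Section Strip.
Context {R : realType}.
Implicit Types (U V : R -> R -> R).

Definition hol (h1 : R) U V := exists A B,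
  forall v h, 0 <= h < h1 -> holo U V A B v h.

Lemma hol_cst h1 a b : hol h1 (fun _ _ => a) (fun _ _ => b).
Proof. by eexists; eexists => v h _; exact: holo_cst. Qed.

Lemma hol_lin h1 mu c : hol h1 (fun v _ => mu * v + c) (fun _ h => mu * h).
Proof. by eexists; eexists => v h _; exact: holo_lin. Qed.

Lemma holD h1 U1 V1 U2 V2 : hol h1 U1 V1 -> hol h1 U2 V2 ->
  hol h1 (fun v h => U1 v h + U2 v h) (fun v h => V1 v h + V2 v h).
Proof.
move=> [A1 [B1 H1]] [A2 [B2 H2]]; eexists; eexists => v h hh.
exact: (holoD (H1 v h hh) (H2 v h hh)).
Qed.

Lemma holM h1 U1 V1 U2 V2 : hol h1 U1 V1 -> hol h1 U2 V2 ->
  hol h1 (fun v h => U1 v h * U2 v h - V1 v h * V2 v h)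
         (fun v h => U1 v h * V2 v h + V1 v h * U2 v h).
Proof.
move=> [A1 [B1 H1]] [A2 [B2 H2]]; eexists; eexists => v h hh.
exact: (holoM (H1 v h hh) (H2 v h hh)).
Qed.

Lemma hol_expR h1 U V : hol h1 U V ->
  hol h1 (fun v h => expR (U v h) * cos (V v h))
         (fun v h => expR (U v h) * sin (V v h)).
Proof.
move=> [A [B H]]; eexists; eexists => v h hh.
exact: (holo_expR (H v h hh)).
Qed.

Lemma holV h1 U V : (forall v h, 0 <= h < h1 ->
    U v h * U v h + V v h * V v h != 0) -> hol h1 U V ->
  hol h1 (fun v h => U v h / (U v h * U v h + V v h * V v h))
         (fun v h => - V v h / (U v h * U v h + V v h * V v h)).
Proof.
move=> n0 [A [B H]]; eexists; eexists => v h hh.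
exact: (holoV (n0 v h hh) (H v h hh)).
Qed.

Lemma hol_log h1 U V : (forall v h, 0 <= h < h1 -> 0 < U v h) -> hol h1 U V ->
  hol h1 (fun v h => 2^-1 * ln (U v h * U v h + V v h * V v h))
         (fun v h => atan (V v h / U v h)).
Proof.
move=> n0 [A [B H]]; eexists; eexists => v h hh.
exact: (holo_log (n0 v h hh) (H v h hh)).
Qed.

Lemma hol_eq h1 U V U' V' : U =2 U' -> V =2 V' -> hol h1 U V -> hol h1 U' V'.
Proof.
move=> UU' VV'.
have -> : U' = U by apply/funext => v; apply/funext => h; rewrite UU'.
by have -> : V' = V by apply/funext => v; apply/funext => h; rewrite VV'.
Qed.

Lemma hol_sum h1 (I : Type) (r : seq I) (U V : I -> R -> R -> R) :
  (forall i, hol h1 (U i) (V i)) ->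
  hol h1 (fun v h => \sum_(i <- r) U i v h) (fun v h => \sum_(i <- r) V i v h).
Proof.
move=> H; elim: r => [|i r IH].
  by apply: hol_eq (hol_cst h1 0 0) => v h; rewrite big_nil.
by apply: hol_eq (holD (H i) IH) => v h; rewrite big_cons.
Qed.

(** The polar form of [X + i Y] in the right half-plane. *)
Lemma polarE (X Y : R) : 0 < X ->
  X = expR (2^-1 * ln (X * X + Y * Y)) * cos (atan (Y / X)) /\
  Y = expR (2^-1 * ln (X * X + Y * Y)) * sin (atan (Y / X)).
Proof.
move=> X0; set N := X * X + Y * Y; set r := expR _; set phi := atan _.
have N0 : 0 < N by rewrite /N ltr_pwDl ?mulr_gt0// -expr2 sqr_ge0.
have r0 : 0 < r := expR_gt0 _.
have r2 : r ^+ 2 = N.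
  by rewrite /r -expRM_natl mulrA divff// mul1r lnK// posrE.
have cphi0 : 0 < cos phi by apply: cos_gt0_pihalf; rewrite atan_gtNpi2 atan_ltpi2.
have sphi : sin phi = Y / X * cos phi.
  by have := atanK (Y / X); rewrite -/phi /tan => <-; rewrite mulfVK// lt0r_neq0.
have c2 : X = r * cos phi.
  have E := cos2Dsin2 phi; rewrite sphi in E.
  have E1 : (r * cos phi) ^+ 2 = X ^+ 2.
    rewrite exprMn r2.
    have -> : N = X ^+ 2 * (1 + (Y / X) ^+ 2).
      by rewrite /N; field; rewrite lt0r_neq0.
    rewrite -mulrA (_ : _ * cos phi ^+ 2 = 1) ?mulr1//.
    by rewrite -[RHS]E; ring.
  apply/eqP; rewrite -(@eqrXn2 _ 2)//; first by rewrite E1.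
    exact: ltW.
  by rewrite mulr_ge0 ?ltW.
by split=> //; rewrite sphi mulrCA -c2 mulfVK// lt0r_neq0.
Qed.

Lemma cos_ge_of_le (x y : R) : `|x| <= y -> y <= pi -> cos y <= cos x.
Proof.
move=> xy ypi; have x0 := normr_ge0 x.
have x_in : `|x| \in `[0, pi] by rewrite in_itv/= x0 (le_trans xy).
have y_in : y \in `[0, pi] by rewrite in_itv/= ypi (le_trans x0).
by rewrite -(cos_norm x) leNgt ltr_cos// -leNgt.
Qed.

Lemma tan_bound (X Y th : R) : 0 <= th < pi / 2 -> 0 < X ->
  `|Y| * cos th <= sin th * X -> `|atan (Y / X)| <= th.
Proof.
move=> /andP[th0 thpi] X0 H; have pi0 := pi_gt0 R.
have cth : 0 < cos th by apply: cos_gt0_pihalf; apply/andP; split; lra.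
have YX : `|Y / X| <= tan th.
  rewrite normrM normfV (gtr0_norm X0) ler_pdivrMr// /tan mulrAC.
  by rewrite ler_pdivlMr.
have thK : atan (tan th) = th.
  by apply: tanK; rewrite in_itv/=; apply/andP; split; lra.
move: YX; rewrite !ler_norml => /andP[Y1 Y2]; rewrite -thK; apply/andP; split.
  by rewrite -atanN; exact: le_atan.
exact: le_atan.
Qed.

Section LogRoot.
Context {I : finType}.
Variables (C E : I -> R) (i0 : I) (lo hi h1 : R).
Hypotheses (C_gt0 : forall i, 0 < C i) (E_lo : forall i, lo <= E i)
  (E_hi : forall i, E i <= hi)
  (h1_lt : forall h, 0 <= h < h1 -> (hi - lo) / 2 * h < pi / 2).

Let m := (lo + hi) / 2.
Let d := (hi - lo) / 2.
(* X + i Y = exp (- m zeta) g (zeta): centring the exponents at m puts all terms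
   into the right half-plane, where the argument is the atan of Y / X *)
Let X v h := \sum_i expR ((E i - m) * v + ln (C i)) * cos ((E i - m) * h).
Let Y v h := \sum_i expR ((E i - m) * v + ln (C i)) * sin ((E i - m) * h).
Let LU v h := (m / 2 * v + 0) + (2^-1 * (2^-1 * ln (X v h * X v h + Y v h * Y v h))
  - 0 * atan (Y v h / X v h)).
Let LV v h := m / 2 * h + (2^-1 * atan (Y v h / X v h) +
  0 * (2^-1 * ln (X v h * X v h + Y v h * Y v h))).
Let S v := \sum_i C i * expR (E i * v).

Let d_ge0 : 0 <= d.
Proof. by rewrite /d; have := E_lo i0; have := E_hi i0; lra. Qed.

Let Em i : `|E i - m| <= d.
Proof.
rewrite ler_norml /m /d; have := E_lo i; have := E_hi i => ? ?.
by apply/andP; split; lra.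
Qed.

Let coefE i v : expR ((E i - m) * v + ln (C i)) =
  expR (- m * v) * (C i * expR (E i * v)).
Proof.
rewrite expRD lnK ?posrE// mulrC mulrCA; congr (_ * _).
by rewrite -expRD; congr expR; ring.
Qed.

Let Emh i h : 0 <= h -> `|(E i - m) * h| <= d * h.
Proof. by move=> h0; rewrite normrM (ger0_norm h0) ler_wpM2r. Qed.

Let S_gt0 v : 0 < S v.
Proof.
rewrite /S (bigD1 i0)//= ltr_pwDl ?mulr_gt0 ?expR_gt0//.
by apply: sumr_ge0 => i _; rewrite mulr_ge0 ?ltW ?expR_gt0.
Qed.

Let X_ge v h : 0 <= h < h1 -> cos (d * h) * (expR (- m * v) * S v) <= X v h.
Proof.
move=> hh; have /andP[h0 _] := hh; have pi0 := pi_gt0 R.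
rewrite /S !mulr_sumr; apply: ler_sum => i _.
have c0 : 0 <= expR (- m * v) * (C i * expR (E i * v)).
  by rewrite mulr_ge0 ?expR_ge0// mulr_ge0 ?expR_ge0// ltW.
rewrite coefE [leLHS]mulrC ler_wpM2l//.
apply: cos_ge_of_le; first exact: Emh.
by have := h1_lt hh; rewrite -/d; lra.
Qed.

Let cosd h : 0 <= h < h1 -> 0 < cos (d * h).
Proof.
move=> hh; have := h1_lt hh; rewrite -/d => dh.
apply: cos_gt0_pihalf; rewrite dh andbT (lt_le_trans (y := 0))//.
  by rewrite oppr_lt0 divr_gt0 ?pi_gt0.
by have /andP[h0 _] := hh; rewrite mulr_ge0.
Qed.

Let X_gt0 v h : 0 <= h < h1 -> 0 < X v h.
Proof.
move=> hh; apply: lt_le_trans (X_ge v hh).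
by rewrite !mulr_gt0 ?expR_gt0 ?cosd.
Qed.

Let hol_XY : hol h1 X Y.
Proof.
apply: hol_sum => i; apply: hol_eq (hol_expR (hol_lin h1 (E i - m) (ln (C i)))).
  by [].
by [].
Qed.

Let hol_L : hol h1 LU LV.
Proof.
apply: holD; first exact: hol_lin.
apply: (@holM h1 (fun _ _ => 2^-1) (fun _ _ => 0)); first exact: hol_cst.
by apply: hol_log => // v h; exact: X_gt0.
Qed.

Let Y_le v h : 0 <= h < h1 -> `|Y v h| * cos (d * h) <= sin (d * h) * X v h.
Proof.
move=> hh; have /andP[h0 _] := hh; have pi0 := pi_gt0 R.
have dh : d * h < pi / 2 := h1_lt hh.
apply: (@le_trans _ _ ((\sum_i expR ((E i - m) * v + ln (C i)) *
    `|sin ((E i - m) * h)|) * cos (d * h))).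
  rewrite ler_wpM2r ?(ltW (cosd hh))//.
  apply: le_trans (ler_norm_sum _ _ _) _; apply: ler_sum => i _.
  by rewrite normrM (ger0_norm (expR_ge0 _)).
rewrite mulr_suml mulr_sumr; apply: ler_sum => i _.
rewrite mulrCA -mulrA ler_wpM2l ?expR_ge0//.
set a := (E i - m) * h; have ad : `|a| <= d * h := Emh i h0.
have -> : `|sin a| = sin `|a|.
  have a_pi : 0 <= sin `|a|.
    by apply: sin_ge0_pi; apply/andP; split; [exact: normr_ge0|lra].
  rewrite -(ger0_norm a_pi); have [a0|a0] := leP 0 a.
    by rewrite (ger0_norm a0).
  by rewrite (ltr0_norm a0) sinN normrN.
rewrite -(cos_norm a) -subr_ge0.
rewrite (_ : _ - _ = sin (d * h - `|a|)); last by rewrite sinB; ring.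
apply: sin_ge0_pi; have := normr_ge0 a => ?.
by apply/andP; split; lra.
Qed.

Let atan_le v h : 0 <= h < h1 -> `|atan (Y v h / X v h)| <= d * h.
Proof.
move=> hh; have /andP[h0 _] := hh; apply: tan_bound.
- by rewrite mulr_ge0//=; exact: h1_lt.
- exact: X_gt0.
- exact: Y_le.
Qed.

Let LUE v h : 2 * LU v h = m * v + 2^-1 * ln (X v h * X v h + Y v h * Y v h).
Proof. by rewrite /LU; field. Qed.

Let LVE v h : 2 * LV v h = m * h + atan (Y v h / X v h).
Proof. by rewrite /LV; field. Qed.

Let im_g v h : 0 <= h < h1 -> expR (2 * LU v h) * sin (2 * LV v h) =
  \sum_i C i * expR (E i * v) * sin (E i * h).
Proof.
move=> hh; rewrite LUE LVE expRD sinD.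
have [EX EY] := polarE (Y v h) (X_gt0 v hh).
rewrite -mulrA [X in _ * X](_ : _ = sin (m * h) * X v h + cos (m * h) * Y v h).
  rewrite /X /Y !mulr_sumr -big_split/= mulr_sumr; apply: eq_bigr => i _.
  rewrite coefE mulNr expRN.
  have -> : E i * h = m * h + (E i - m) * h by ring.
  rewrite sinD; field.
  by rewrite lt0r_neq0// expR_gt0.
move: EX EY; move: (expR (2^-1 * _)) (atan _) => r phi EX EY.
by rewrite EX EY; ring.
Qed.

Let N_bounds v h : 0 <= h < h1 ->
  cos (d * h) * S v <= expR (2 * LU v h) /\ expR (2 * LU v h) <= 2 * S v.
Proof.
move=> hh; rewrite LUE expRD.
set r := expR (2^-1 * _); have r0 : 0 < r := expR_gt0 _.
have [EX EY] := polarE (Y v h) (X_gt0 v hh).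
have Xr : X v h <= r.
  by rewrite EX ler_piMr ?cos_le1// ltW.
have e0 := expR_gt0 (m * v).
have SE : expR (m * v) * (expR (- m * v) * S v) = S v.
  by rewrite mulrA -expRD mulNr subrr expR0 mul1r.
split.
  rewrite -SE mulrCA ler_wpM2l ?(ltW e0)//.
  exact: le_trans (X_ge v hh) Xr.
have sumle (F : R -> R) : (forall x, `|F x| <= 1) ->
    `|\sum_i expR ((E i - m) * v + ln (C i)) * F ((E i - m) * h)|
      <= expR (- m * v) * S v.
  move=> F1; apply: le_trans (ler_norm_sum _ _ _) _.
  rewrite /S mulr_sumr; apply: ler_sum => i _.
  rewrite normrM (ger0_norm (expR_ge0 _)) coefE -[leRHS]mulr1.
  by rewrite ler_wpM2l// mulr_ge0 ?expR_ge0// mulr_ge0 ?expR_ge0// ltW.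
have X1 : `|X v h| <= expR (- m * v) * S v by apply: sumle => x; exact: cos_max.
have Y1 : `|Y v h| <= expR (- m * v) * S v by apply: sumle => x; exact: sin_max.
have r2 : r ^+ 2 = X v h ^+ 2 + Y v h ^+ 2.
  have EX2 := congr1 (fun x => x ^+ 2) EX; have EY2 := congr1 (fun x => x ^+ 2) EY.
  rewrite /= -/r exprMn in EX2; rewrite /= -/r exprMn in EY2.
  by rewrite [RHS](congr2 +%R EX2 EY2) -mulrDr cos2Dsin2 mulr1.
rewrite -[in leRHS]SE mulrCA ler_wpM2l ?(ltW e0)//.
have := X1; have := Y1; set T := expR _ * S v; move=> Y1' X1'.
have T0 : 0 <= T := le_trans (normr_ge0 _) X1'.
suff : r ^+ 2 <= (2 * T) ^+ 2.
  by rewrite ler_pXn2r// ?nnegrE ?mulr_ge0// ltW.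
rewrite r2 exprMn.
have XX : X v h ^+ 2 <= T ^+ 2.
  by rewrite -[X in X <= _]real_normK ?num_real// lerXn2r ?nnegrE ?normr_ge0.
have YY : Y v h ^+ 2 <= T ^+ 2.
  by rewrite -[X in X <= _]real_normK ?num_real// lerXn2r ?nnegrE ?normr_ge0.
have := sqr_ge0 T; nra.
Qed.

(** With [g (zeta) = \sum_i C i exp (E i zeta)], [LU + i LV] is the branch of
    [ln (g) / 2] which is real for real [zeta]. Taking out the factor
    [exp (m zeta)], [m] being the mean of the extreme exponents, leaves a
    function with values in a sector of half-angle less than [pi / 2], on which
    the logarithm is given by the arctangent. *)
Lemma log_root : exists LU LV : R -> R -> R,
  [/\ hol h1 LU LV, forall v, LV v 0 = 0,
      forall v h, 0 <= h < h1 -> lo / 2 * h <= LV v h <= hi / 2 * h,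
      forall v h, 0 <= h < h1 -> expR (2 * LU v h) * sin (2 * LV v h) =
        \sum_i C i * expR (E i * v) * sin (E i * h) &
      forall v h, 0 <= h < h1 ->
        cos ((hi - lo) / 2 * h) * (\sum_i C i * expR (E i * v))
          <= expR (2 * LU v h) <= 2 * (\sum_i C i * expR (E i * v)) /\
        (h = 0 -> expR (2 * LU v h) = \sum_i C i * expR (E i * v))].
Proof.
have Y0 v : Y v 0 = 0.
  by rewrite /Y big1// => i _; rewrite mulr0 sin0 mulr0.
exists LU, LV; split.
- exact: hol_L.
- by move=> v; rewrite /LV Y0 mul0r atan0 !mulr0 mul0r !addr0.
- move=> v h hh; have := atan_le v hh; rewrite ler_norml.
  have -> : LV v h = (m * h + atan (Y v h / X v h)) / 2 by rewrite -LVE; field.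
  by rewrite /m /d => /andP[? ?]; apply/andP; split; lra.
- exact: im_g.
- move=> v h hh; have [H1 H2] := N_bounds v hh; split; first by rewrite H1.
  move=> h0; move: hh; rewrite h0 => hh.
  rewrite LUE Y0 mulr0 addr0 expRD; have X0 := X_gt0 v hh.
  rewrite -expr2 lnXn// -[ln _ *+ 2]mulr_natl mulrA mulVf// mul1r lnK ?posrE//.
  rewrite /X mulr_sumr; apply: eq_bigr => i _.
  rewrite mulr0 cos0 mulr1 coefE mulrA -expRD mulNr subrr expR0 mul1r//.
Qed.

End LogRoot.
End Strip.

(** * Stieltjes functions *)
Section Stieltjes.
Context {R : realType}.
Notation mu := (@lebesgue_measure R).

Lemma powR_expR (s E : R) : 0 < s -> s `^ E = expR (E * ln s).
Proof. by move=> s0; rewrite /powR gt_eqF. Qed.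

Lemma ch_shift_inv (v v0 : R) :
  (ch (v - v0))^-1 = 2 * expR v0 * expR v / (expR (2 * v0) + expR (2 * v)).
Proof.
have ex (x : R) : expR (2 * x) = expR x * expR x by rewrite -expRD; congr expR; ring.
rewrite /ch opprB !expRD !expRN !ex; have a0 := expR_gt0 v; have b0 := expR_gt0 v0.
field; rewrite !lt0r_neq0 ?addr_gt0 ?mulr_gt0 ?invr_gt0//.
Qed.

Section Family.
Context {I : finType}.
Variables (C A : I -> R) (i0 : I) (lo hi : R).
Hypotheses (C_gt0 : forall i, 0 < C i) (lo_gt0 : 0 < lo)
  (A_lo : forall i, lo <= A i) (A_hi : forall i, A i <= hi)
  (hi_lo : hi - lo < 1) (hi_lt2 : hi < 2) (A_ge1 : 1 <= A i0).

Let psi (s : R) := Num.sqrt (\sum_i C i * s `^ A i).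

(** With [s = exp (2 zeta)] the plane slit along the negative axis becomes the strip
    [|Im zeta| < pi / 2], on whose boundary [- s] is [exp (2 v)]. The Poisson
    formula is applied to [U + i V = exp zeta / (1 + y psi)], which is bounded
    because an exponent is at least [1], and whose real part on the boundary is
    [exp v] times the imaginary part of [- 1 / (1 + y psi)], a non-negative
    number. *)
Lemma inv_1psi_stieltjes (y : R) : 0 < y -> exists rho : R -> R,
  [/\ measurable_fun setT rho, forall v, 0 <= rho v &
      forall s, 0 < s ->
        mu.-integrable setT (fun v => (rho v / (s + expR (2 * v)))%:E) /\
        (1 + y * psi s)^-1 = \int[mu]_(v in [set: R]) (rho v / (s + expR (2 * v)))].
Proof.
move=> y0; have pi0 := pi_gt0 R.
have := hi_lt2; have := lo_gt0; have := hi_lo => hilo' lo0' hi2'.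
have hi1 : 1 <= hi := le_trans A_ge1 (A_hi i0).
have lohi : lo <= hi := le_trans (A_lo i0) (A_hi i0).
pose k := Num.max (hi - lo) (hi / 2).
have k0 : 0 < k by rewrite lt_max; apply/orP; right; lra.
have k1 : k < 1 by rewrite gt_max hi_lo/=; lra.
pose h1 := pi / 2 / k.
have h1pi : pi / 2 < h1 by rewrite /h1 ltr_pdivlMr// gtr_pMr ?divr_gt0.
have kh h : 0 <= h < h1 -> 0 <= h /\ k * h < pi / 2.
  by move=> /andP[h0 hh]; split=> //; rewrite mulrC -ltr_pdivlMr.
have dk : hi - lo <= k by rewrite le_max lexx.
have hk : hi / 2 <= k by rewrite le_max lexx orbT.
have dE : (2 * hi - 2 * lo) / 2 = hi - lo by field.
have dh h : 0 <= h < h1 -> (2 * hi - 2 * lo) / 2 * h < pi / 2.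
  move=> /kh[h0]; apply: le_lt_trans.
  by rewrite dE ler_wpM2r.
have E_lo i : 2 * lo <= 2 * A i by rewrite ler_pM2l.
have E_hi i : 2 * A i <= 2 * hi by rewrite ler_pM2l.
have [LU [LV [hL LV0 LVb _ LUb]]] := @log_root R I C (fun i => 2 * A i) i0
  (2 * lo) (2 * hi) h1 C_gt0 E_lo E_hi dh.
have LV_in v h : 0 <= h < h1 -> 0 <= LV v h < pi.
  move=> hh; have := LVb v h hh; have [h0 khh] := kh h hh.
  have : hi * h <= 2 * (k * h) by rewrite mulrA ler_wpM2r//; lra.
  have : 0 <= lo * h by rewrite mulr_ge0// ltW.
  have -> : 2 * lo / 2 = lo by field.
  have -> : 2 * hi / 2 = hi by field.
  by move=> ? ? /andP[? ?]; apply/andP; split; lra.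
(* QU + i QV = 1 + y psi *)
pose QU v h := 1 + (y * (expR (LU v h) * cos (LV v h)) - 0 * (expR (LU v h) * sin (LV v h))).
pose QV v h := 0 + (y * (expR (LU v h) * sin (LV v h)) + 0 * (expR (LU v h) * cos (LV v h))).
have hQ : hol h1 QU QV.
  apply: (@holD _ h1 (fun _ _ => 1) (fun _ _ => 0)); first exact: hol_cst.
  apply: (@holM _ h1 (fun _ _ => y) (fun _ _ => 0)); first exact: hol_cst.
  exact: hol_expR.
pose QN v h := QU v h * QU v h + QV v h * QV v h.
have QUE v h : QU v h = 1 + y * expR (LU v h) * cos (LV v h) by rewrite /QU; ring.
have QVE v h : QV v h = y * expR (LU v h) * sin (LV v h) by rewrite /QV; ring.
have QNE v h : QN v h = 1 + 2 * (y * expR (LU v h)) * cos (LV v h) +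
    (y * expR (LU v h)) ^+ 2.
  rewrite /QN QUE QVE; have := cos2Dsin2 (LV v h).
  move: (cos _) (sin _) (y * _) => c s r E.
  transitivity (1 + 2 * r * c + r ^+ 2 * (c ^+ 2 + s ^+ 2)); first by ring.
  by rewrite E mulr1.
have rgt0 v h : 0 < y * expR (LU v h) by rewrite mulr_gt0 ?expR_gt0.
have QN_gt0 v h : 0 <= h < h1 -> 0 < QN v h.
  move=> hh; rewrite QNE; have := rgt0 v h; set r := y * _ => r0.
  have : -1 < cos (LV v h).
    have /andP[L0 Lpi] := LV_in v h hh.
    rewrite -cospi ltr_cos// in_itv/= ?L0 ?(ltW Lpi)//.
    by rewrite lexx (ltW pi0).
  move: (cos _) => c cgt.
  have : 0 <= (1 - r) ^+ 2 by exact: sqr_ge0.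
  have : 0 < r * (1 + c) by rewrite mulr_gt0//; lra.
  by rewrite expr2; nra.
pose U v h := expR (1 * v + 0) * cos (1 * h) * (QU v h / QN v h) -
  expR (1 * v + 0) * sin (1 * h) * (- QV v h / QN v h).
pose V v h := expR (1 * v + 0) * cos (1 * h) * (- QV v h / QN v h) +
  expR (1 * v + 0) * sin (1 * h) * (QU v h / QN v h).
have hUV : hol h1 U V.
  apply: holM; first exact/hol_expR/hol_lin.
  by apply: holV => // v h hh; rewrite lt0r_neq0// QN_gt0.
have V0 v : V v 0 = 0.
  rewrite /V mulr0 sin0 cos0 QVE LV0 sin0; ring.
(* uniform lower bound for |Q| on the closed strip *)
pose c1 := - cos (hi * (pi / 2)).
have hipi : hi * (pi / 2) < pi by rewrite mulrCA gtr_pMr//; lra.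
have hipi0 : 0 <= hi * (pi / 2) by rewrite mulr_ge0//; lra.
have c1lt : c1 < 1.
  rewrite ltrNl -cospi ltr_cos// in_itv/= ?hipi0 ?(ltW hipi)//.
  by rewrite lexx (ltW pi0).
have c10 : 0 <= c1.
  rewrite oppr_ge0 -cos_pihalf; apply: cos_ge_of_le; last exact: ltW.
  by rewrite ger0_norm ?divr_ge0 ?(ltW pi0)// ler_peMl// divr_ge0 ?(ltW pi0).
have in_h1 h : 0 <= h <= pi / 2 -> 0 <= h < h1.
  by move=> /andP[-> /le_lt_trans]; apply.
pose S0 v := \sum_i C i * expR (2 * A i * v).
have S0_ge v : 0 <= v -> C i0 * expR v ^+ 2 <= S0 v.
  move=> v0; rewrite /S0 (bigD1 i0)//= ler_wpDr//.
    by apply: sumr_ge0 => i _; rewrite mulr_ge0 ?expR_ge0 ?(ltW (C_gt0 i)).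
  rewrite ler_wpM2l ?(ltW (C_gt0 i0))// -expRM_natl ler_expR.
  by rewrite ler_wpM2r//; have := A_ge1; lra.
pose cd := cos ((2 * hi - 2 * lo) / 2 * (pi / 2)).
have cd0 : 0 < cd.
  have := dh (pi / 2); rewrite h1pi andbT divr_ge0 ?(ltW pi0)// => /(_ isT) H.
  apply: cos_gt0_pihalf; rewrite H andbT dE.
  have : 0 <= (hi - lo) * (pi / 2) by rewrite mulr_ge0 ?divr_ge0 ?(ltW pi0)//; lra.
  by lra.
pose q := y * Num.sqrt (cd * C i0).
have q0 : 0 < q by rewrite mulr_gt0// sqrtr_gt0 mulr_gt0.
have r_ge v h : 0 <= h <= pi / 2 -> 0 <= v -> q * expR v <= y * expR (LU v h).
  move=> hh v0; rewrite /q -mulrA ler_pM2l//.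
  have /andP[h0 hpi] := hh.
  have [/andP[H _] _] := LUb v h (in_h1 h hh).
  have e0 := expR_gt0 (LU v h).
  rewrite -[leRHS]ger0_norm ?(ltW e0)// -sqrtr_sqr.
  rewrite -[X in _ * X <= _]ger0_norm ?expR_ge0// -[X in _ * X <= _]sqrtr_sqr.
  rewrite -sqrtrM ?mulr_ge0 ?(ltW cd0) ?(ltW (C_gt0 i0))//.
  rewrite ler_wsqrtr// -[expR (LU v h) ^+ 2]expRM_natl; apply: le_trans H.
  rewrite -[leLHS]mulrA ler_pM//.
  - exact: (ltW cd0).
  - by rewrite mulr_ge0 ?exprn_ge0 ?expR_ge0 ?(ltW (C_gt0 i0)).
  - apply: cos_ge_of_le.
      rewrite ger0_norm; last by rewrite dE mulr_ge0//; lra.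
      by rewrite ler_wpM2l// dE; lra.
    apply: le_trans (_ : pi / 2 <= _); last by lra.
    apply: ltW; apply: dh; rewrite h1pi andbT; lra.
  - exact: S0_ge.
have ev_le v h : 0 <= h <= pi / 2 -> expR v <= 1 + y * expR (LU v h) / q.
  move=> hh; have [v0|v0] := leP 0 v.
    have H : expR v <= y * expR (LU v h) / q by rewrite ler_pdivlMr// mulrC r_ge.
    by rewrite (le_trans H)// lerDr.
  have : expR v <= 1 by rewrite -expR0 ler_expR ltW.
  have : 0 <= y * expR (LU v h) / q by rewrite divr_ge0 ?ltW.
  by lra.
have QN_ge v h : 0 <= h <= pi / 2 ->
    (1 - c1) / 1 * (1 + (y * expR (LU v h)) ^+ 2) / 1 <= QN v h.
  move=> hh; rewrite QNE; have := rgt0 v h; set r := y * _ => r0.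
  have : - c1 <= cos (LV v h).
    rewrite opprK; have /andP[L0 Lpi] := LV_in v h (in_h1 h hh).
    have /andP[h0 hpi] := hh.
    apply: cos_ge_of_le; last exact: ltW.
    rewrite ger0_norm//; have := LVb v h (in_h1 h hh).
    have -> : 2 * hi / 2 = hi by field.
    move=> /andP[_ /le_trans]; apply.
    by rewrite ler_wpM2l//; lra.
  move: (cos (LV v h)) => c cge.
  have : 0 <= c1 * (1 - r) ^+ 2 by rewrite mulr_ge0 ?sqr_ge0.
  have : 0 <= r * (c + c1) by apply: mulr_ge0; [exact: ltW|lra].
  rewrite !divr1 !expr2; lra.
pose K := 4 * (1 + q^-1) / (1 - c1).
have bound v h : 0 <= h <= pi / 2 -> `|U v h| <= 2 * K /\ `|V v h| <= 2 * K.
  move=> hh; have QN0 := QN_gt0 v h (in_h1 h hh); have ev := ev_le v h hh.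
  have QNg := QN_ge v h hh; have r0 := rgt0 v h.
  set r := y * _ in ev QNg r0.
  have e0 := expR_gt0 v.
  have key a b : `|a| <= 1 -> `|b| <= 1 + r ->
      `|expR (1 * v + 0) * a * (b / QN v h)| <= K.
    move=> a1 b1; rewrite mul1r addr0 !normrM normfV.
    rewrite (gtr0_norm QN0) (gtr0_norm e0).
    apply: (@le_trans _ _ ((1 + r / q) * 1 * ((1 + r) / QN v h))).
      apply: ler_pM => //; rewrite ?mulr_ge0 ?invr_ge0 ?(ltW e0) ?(ltW QN0)//.
        by apply: ler_pM => //; exact: ltW.
      by rewrite ler_wpM2r// invr_ge0 ltW.
    rewrite mulr1 mulrA ler_pdivrMr// /K.
    have t0 : 0 < q^-1 by rewrite invr_gt0.
    have c1lt' : 0 < 1 - c1 by lra.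
    apply: le_trans (_ : 4 * (1 + q^-1) / (1 - c1) *
       ((1 - c1) / 1 * (1 + r ^+ 2) / 1) <= _); last first.
      by rewrite ler_wpM2l// divr_ge0 ?(ltW c1lt')// mulr_ge0 ?addr_ge0 ?(ltW t0).
    rewrite !divr1 mulrA mulfVK ?lt0r_neq0//.
    move: (q^-1) t0 => t t0; rewrite expr2.
    have : 0 <= (1 - r) ^+ 2 by exact: sqr_ge0.
    have : 0 <= t * (1 - r) ^+ 2 by rewrite mulr_ge0 ?sqr_ge0 ?ltW.
    have : 0 <= t * r by rewrite mulr_ge0 ?ltW.
    rewrite !expr2; nra.
  have QUb : `|QU v h| <= 1 + r.
    rewrite QUE (le_trans (ler_normD _ _))// normr1 lerD2l normrM.
    by rewrite (gtr0_norm r0) ler_piMr ?cos_max ?ltW.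
  have QVb : `|- QV v h| <= 1 + r.
    rewrite normrN QVE normrM (gtr0_norm r0).
    rewrite (@le_trans _ _ (r * 1))// ?ler_wpM2l ?sin_max ?(ltW r0)//.
    by rewrite mulr1 lerDr.
  rewrite (mulr_natl K 2) mulr2n; split.
    rewrite (le_trans (ler_normB _ _))// lerD//.
      by apply: key QUb; exact: cos_max.
    by apply: key QVb; exact: sin_max.
  rewrite (le_trans (ler_normD _ _))// lerD//.
    by apply: key QVb; exact: cos_max.
  by apply: key QUb; exact: sin_max.
have [A' [B' H]] := hUV.
have poisson v0 := @strip_poisson R U V A' B' h1 (2 * K) v0 h1pi H V0
  (fun v h hh => (bound v h hh).1) (fun v h hh => (bound v h hh).2).
have p_in : 0 <= (pi / 2 : R) <= pi / 2 by rewrite lexx andbT; lra.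
have UpiE v : U v (pi / 2) = expR v * (QV v (pi / 2) / QN v (pi / 2)).
  rewrite /U !mul1r cos_pihalf sin_pihalf addr0; ring.
have Upi0 v : 0 <= U v (pi / 2).
  rewrite UpiE mulr_ge0 ?expR_ge0// divr_ge0 ?(ltW (QN_gt0 _ _ (in_h1 _ p_in)))//.
  rewrite QVE mulr_ge0 ?(ltW (rgt0 _ _))//; apply: sin_ge0_pi.
  have /andP[-> L] := LV_in v _ (in_h1 _ p_in); exact: ltW.
exists (fun v => 2 * expR v * U v (pi / 2) / pi); split.
- apply: continuous_measurable_fun => v.
  apply: cvgM; last exact: cvg_cst.
  apply: cvgM; last exact: (holo_cts1 (holo_cU (H v _ (in_h1 _ p_in)))).
  by apply: cvgM; [exact: cvg_cst|exact: continuous_expR].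
- by move=> v; rewrite divr_ge0 ?(ltW pi0)// !mulr_ge0 ?expR_ge0.
- move=> s s0; pose v0 := ln s / 2.
  have sE : s = expR (2 * v0) by rewrite /v0 mulrC mulfVK// lnK// posrE.
  have [P1 P2] := poisson v0; have ev0 := expR_gt0 v0.
  have E v : 2 * expR v * U v (pi / 2) / pi / (s + expR (2 * v)) =
      (expR v0 * pi)^-1 * (U v (pi / 2) / ch (v - v0)).
    rewrite ch_shift_inv sE; move: (U v _) => u; have := pi0; move: (@pi R) => p p0.
    by field; rewrite !lt0r_neq0 ?addr_gt0 ?expR_gt0.
  split.
    apply: (@integrable_EFin_eq _ _ _ mu setT measurableT
      (fun v => (expR v0 * pi)^-1 * (U v (pi / 2) / ch (v - v0)))).
      by move=> v _; rewrite E.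
    exact: integrable_EFinZl.
  rewrite (@eq_Rintegral _ _ _ mu _
    (fun v => (expR v0 * pi)^-1 * (U v (pi / 2) / ch (v - v0)))); last first.
    by move=> v _; rewrite E.
  rewrite RintegralZl// P2.
  have -> : U v0 0 = expR v0 * (1 + y * psi s)^-1.
    have z_in : 0 <= (0 : R) < h1 by rewrite lexx (le_lt_trans _ h1pi)//; lra.
    have LUp : expR (LU v0 0) = psi s.
      have [_ /(_ erefl) LU2] := LUb v0 0 z_in.
      rewrite /psi (_ : \sum_i _ = expR (LU v0 0) ^+ 2).
        by rewrite sqrtr_sqr ger0_norm ?expR_ge0.
      rewrite -expRM_natl LU2; apply: eq_bigr => i _; congr (_ * _).
      by rewrite powR_expR// sE expRK; congr expR; ring.
    have QN00 : QN v0 0 = (1 + y * psi s) ^+ 2.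
      by rewrite /QN QUE QVE LV0 sin0 cos0 LUp; ring.
    rewrite /U !mulr0 sin0 cos0 mul1r addr0 QN00 QUE LV0 cos0 LUp.
    by field; rewrite lt0r_neq0// ltr_pwDl// mulr_ge0 ?sqrtr_ge0// ltW.
  have := pi0; move: (@pi R) => p p0.
  have : 0 < 1 + y * psi s by rewrite ltr_pwDl// mulr_ge0 ?sqrtr_ge0// ltW.
  by move: (psi s) => z z0; field; rewrite !lt0r_neq0.
Qed.

End Family.
End Stieltjes.

Section StieltjesCM.
Context {R : realType}.
Notation mu := (@lebesgue_measure R).

(** A Stieltjes function [F] with limit [1] at the origin and the quotient
    [(1 - F s) / s]: the latter is the limit, as [e] tends to [0], of
    [(F e - F s) / (s - e)], which is a Stieltjes function as well. *)
Lemma stieltjes_cm (F rho : R -> R) : measurable_fun setT rho ->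
  (forall v, 0 <= rho v) ->
  (forall s, 0 < s ->
     mu.-integrable setT (fun v => (rho v / (s + expR (2 * v)))%:E) /\
     F s = \int[mu]_(v in [set: R]) (rho v / (s + expR (2 * v)))) ->
  F e @[e --> (0 : R)^'+] --> (1 : R) ->
  cm F /\ cm (fun s => (1 - F s) / s).
Proof.
move=> mrho rho0 HF F1.
have e20 (v : R) : 0 < expR (2 * v) := expR_gt0 _.
split=> n.
  apply: (@cmn_eq _ n (fun s => \int[mu]_(v in [set: R]) (rho v / (s + expR (2 * v))))).
    by move=> s s0; rewrite (HF s s0).2.
  apply: (@cmn_int _ n _ _ mu setT (fun v s => rho v / (s + expR (2 * v)))) => //.
    by move=> s s0; exact: (HF s s0).1.
  by move=> v _; apply: cmnZ => //; apply: cmn_inv; exact: ltW.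
pose k e v s := rho v / ((e + expR (2 * v)) * (s + expR (2 * v))).
have kE e v s : k e v s = (e + expR (2 * v))^-1 * (rho v / (s + expR (2 * v))).
  by rewrite /k invfM mulrCA mulrA.
have ik e s : 0 < e -> 0 < s -> mu.-integrable setT (fun v => (k e v s)%:E).
  move=> e0 s0; apply: (@integrable_EFin_le _ _ _ mu setT measurableT _
      (fun v => e^-1 * (rho v / (s + expR (2 * v))))).
  - apply: measurable_funM => //; apply: continuous_measurable_fun => v.
    have ce : (expR (2 * v0))%R @[v0 --> v] --> expR (2 * v).
      apply: continuous_cvg; first exact: continuous_expR.
      by apply: cvgM; [exact: cvg_cst|exact: cvg_id].
    apply: cvgV; first by rewrite lt0r_neq0// mulr_gt0 ?addr_gt0.
    by apply: cvgM; apply: cvgD => //; exact: cvg_cst.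
  - move=> v _; rewrite kE; have s1 : 0 < s + expR (2 * v) by rewrite addr_gt0.
    have e1 : 0 < e + expR (2 * v) by rewrite addr_gt0.
    have q0 : 0 <= rho v / (s + expR (2 * v)) by rewrite divr_ge0 ?(ltW s1).
    rewrite ger0_norm; last by rewrite mulr_ge0// invr_ge0 ltW.
    by rewrite ler_wpM2r// lef_pV2 ?posrE// lerDl ltW.
  - by apply: integrable_EFinZl => //; exact: (HF s s0).1.
pose D e s := \int[mu]_(v in [set: R]) k e v s.
have cD e : 0 < e -> cmn n (D e).
  move=> e0; apply: (@cmn_int _ n _ _ mu setT (k e)) => //.
    by move=> s s0; exact: ik.
  move=> v _; apply: (@cmn_eq _ n (fun s => (rho v / (e + expR (2 * v))) *
      (s + expR (2 * v))^-1)).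
    by move=> s s0; rewrite /k invfM mulrA.
  apply: cmnZ; last by apply: cmn_inv; exact: ltW.
  by rewrite divr_ge0// addr_ge0 ?ltW.
have DE e s : 0 < e -> 0 < s -> F e - F s = (s - e) * D e s.
  move=> e0 s0; rewrite (HF e e0).2 (HF s s0).2 -RintegralB//; last 2 first.
    exact: (HF e e0).1.
    exact: (HF s s0).1.
  rewrite /D -RintegralZl//; last exact: ik.
  apply: eq_Rintegral => v _; rewrite /k; field.
  by rewrite !lt0r_neq0 ?addr_gt0.
apply: (@cmn_lim _ n _ 0^'+ _ D).
  by near=> e; apply: cD; near: e; exact: nbhs_right_gt.
move=> s s0.
have E : {near (0 : R)^'+, (fun e => (F e - F s) / (s - e)) =1 D ^~ s}.
  near=> e; have e0 : 0 < e by near: e; exact: nbhs_right_gt.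
  rewrite DE//.
  have es : e < s by near: e; exact: nbhs_right_lt.
  by rewrite mulrC mulKf// subr_eq0 gt_eqF.
apply: (cvg_trans (near_eq_cvg E)).
apply: cvgM; first by apply: cvgB => //; exact: cvg_cst.
have lim_s : (s - e) @[e --> (0 : R)^'+] --> s.
  rewrite -[X in _ --> X]subr0; apply: cvgB; first exact: cvg_cst.
  exact/cvg_at_right_filter/cvg_id.
by apply: cvgV lim_s; rewrite gt_eqF.
Unshelve. all: by end_near. Qed.

End StieltjesCM.

Section SymbolFamily.
Context {R : realType}.
Variables (alpha c : R) (m : nat) (a cs : 'I_m -> R).

(** [alpha, alpha_1, ..., alpha_m] and [c, c_1, ..., c_m] as single families, so
    that [symbol_g] is one sum of powers. *)
Definition fam (x : R) (f : 'I_m -> R) (i : 'I_m.+1) : R :=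
  oapp f x (unlift ord0 i).

Lemma fam_ind (P : R -> Prop) x f : P x -> (forall j, P (f j)) ->
  forall i, P (fam x f i).
Proof. by move=> Px Pf i; rewrite /fam; case: unliftP => [j _|_] /=. Qed.

Lemma fam0 x f : fam x f ord0 = x.
Proof. by rewrite /fam unlift_none. Qed.

Lemma sum_fam (F : R -> R -> R) :
  \sum_i F (fam c cs i) (fam alpha a i) = F c alpha + \sum_(j < m) F (cs j) (a j).
Proof.
rewrite big_ord_recl !fam0; congr (_ + _); apply: eq_bigr => j _.
by rewrite /fam liftK.
Qed.

End SymbolFamily.

Section SymbolCM.
Context {R : realType}.
Variables (c : R) (m : nat) (a cs : 'I_m -> R).
Hypotheses (c_gt0 : 0 < c) (cs_gt0 : forall j, 0 < cs j)
  (a_gt0 : forall j, 0 < a j).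

Let psi alpha s := Num.sqrt (symbol_g alpha c a cs s).

Lemma symbol_fam alpha s :
  symbol_g alpha c a cs s = \sum_i fam c cs i * s `^ fam alpha a i.
Proof. by rewrite (sum_fam alpha c a cs (fun C A => C * s `^ A)). Qed.

Lemma symbol_cvg0 alpha : 0 < alpha ->
  symbol_g alpha c a cs s @[s --> (0 : R)^'+] --> (0 : R).
Proof.
move=> al0; rewrite -[X in _ --> X]addr0 /symbol_g; apply: cvgD.
  by rewrite -[X in _ --> X](mulr0 c); apply: cvgM; [exact: cvg_cst|exact: powR_cvg0].
rewrite [X in _ --> X](_ : 0 = \sum_(j < m) 0); last by rewrite big1.
apply: cvg_big => [|j _]; first exact: add_continuous.
rewrite -[X in _ --> X](mulr0 (cs j)); apply: cvgM; first exact: cvg_cst.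
exact: powR_cvg0.
Qed.

Lemma inv_1psi_cvg1 alpha y : 0 < alpha ->
  (1 + y * psi alpha s)^-1 @[s --> (0 : R)^'+] --> (1 : R).
Proof.
move=> al0.
have psi0 : psi alpha s @[s --> (0 : R)^'+] --> (0 : R).
  rewrite -[X in _ --> X]sqrtr0.
  by apply: continuous_cvg; [exact: sqrt_continuous|exact: symbol_cvg0].
rewrite -[X in _ --> X]invr1; apply: cvgV; first exact: oner_neq0.
rewrite -[X in _ --> X]addr0; apply: cvgD; first exact: cvg_cst.
by rewrite -[X in _ --> X](mulr0 y); apply: cvgM; first exact: cvg_cst.
Qed.

Lemma inv_1psi_cm_strict alpha lo y : 1 <= alpha -> alpha < 2 ->
  0 < lo -> lo <= alpha -> (forall j, lo <= a j) -> (forall j, a j <= alpha) ->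
  alpha - lo < 1 -> 0 < y ->
  cm (fun s => (1 + y * psi alpha s)^-1) /\
  cm (fun s => (1 - (1 + y * psi alpha s)^-1) / s).
Proof.
move=> al1 al2 lo0 loal loa aal allo y0.
have [] := @inv_1psi_stieltjes R 'I_m.+1 (fam c cs) (fam alpha a) ord0 lo alpha
  _ lo0 _ _ allo al2 _ y y0.
- by apply: (fam_ind (P := fun x => 0 < x)).
- by apply: (fam_ind (P := fun x => lo <= x)).
- by apply: (fam_ind (P := fun x => x <= alpha)).
- by rewrite fam0.
move=> rho [mrho rho0 Hrho].
apply: (stieltjes_cm mrho rho0); last first.
  by apply: inv_1psi_cvg1; rewrite (lt_le_trans lo0).
by move=> s s0; have [H1 H2] := Hrho s s0; split=> //; rewrite -H2 -symbol_fam.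
Qed.

Lemma symbol_cvg_alpha alpha s : 0 < s ->
  symbol_g b c a cs s @[b --> alpha^'-] --> symbol_g alpha c a cs s.
Proof.
move=> s0; rewrite /symbol_g; apply: cvgD; last exact: cvg_cst.
apply: cvgM; first exact: cvg_cst.
have -> : powR s = (fun b => expR (b * ln s)).
  by apply/funext => b; rewrite powR_expR.
apply: cvg_at_left_filter.
apply: continuous_cvg; first exact: continuous_expR.
by apply: cvgM; [exact: cvg_id|exact: cvg_cst].
Qed.

(** Lowering the leading exponent slightly makes the bounds [2] on [alpha] and
    [1] on [alpha - lo] strict, so that [1 + y psi] has no zero slightly beyond
    the closed strip either. Complete monotonicity survives the limit. *)
Lemma inv_1psi_cm alpha lo y : 1 < alpha <= 2 -> 0 < lo -> lo <= alpha ->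
  (forall j, lo <= a j) -> (forall j, a j < alpha) -> alpha - lo <= 1 -> 0 < y ->
  cm (fun s => (1 + y * psi alpha s)^-1) /\
  cm (fun s => (1 - (1 + y * psi alpha s)^-1) / s).
Proof.
move=> /andP[al1 al2] lo0 loal loa aal allo y0.
pose M := \big[Num.max/1]_(j < m) a j.
have M_lt : M < alpha by apply: bigmax_lt.
have a_le b j : M < b -> a j <= b.
  by move=> /ltW; apply: le_trans; exact: le_bigmax.
have b_gt1 b : M < b -> 1 <= b.
  by move=> /ltW; apply: le_trans; exact: bigmax_ge_id.
have strict b : M < b -> b < alpha ->
    cm (fun s => (1 + y * psi b s)^-1) /\
    cm (fun s => (1 - (1 + y * psi b s)^-1) / s).
  move=> Mb bal; have b1 := b_gt1 b Mb.
  apply: (@inv_1psi_cm_strict b (Num.min lo b)) => //.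
  - exact: lt_le_trans bal al2.
  - by rewrite lt_min lo0 (lt_le_trans ltr01).
  - by rewrite ge_min lexx orbT.
  - by move=> j; rewrite ge_min loa.
  - by move=> j; exact: a_le.
  - by rewrite ltrBlDr -ltrBlDl lt_min; apply/andP; split; lra.
have near_strict : \forall b \near alpha^'-, M < b /\ b < alpha.
  near=> b; split; near: b; [exact: nbhs_left_gt|exact: nbhs_left_lt].
have lim s : 0 < s ->
    (1 + y * psi b s)^-1 @[b --> alpha^'-] --> (1 + y * psi alpha s)^-1.
  move=> s0; apply: cvgV.
    by rewrite lt0r_neq0// ltr_pwDl// mulr_ge0 ?sqrtr_ge0// ltW.
  apply: cvgD; first exact: cvg_cst.
  apply: cvgM; first exact: cvg_cst.
  apply: continuous_cvg; first exact: sqrt_continuous.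
  exact: symbol_cvg_alpha.
split=> n.
  apply: (@cmn_lim _ n _ alpha^'- _ (fun b s => (1 + y * psi b s)^-1)) => //.
  by apply: filterS near_strict => b [Mb bal]; exact: (strict b Mb bal).1.
apply: (@cmn_lim _ n _ alpha^'- _ (fun b s => (1 - (1 + y * psi b s)^-1) / s)).
  by apply: filterS near_strict => b [Mb bal]; exact: (strict b Mb bal).2.
move=> s s0; apply: cvgM; last exact: cvg_cst.
by apply: cvgB; [exact: cvg_cst|exact: lim].
Unshelve. all: by end_near. Qed.

End SymbolCM.

(** * Monotonicity of the propagation function *)
Section Monotonicity.
Context {R : realType}.
Notation mu := (@lebesgue_measure R).
Notation Rpos := `]0%R, +oo[%classic.

Lemma laplace_shift (f : R -> R) (d s : R) : 0 <= d ->
  mu.-integrable Rpos (fun t => (expR (- s * t) * f t)%:E) ->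
  let g t := if d < t then f (t - d) else 0 in
  mu.-integrable Rpos (fun t => (expR (- s * t) * g t)%:E) /\
  \int[mu]_(t in Rpos) (expR (- s * t) * g t) =
  expR (- s * d) * \int[mu]_(t in Rpos) (expR (- s * t) * f t).
Proof.
move=> d0 fi g.
pose G := (fun t => expR (- s * t) * f t) \_ Rpos.
have Gi : mu.-integrable setT (fun t => (G t)%:E).
  have := (integrable_mkcond (mu := mu) (fun t => (expR (- s * t) * f t)%:E)
    (measurable_itv `]0, +oo[)).1 fi.
  by rewrite /G restrict_EFin.
have E t : (fun t => expR (- s * t) * g t) \_ Rpos t = expR (- s * d) * G (t - d).
  rewrite /G !patchE /g; have [dt|td] := ltP d t.
    rewrite !mem_set/= ?in_itv/= ?andbT ?subr_gt0//; last first.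
      exact: le_lt_trans d0 dt.
    by rewrite mulrA -expRD; congr (expR _ * _); ring.
  rewrite [X in _ = _ * X]ifF ?mulr0//; first by case: ifP => //; rewrite mulr0.
  by apply/negbTE/negP; rewrite inE/= in_itv/= andbT subr_gt0 ltNge td.
have gi : mu.-integrable setT
    (fun t => ((fun t => expR (- s * t) * g t) \_ Rpos t)%:E).
  apply: (@integrable_EFin_eq _ _ _ mu setT measurableT
    (fun t : R => expR (- s * d) * G (t - d))).
    by move=> t _; rewrite E.
  by apply: integrable_EFinZl => //; exact: (integrable_shift (- d) Gi).
split.
  apply/(integrable_mkcond (mu := mu) (fun t => (expR (- s * t) * g t)%:E)
    (measurable_itv `]0, +oo[)).
  by rewrite restrict_EFin.
rewrite Rintegral_mkcond (@eq_Rintegral _ _ _ mu _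
  (fun t : R => expR (- s * d) * G (t - d))); last by move=> t _; rewrite E.
rewrite RintegralZl//; last exact: (integrable_shift (- d) Gi).
congr (_ * _); rewrite [RHS]Rintegral_mkcond.
exact: (Rintegral_shift (- d) Gi).
Qed.

Variables (psi : R -> R) (w : R -> R -> R).
Hypotheses (psi_ge0 : forall s, 0 < s -> 0 <= psi s)
  (psi_cm : forall y, 0 < y -> cm (fun s => (1 + y * psi s)^-1) /\
     cm (fun s => (1 - (1 + y * psi s)^-1) / s))
  (w_cont : forall x t, 0 < x -> 0 < t -> w x t' @[t' --> t^'+] --> w x t)
  (w_int : forall x s, 0 < x -> 0 < s ->
     mu.-integrable Rpos (fun t => (expR (- s * t) * w x t)%:E))
  (w_lap : forall x s, 0 < x -> 0 < s ->
     \int[mu]_(t in Rpos) (expR (- s * t) * w x t) =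
     s^-1 * expR (- x * psi s)).

Let cmE x : 0 <= x -> cm (fun s => expR (- x * psi s)).
Proof. by move=> x0; apply: cm_expR => // y /psi_cm []. Qed.

Lemma propagation_ge0 x t : 0 < x -> 0 < t -> 0 <= w x t.
Proof.
move=> x0 t0; apply: (@laplace_ge0 _ (w x) (fun s => s^-1 * expR (- x * psi s))) => //.
- exact: w_cont.
- by move=> s s0; exact: w_int.
- by move=> s s0; exact: w_lap.
- by move=> n; apply: cmnM; [exact: cm_inv_id|exact: cmE (ltW x0) n].
Qed.

(** The transform of the decrement is
    [exp (- x psi) (1 - exp (- (x' - x) psi)) / s]. *)
Lemma propagation_nonincr_x x x' t : 0 < x -> x < x' -> 0 < t -> w x' t <= w x t.
Proof.
move=> x0 xx' t0; rewrite -subr_ge0; have x'0 : 0 < x' by exact: lt_trans xx'.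
have E s : (fun t => expR (- s * t) * (w x t - w x' t)) =
    (fun t => expR (- s * t) * w x t - expR (- s * t) * w x' t).
  by apply/funext => u; rewrite mulrBr.
apply: (@laplace_ge0 _ (fun t => w x t - w x' t)
  (fun s => expR (- x * psi s) * ((1 - expR (- (x' - x) * psi s)) / s))) => //.
- by apply: cvgB; exact: w_cont.
- move=> s s0; apply: (@integrable_EFin_eq _ _ _ mu Rpos _
    (fun t => expR (- s * t) * w x t - expR (- s * t) * w x' t)) => //.
    by move=> u _; rewrite mulrBr.
  by apply: integrable_EFinB => //; exact: w_int.
- move=> s s0; rewrite E RintegralB//; [|exact: w_int|exact: w_int].
  rewrite !w_lap// [RHS]mulrA mulrBr mulr1 -expRD mulrBl mulrC.
  by congr (_ - _); rewrite mulrC; congr (expR _ / _); ring.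
- move=> n; apply: cmnM; first exact: cmE (ltW x0) n.
  apply: cm_1mexpR_div => //; first by rewrite subr_gt0.
    by move=> y /psi_cm [].
  by move=> y /psi_cm [].
Qed.

(** [w x t] is the value at [t'] of [w x] delayed by [d = t' - t], and the delayed
    function has the transform [exp (- d s)] times that of [w x]. *)
Lemma propagation_nondecr_t x t t' : 0 < x -> 0 < t -> t < t' -> w x t <= w x t'.
Proof.
move=> x0 t0 tt'; rewrite -subr_ge0.
pose d := t' - t; have d0 : 0 < d by rewrite subr_gt0.
pose g u := if d < u then w x (u - d) else 0.
have dt' : d < t' by rewrite /d ltrBlDr ltrDl.
have -> : w x t = g t' by rewrite /g dt' /d subKr.
have t'0 : 0 < t' := lt_trans t0 tt'.
have gE s : 0 < s -> _ := fun s0 => @laplace_shift (w x) d s (ltW d0) (w_int x0 s0).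
apply: (@laplace_ge0 _ (fun u => w x u - g u)
  (fun s => ((1 - expR (- d * s)) / s) * expR (- x * psi s))) => //.
- apply: cvgB; first exact: w_cont.
  have -> : g t' = w x t by rewrite /g dt' /d subKr.
  have E : {near t'^'+, (fun u => w x (u - d)) =1 g}.
    near=> u; have t'u : t' < u by near: u; exact: nbhs_right_gt.
    by rewrite /g ifT// (lt_trans dt').
  apply: (cvg_trans (near_eq_cvg E)).
  have := w_cont x0 t0; apply: cvg_trans.
  move=> P /= [e e0 HP]; exists e => // u /= ue t'u.
  apply: HP => /=; last by rewrite /d opprB addrCA ltrDl subr_gt0.
  by move: ue; congr (`|_| < _); rewrite /d; ring.
- move=> s s0; apply: (@integrable_EFin_eq _ _ _ mu Rpos _
    (fun u => expR (- s * u) * w x u - expR (- s * u) * g u)) => //.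
    by move=> u _; rewrite mulrBr.
  by apply: integrable_EFinB => //; [exact: w_int|exact: (gE s s0).1].
- move=> s s0.
  rewrite (@eq_Rintegral _ _ _ mu _
    (fun u => expR (- s * u) * w x u - expR (- s * u) * g u)); last first.
    by move=> u _; rewrite mulrBr.
  rewrite RintegralB//; [|exact: w_int|exact: (gE s s0).1].
  rewrite (gE s s0).2 w_lap// (_ : - s * d = - d * s); last by ring.
  by ring.
- move=> n; apply: cmnM; last exact: cmE (ltW x0) n.
  exact: cm_1mexpR_id d0 n.
Unshelve. all: by end_near. Qed.

End Monotonicity.

(** * Differentiability outside of the classical cases *)
Section ProductIntegral.
Context {R : realType}.
Notation mu := (@lebesgue_measure R).

Section Dominated.
Variables (f : R * R -> R) (p q : R -> R).
Hypotheses (mf : measurable_fun [set: measurableTypeR R * measurableTypeR R] f)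
  (pi_ : mu.-integrable setT (fun x => (p x)%:E))
  (qi : mu.-integrable setT (fun x => (q x)%:E))
  (fpq : forall x y, `|f (x, y)| <= p x * q y).

Lemma integrable_prod_dominated :
  (mu \x mu)%E.-integrable setT (fun z => (f z)%:E).
Proof.
apply/integrable12ltyP; first exact/measurable_EFinP.
pose Q := \int[mu]_y q y.
have QE : (\int[mu]_y (q y)%:E)%E = Q%:E by rewrite /Q /Rintegral fineK// integrable_fin_num.
have mfx x : measurable_fun setT (fun y => f (x, y)).
  exact: (measurableT_comp mf (measurable_pair1 x)).
apply: (@le_lt_trans _ _ (\int[mu]_x (p x * Q)%:E)%E).
  have Qge0 (x : R) : (0 <= \int[mu]_y (`|f (x, y)|%:E))%E.
    by apply: integral_ge0 => y _; rewrite lee_fin.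
  have le_x (x : R) : (\int[mu]_y (`|f (x, y)|%:E) <= (p x * Q)%:E)%E.
    apply: (@le_trans _ _ (\int[mu]_y (p x * q y)%:E)%E).
      apply: ge0_le_integral => //.
      - by apply/measurable_EFinP; apply: measurableT_comp => //; exact: mfx.
      - apply/measurable_EFinP/measurable_funM => //.
        exact: (integrable_EFin_measurable qi).
      - by move=> y _; rewrite lee_fin.
    by under eq_integral do rewrite EFinM; rewrite integralZl// QE.
  apply: ge0_le_integral => //.
  - by move=> x _; exact: Qge0.
  - have mfE : measurable_fun [set: measurableTypeR R * measurableTypeR R]
        (fun z => `|(f z)%:E|)%E.
      by apply: measurableT_comp => //; exact/measurable_EFinP.
    exact: (@measurable_fun_fubini_tonelli_F _ _ _ _ _ mu
      (fun z => `|(f z)%:E|%E) mfE (fun z => abse_ge0 _)).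
  - apply/measurable_EFinP/measurable_funM => //.
    exact: (integrable_EFin_measurable pi_).
  - by move=> x _; exact: le_x.
have : mu.-integrable setT (fun x => (Q * p x)%:E) by exact: integrable_EFinZl.
by move/integrable_lty => H; under eq_integral do rewrite mulrC; exact: H.
Qed.

Let ix x : mu.-integrable setT (fun y => (f (x, y))%:E).
Proof.
apply: (@integrable_EFin_le _ _ _ mu setT measurableT _ (fun y => p x * q y)).
- exact: (measurableT_comp mf (measurable_pair1 x)).
- by move=> y _; exact: fpq.
- exact: integrable_EFinZl.
Qed.

Let iy y : mu.-integrable setT (fun x => (f (x, y))%:E).
Proof.
apply: (@integrable_EFin_le _ _ _ mu setT measurableT _ (fun x => q y * p x)).
- exact: (measurableT_comp mf (measurable_pair2 y)).
- by move=> x _; rewrite mulrC; exact: fpq.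
- exact: integrable_EFinZl.
Qed.

Lemma Rintegral_prod1 :
  \int[(mu \x mu)%E]_z f z = \int[mu]_x (\int[mu]_y f (x, y)).
Proof.
rewrite /Rintegral -(integral12_prod_meas1 integrable_prod_dominated); congr fine.
by apply: eq_integral => x _; rewrite fineK// integrable_fin_num.
Qed.

Lemma Rintegral_prod2 :
  \int[(mu \x mu)%E]_z f z = \int[mu]_y (\int[mu]_x f (x, y)).
Proof.
rewrite /Rintegral -(integral21_prod_meas1 integrable_prod_dominated); congr fine.
by apply: eq_integral => y _; rewrite fineK// integrable_fin_num.
Qed.

Lemma Rintegral_Fubini :
  \int[mu]_x (\int[mu]_y f (x, y)) = \int[mu]_y (\int[mu]_x f (x, y)).
Proof. by rewrite -Rintegral_prod1 Rintegral_prod2. Qed.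

End Dominated.
End ProductIntegral.

Section LaplaceSin.
Context {R : realType}.
Notation mu := (@lebesgue_measure R).
Notation Rpos := `]0%R, +oo[%classic.

Lemma integrable_expN (s : R) : 0 < s ->
  mu.-integrable Rpos (fun t => (expR (- s * t))%:E).
Proof.
move=> s0.
have cexp : continuous (fun t : R => expR (- s * t)).
  move=> t; apply: continuous_cvg; first exact: continuous_expR.
  by apply: cvgM; [exact: cvg_cst|exact: cvg_id].
apply/integrableP; split.
  by apply/measurable_EFinP/measurable_funTS; exact: continuous_measurable_fun.
under eq_integral do rewrite gee0_abs ?lee_fin ?expR_ge0//.
pose F (t : R) := - s^-1 * expR (- s * t).
have dF (t : R) : is_derive t 1 F (expR (- s * t)).
  rewrite /F; notypeclasses refine (is_derive1_eq (is_derive1M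
   (is_derive1_cst (- s^-1) t) (is_derive1_expR (is_derive1M
   (is_derive1_cst (- s) t) (is_derive1_id t)))) _).
  by rewrite /=; field; rewrite lt0r_neq0.
rewrite integral_itv_obnd_cbnd; last first.
  by apply/measurable_EFinP/measurable_funTS; exact: continuous_measurable_fun.
rewrite (@ge0_continuous_FTC2y R _ F 0 0).
- by rewrite -EFinB ltry.
- by move=> t _; rewrite expR_ge0.
- exact: continuous_subspaceT.
- rewrite -[X in _ --> X](mulr0 (- s^-1)); apply: cvgM; first exact: cvg_cst.
  have := @cvgr_expR R.
  have : s * t @[t --> +oo] --> +oo.
    apply/cvgryPge => A; near=> t.
    have At : A / s <= t by near: t; apply: nbhs_pinfty_ge; exact: num_real.
    by rewrite mulrC -ler_pdivrMr.
  by move=> H1 H2; under eq_fun do rewrite mulNr; exact: (cvg_comp _ _ H1 H2).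
- by move=> t _; have [] := dF t.
- apply: cvg_at_right_filter.
  by apply/differentiable_continuous/derivable1_diffP; have [] := dF 0.
- by move=> t _; rewrite derive1E; exact: derive_val.
Unshelve. all: by end_near. Qed.

Lemma cvg_Rintegral_right (f : R -> R) : mu.-integrable Rpos (fun x => (f x)%:E) ->
  \int[mu]_(x in `[0, n%:R]) f x @[n --> \oo] --> \int[mu]_(x in Rpos) f x.
Proof.
move=> fi.
have mpos : measurable (Rpos : set R) by exact: measurable_itv.
have gi : mu.-integrable setT (fun t => ((f \_ Rpos) t)%:E).
  by have := (integrable_mkcond (mu := mu) (fun t => (f t)%:E) mpos).1 fi;
    rewrite restrict_EFin.
have := cvg_Rintegral_segment 0 gi.
rewrite -Rintegral_mkcond; apply: cvg_trans.
apply: near_eq_cvg; near=> n.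
have n0 : 0 <= n%:R :> R by [].
rewrite -(@Rintegral_itv_obnd_cbnd R 0 (BRight n%:R) f); last first.
  by apply: integrableS fi => // x /=; rewrite !in_itv/= andbT => /andP[].
rewrite [LHS]Rintegral_mkcond [RHS]Rintegral_mkcond.
apply: eq_Rintegral => x _; rewrite !patchE sub0r add0r.
have -> : (x \in `]0, n%:R]%classic) = (x \in `[- n%:R, n%:R]%classic) && (x \in Rpos).
  apply/idP/andP.
    rewrite inE /= in_itv/= => /andP[x0 xn]; rewrite !inE /= !in_itv/= andbT.
    by split=> //; rewrite xn andbT (le_trans _ (ltW x0))// oppr_le0.
  rewrite !inE /= !in_itv/= andbT => -[/andP[_ xn] x0].
  by rewrite x0 xn.
by case: (x \in `[_, _]%classic).
Unshelve. all: by end_near. Qed.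

Lemma laplace_sin (s r : R) : 0 < s ->
  mu.-integrable Rpos (fun t => (expR (- s * t) * sin (r * t))%:E) /\
  \int[mu]_(t in Rpos) (expR (- s * t) * sin (r * t)) = r / (s ^+ 2 + r ^+ 2).
Proof.
move=> s0; pose f t := expR (- s * t) * sin (r * t).
have sr : s ^+ 2 + r ^+ 2 != 0 by rewrite lt0r_neq0// ltr_pwDl ?exprn_gt0// sqr_ge0.
pose F t := - (s ^+ 2 + r ^+ 2)^-1 * (expR (- s * t) *
  (s * sin (r * t) + r * cos (r * t))).
have dlin (k t : R) : is_derive t 1 (fun t => k * t) k.
  notypeclasses refine (is_derive1_eq (is_derive1M (is_derive1_cst k t)
    (is_derive1_id t)) _).
  by rewrite /=; ring.
have dexp (t : R) := is_derive1_expR (dlin (- s) t).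
have dsin (t : R) := is_derive1_sin (dlin r t).
have dcos (t : R) := is_derive1_cos (dlin r t).
have dF (t : R) : is_derive t 1 F (f t).
  rewrite /F; notypeclasses refine (is_derive1_eq (is_derive1M (is_derive1_cst _ t)
   (is_derive1M (dexp t) (is_derive1D (is_derive1M (is_derive1_cst s t) (dsin t))
   (is_derive1M (is_derive1_cst r t) (dcos t))))) _).
  by rewrite /f /=; field.
have df (t : R) := is_derive1M (dexp t) (dsin t).
have cf : continuous f.
  move=> t; apply/differentiable_continuous/derivable1_diffP.
  by have [] := df t.
have fi : mu.-integrable Rpos (fun t => (f t)%:E).
  apply: (@integrable_EFin_le _ _ _ mu Rpos _ _ (fun t => expR (- s * t))) => //.
  - by apply: measurable_funTS; exact: continuous_measurable_fun.
  - move=> t _; rewrite /f normrM (ger0_norm (expR_ge0 _)).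
    by rewrite ler_piMr ?expR_ge0 ?sin_max.
  - exact: integrable_expN.
split=> //.
apply: (cvg_unique _ (cvg_Rintegral_right fi)) => //=.
have E n : (0 < n)%N -> \int[mu]_(x in `[0, n%:R]) f x = F n%:R - F 0.
  move=> n0; rewrite /Rintegral (@continuous_FTC2 R f F 0 n%:R)//.
  - by rewrite ltr0n.
  - exact: continuous_subspaceT.
  - have cF : continuous F.
      move=> t; apply/differentiable_continuous/derivable1_diffP.
      by have [] := dF t.
    split.
    + by move=> t _; have [] := dF t.
    + exact/cvg_at_right_filter/cF.
    + exact/cvg_at_left_filter/cF.
  - by move=> t _; rewrite derive1E; exact: derive_val.
have F0 : F 0 = - (r / (s ^+ 2 + r ^+ 2)).
  by rewrite /F !mulr0 expR0 sin0 cos0; field.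
have Fn : F n%:R @[n --> \oo] --> 0.
  apply/cvgr0Pnorm_le => eps eps0; near=> n.
  pose M := (s ^+ 2 + r ^+ 2)^-1 * (s + `|r|).
  have M0 : 0 <= M.
    rewrite mulr_ge0 ?addr_ge0 ?(ltW s0)// invr_ge0 addr_ge0 ?sqr_ge0//.
  have bound : `|F n%:R| <= M * expR (- s * n%:R).
    rewrite /F mulNr normrN !normrM /M (ger0_norm (expR_ge0 _)).
    rewrite (ger0_norm (_ : 0 <= _^-1)); last by rewrite invr_ge0 addr_ge0 ?sqr_ge0.
    rewrite -mulrA ler_wpM2l ?invr_ge0 ?addr_ge0 ?sqr_ge0// mulrC.
    rewrite ler_wpM2r ?expR_ge0// (le_trans (ler_normD _ _))// !normrM.
    by rewrite (gtr0_norm s0) lerD// ler_piMr ?sin_max ?cos_max// ltW.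
  apply: le_trans bound _.
  have : M / (1 + s * n%:R) <= eps.
    have d0 : 0 < 1 + s * n%:R by rewrite ltr_pwDl// mulr_ge0// ltW.
    rewrite ler_pdivrMr// mulrC -ler_pdivrMr//.
    have : M / eps / s <= n%:R by near: n; exact: nbhs_infty_ger.
    move=> H.
    by apply: le_trans (_ : n%:R * s <= _); [rewrite -ler_pdivrMr|rewrite mulrC lerDr].
  apply: le_trans; rewrite ler_wpM2l// mulNr expRN lef_pV2 ?posrE ?expR_gt0//.
    exact: expR_ge1Dx.
  by rewrite ltr_pwDl// mulr_ge0// ltW.
rewrite -[X in _ --> X](_ : 0 - F 0 = _); last by rewrite F0; ring.
have : F n%:R - F 0 @[n --> \oo] --> 0 - F 0 by apply: cvgB => //; exact: cvg_cst.
apply: cvg_trans; apply: near_eq_cvg; near=> n; rewrite E//.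
by near: n; exact: nbhs_infty_gt.
Unshelve. all: by end_near. Qed.

Lemma sin_le_norm (u : R) : `|sin u| <= `|u|.
Proof.
wlog u0 : u / 0 <= u.
  move=> H; have [/H//|u0] := leP 0 u.
  by have := H (- u); rewrite sinN !normrN; apply; rewrite oppr_ge0 ltW.
have ds (x : R) : x \in `]0, u[ -> is_derive x 1 sin (cos x).
  by move=> _; exact: is_derive_sin.
have cs : {within `[0, u], continuous sin}.
  by apply: continuous_subspaceT; exact: continuous_sin.
have [z _] := @MVT_segment R sin cos 0 u u0 ds cs.
by rewrite sin0 !subr0 => ->; rewrite normrM ler_piMl ?cos_max.
Qed.

End LaplaceSin.

Section BoundaryValues.
Context {R : realType}.
Notation mu := (@lebesgue_measure R).
Context {I : finType}.
Variables (C A : I -> R) (i0 : I) (lo hi : R).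
Hypotheses (C_gt0 : forall i, 0 < C i) (lo_gt0 : 0 < lo)
  (A_lo : forall i, lo <= A i) (A_hi : forall i, A i <= hi)
  (hi_lo : hi - lo <= 1) (hi_le2 : hi <= 2) (A_i0 : 1 < A i0 < 2).

Let psi (s : R) := Num.sqrt (\sum_i C i * s `^ A i).

(** [k + i l] is [psi (i exp v)]. As the argument of [psi] in the first quadrant
    is at most [pi / 2], [Re psi >= 0] there, so [exp (- x psi)] is bounded by [1]
    and the Poisson formula applies. The growth of [k] comes from the exponent
    [A i0]: the imaginary part [2 k l] of [g = psi ^ 2] is at least of the order
    of [exp (A i0 v)], while [l] is at most of the order of [exp v]. *)
Lemma boundary_values : exists k l : R -> R,
  [/\ continuous k /\ continuous l, forall v, 0 <= k v,
      exists2 K, 0 <= K & forall v, `|k v| <= K * (1 + expR v) /\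
        `|l v| <= K * (1 + expR v),
      exists2 b, 0 < b &
        forall v, 0 <= v -> b * expR ((A i0 - 1) * v) <= k v &
      forall x, 0 <= x -> forall v0,
        mu.-integrable setT
          (fun v => (expR (- x * k v) * cos (x * l v) / ch (v - v0))%:E) /\
        \int[mu]_(v in [set: R]) (expR (- x * k v) * cos (x * l v) / ch (v - v0)) =
          expR (- x * psi (expR v0)) * pi].
Proof.
have := hi_le2; have := lo_gt0; have := hi_lo => hilo' lo0' hi2'.
have := A_i0 => /andP[Ai1 Ai2].
have pi0 := pi_gt0 R.
have lohi : lo <= hi := le_trans (A_lo i0) (A_hi i0).
have dh h : 0 <= h < pi -> (hi - lo) / 2 * h < pi / 2.
  move=> /andP[h0 hpi]; have : (hi - lo) / 2 * h <= 2^-1 * h by rewrite ler_wpM2r//; lra.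
  by lra.
have pi_half : pi / 2 < (pi : R) by lra.
have in_pi h : 0 <= h <= pi / 2 -> 0 <= h < (pi : R).
  by move=> /andP[-> hh] /=; lra.
have [LU [LV [hL LV0 LVb LUim LUb]]] := @log_root R I C A i0 lo hi pi C_gt0 A_lo A_hi dh.
have LV_in v h : 0 <= h <= pi / 2 -> 0 <= LV v h <= pi / 2.
  move=> hh; have := LVb v h (in_pi h hh); have /andP[h0 hpi] := hh.
  have : hi / 2 * h <= 1 * h by rewrite ler_wpM2r//; lra.
  have : 0 <= lo / 2 * h by rewrite mulr_ge0//; lra.
  by move=> ? ? /andP[? ?]; apply/andP; split; lra.
have p_in : 0 <= (pi / 2 : R) <= pi / 2 by apply/andP; split; lra.
pose k v := expR (LU v (pi / 2)) * cos (LV v (pi / 2)).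
pose l v := expR (LU v (pi / 2)) * sin (LV v (pi / 2)).
have [kA [kB kl_holo]] := hol_expR hL.
have p_in' := in_pi _ p_in.
have k0 v : 0 <= k v.
  rewrite /k mulr_ge0 ?expR_ge0//; apply: cos_ge0_pihalf.
  by have /andP[L0 L1] := LV_in v _ p_in; apply/andP; split; lra.
have l0 v : 0 <= l v.
  rewrite /l mulr_ge0 ?expR_ge0//; apply: sin_ge0_pi.
  by have /andP[L0 L1] := LV_in v _ p_in; apply/andP; split; lra.
pose S := \sum_i C i.
have S0 : 0 < S.
  rewrite /S (bigD1 i0)//= ltr_pwDl//; apply: sumr_ge0 => i _; exact: ltW.
pose K := Num.sqrt (2 * S).
have psi_le v : expR (LU v (pi / 2)) <= K * (1 + expR v).
  have [/andP[_ H] _] := LUb v _ p_in'.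
  have e0 := expR_gt0 v.
  suff : expR (LU v (pi / 2)) ^+ 2 <= (K * (1 + expR v)) ^+ 2.
    rewrite ler_pXn2r// nnegrE ?expR_ge0// mulr_ge0 ?sqrtr_ge0//; lra.
  rewrite -expRM_natl; apply: le_trans H _.
  rewrite exprMn sqr_sqrtr; last by rewrite mulr_ge0// ltW.
  rewrite -mulrA ler_wpM2l// mulr_suml; apply: ler_sum => i _.
  rewrite ler_wpM2l ?(ltW (C_gt0 i))//.
  have A0 : 0 < A i := lt_le_trans lo0' (A_lo i).
  have A2 : A i <= 2 := le_trans (A_hi i) hi2'.
  have [v0|v0] := leP 0 v.
    apply: (@le_trans _ _ (expR v ^+ 2)).
      by rewrite -expRM_natl ler_expR ler_wpM2r.
    by rewrite ler_pXn2r ?nnegrE ?(ltW e0)//; lra.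
  apply: (@le_trans _ _ 1).
    by rewrite -expR0 ler_expR; nra.
  by rewrite expr2; nra.
exists k, l; split.
- by split=> v; [exact: (holo_cts1 (holo_cU (kl_holo v _ p_in')))|
    exact: (holo_cts1 (holo_cV (kl_holo v _ p_in')))].
- exact: k0.
- exists K; first exact: sqrtr_ge0.
  move=> v; rewrite /k /l !normrM !(ger0_norm (expR_ge0 _)).
  by split; apply: le_trans (psi_le v); rewrite ler_piMr ?expR_ge0 ?cos_max ?sin_max.
- (* Im (psi ^ 2) = 2 k l, and l is at most |psi| *)
  pose b0 := C i0 * sin (A i0 * (pi / 2)).
  have b00 : 0 < b0.
    by rewrite mulr_gt0//; apply: sin_gt0_pi; apply/andP; split; nra.
  have K0 : 0 < K by rewrite sqrtr_gt0 mulr_gt0.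
  exists (b0 / (4 * K)); first by rewrite divr_gt0// mulr_gt0.
  move=> v v0; have e1 : 1 <= expR v by rewrite -expR0 ler_expR.
  have kl : b0 * expR (A i0 * v) <= 2 * k v * l v.
    have -> : 2 * k v * l v = expR (2 * LU v (pi / 2)) * sin (2 * LV v (pi / 2)).
      rewrite /k /l (mulr_natl (LV _ _)) sin_mulr2n expRM_natl; ring.
    rewrite (LUim v _ p_in') (bigD1 i0)//= ler_wpDr//.
      apply: sumr_ge0 => i _; rewrite !mulr_ge0 ?expR_ge0 ?(ltW (C_gt0 i))//.
      have Ai := A_lo i; have Ah := A_hi i.
      by apply: sin_ge0_pi; apply/andP; split; nra.
    by rewrite /b0 mulrAC.
  have lK : l v <= 2 * K * expR v.
    apply: (@le_trans _ _ (K * (1 + expR v))).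
      apply: le_trans (psi_le v).
      by rewrite /l ler_piMr ?expR_ge0 ?sin_le1.
    by rewrite (mulrC 2) -mulrA ler_wpM2l ?(ltW K0)//; lra.
  have kk := k0 v.
  have H : b0 * expR (A i0 * v) <= 4 * K * expR v * k v.
    apply: le_trans kl _.
    have -> : 4 * K * expR v * k v = 2 * k v * (2 * K * expR v) by ring.
    by rewrite ler_wpM2l// mulr_ge0.
  rewrite mulrBl mul1r expRD expRN mulrAC mulrA.
  rewrite ler_pdivrMr ?mulr_gt0//.
  rewrite ler_pdivrMr ?expR_gt0//.
  by apply: le_trans H _; rewrite le_eqVlt; apply/orP; left; apply/eqP; ring.
- move=> x x0 v0.
  pose PU v h := - x * (expR (LU v h) * cos (LV v h)) - 0 * (expR (LU v h) * sin (LV v h)).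
  pose PV v h := - x * (expR (LU v h) * sin (LV v h)) + 0 * (expR (LU v h) * cos (LV v h)).
  pose U v h := expR (PU v h) * cos (PV v h).
  pose V v h := expR (PU v h) * sin (PV v h).
  have hUV : hol pi U V.
    apply: hol_expR; apply: (@holM _ pi (fun _ _ => - x) (fun _ _ => 0)).
      exact: hol_cst.
    exact: hol_expR.
  have [A' [B' H]] := hUV.
  have V0 v : V v 0 = 0 by rewrite /V /PV LV0 sin0 !mulr0 mul0r addr0 sin0 mulr0.
  have PU0 v h : 0 <= h <= pi / 2 -> expR (PU v h) <= 1.
    move=> hh; rewrite -expR0 ler_expR /PU mul0r subr0 mulNr oppr_le0.
    rewrite !mulr_ge0 ?expR_ge0//; apply: cos_ge0_pihalf.
    by have /andP[L0 L1] := LV_in v _ hh; apply/andP; split; lra.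
  have bU v h : 0 <= h <= pi / 2 -> `|U v h| <= 1.
    move=> hh; rewrite /U normrM (ger0_norm (expR_ge0 _)).
    by rewrite mulr_ile1 ?expR_ge0 ?cos_max ?PU0.
  have bV v h : 0 <= h <= pi / 2 -> `|V v h| <= 1.
    move=> hh; rewrite /V normrM (ger0_norm (expR_ge0 _)).
    by rewrite mulr_ile1 ?expR_ge0 ?sin_max ?PU0.
  have [P1 P2] := @strip_poisson R U V A' B' pi 1 v0 pi_half H V0 bU bV.
  have UE v : U v (pi / 2) = expR (- x * k v) * cos (x * l v).
    by rewrite /U /PU /PV /k /l !mul0r subr0 addr0 !mulNr cosN.
  split.
    by apply: integrable_EFin_eq P1 => // v _; rewrite UE.
  rewrite -[X in X * pi](_ : U v0 0 = _); last first.
    have z_in : 0 <= (0 : R) < pi by rewrite lexx pi0.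
    have LUp : expR (LU v0 0) = psi (expR v0).
      have [_ /(_ erefl) LU2] := LUb v0 0 z_in.
      rewrite /psi (_ : \sum_i _ = expR (LU v0 0) ^+ 2).
        by rewrite sqrtr_sqr ger0_norm ?expR_ge0.
      rewrite -expRM_natl LU2; apply: eq_bigr => i _; congr (_ * _).
      by rewrite powR_expR ?expR_gt0// expRK.
    by rewrite /U /PU /PV LV0 sin0 cos0 !mulr0 mulr1 mul0r subr0 addr0 cos0 mulr1 LUp.
  by rewrite -P2; apply: eq_Rintegral => v _; rewrite UE.
Qed.

End BoundaryValues.

Section ExplicitSolution.
Context {R : realType}.
Notation mu := (@lebesgue_measure R).
Notation Rpos := `]0%R, +oo[%classic.
Variables (psi : R -> R) (k l : R -> R) (K b gam : R).
Hypotheses (ck : continuous k) (cl : continuous l) (k_ge0 : forall v, 0 <= k v)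
  (K_ge0 : 0 <= K)
  (kl_le : forall v, `|k v| <= K * (1 + expR v) /\ `|l v| <= K * (1 + expR v))
  (b_gt0 : 0 < b) (gam_gt0 : 0 < gam)
  (k_ge : forall v, 0 <= v -> b * expR (gam * v) <= k v)
  (poisson : forall x, 0 <= x -> forall v0,
    mu.-integrable setT
      (fun v => (expR (- x * k v) * cos (x * l v) / ch (v - v0))%:E) /\
    \int[mu]_(v in [set: R]) (expR (- x * k v) * cos (x * l v) / ch (v - v0)) =
      expR (- x * psi (expR v0)) * pi).

Let Phi x v := expR (- x * k v) * cos (x * l v).
Let G y v := expR (- y * k v) * (expR v * (1 + expR v)).

(* exp (- y k) beats every power of exp v as v tends to +oo; G y dominates the
   integrands of explicit_w and of its derivatives. *)
Let decay y : 0 < y -> exists2 M, 0 <= M & forall v, G y v <= M * (ch v)^-1.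
Proof.
have := b_gt0; have := gam_gt0 => gam0' b0' y0.
have chV (v : R) : expR (- `|v|) <= (ch v)^-1.
  rewrite expRN lef_pV2 ?posrE ?expR_gt0 ?ch_gt0//.
  rewrite /ch ler_pdivrMr// mulr_natr mulr2n lerD// ler_expR ?ler_norm//.
  by rewrite -normrN ler_norm.
pose n := (Num.truncn (3 / gam)).+1.
have ngam : 3 <= n%:R * gam.
  by rewrite -ler_pdivrMr// ltW// truncnS_gt.
have n0 : 0 < n%:R :> R by rewrite ltr0n.
have [z0 z00 z0E] : exists2 z0, 0 < z0 & z0 = y * b / n%:R.
  by exists (y * b / n%:R) => //; rewrite divr_gt0// mulr_gt0.
exists (2 + 2 / z0 ^+ n); first by rewrite addr_ge0// divr_ge0// exprn_ge0// ltW.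
move=> v; have e0 := expR_gt0 v.
have c0 : 0 < (ch v)^-1 by rewrite invr_gt0 ch_gt0.
have z1 : 0 <= 2 / z0 ^+ n by rewrite divr_ge0// exprn_ge0// ltW.
have ek : expR (- y * k v) <= 1.
  by rewrite -expR0 ler_expR mulNr oppr_le0 mulr_ge0// ltW.
have ekp := expR_gt0 (- y * k v).
rewrite mulrDl /G; have [v0|v0] := leP 0 v; last first.
  have e1 : expR v <= 1 by rewrite -expR0 ler_expR ltW.
  have := chV v; rewrite (ltr0_norm v0) opprK => H.
  have : 0 <= 2 / z0 ^+ n * (ch v)^-1 by rewrite mulr_ge0 ?(ltW c0).
  have : expR (- y * k v) * (expR v * (1 + expR v)) <= 1 * (expR v * 2).
    by apply: ler_pM => //; rewrite ?mulr_ge0 ?ler_wpM2l ?(ltW ekp) ?(ltW e0)//; lra.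
  by lra.
have e1 : 1 <= expR v by rewrite -expR0 ler_expR.
have := chV v; rewrite (ger0_norm v0) => H.
have : 0 <= 2 * (ch v)^-1 by rewrite mulr_ge0 ?(ltW c0).
suff : expR (- y * k v) * (expR v * (1 + expR v)) <= 2 / z0 ^+ n * expR (- v).
  have : 2 / z0 ^+ n * expR (- v) <= 2 / z0 ^+ n * (ch v)^-1 by rewrite ler_wpM2l.
  by lra.
(* exp (y k) >= (y k / n) ^ n >= z0 ^ n exp (3 v) *)
have big : z0 ^+ n * expR (3 * v) <= expR (y * k v).
  apply: (@le_trans _ _ ((z0 * expR (gam * v)) ^+ n)).
    rewrite exprMn -expRM_natl ler_wpM2l ?exprn_ge0 ?(ltW z00)//.
    by rewrite ler_expR mulrA ler_wpM2r.
  have -> : y * k v = n%:R * (y * k v / n%:R) by rewrite mulrCA divff ?mulr1// lt0r_neq0.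
  rewrite expRM_natl lerXn2r ?nnegrE ?expR_ge0 ?mulr_ge0 ?expR_ge0 ?(ltW z00)//.
  apply: le_trans (_ : 1 + y * k v / n%:R <= _); last exact: expR_ge1Dx.
  apply: (@le_trans _ _ (y * k v / n%:R)); last by rewrite lerDr.
  rewrite z0E mulrAC ler_pM2r ?invr_gt0// -mulrA ler_pM2l//.
  exact: k_ge.
have zn0 : 0 < z0 ^+ n by rewrite exprn_gt0.
rewrite [leLHS](_ : _ = expR v * (1 + expR v) / expR (y * k v)); last first.
  by rewrite mulNr expRN mulrC.
rewrite ler_pdivrMr ?expR_gt0//.
apply: (@le_trans _ _ (2 / z0 ^+ n * expR (- v) * (z0 ^+ n * expR (3 * v)))); last first.
  by rewrite ler_wpM2l// mulr_ge0 ?expR_ge0.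
have -> : 2 / z0 ^+ n * expR (- v) * (z0 ^+ n * expR (3 * v)) = 2 * expR v ^+ 2.
  have -> : 3 * v = v + v + v by ring.
  by rewrite expRN !expRD; field; rewrite !lt0r_neq0.
by rewrite expr2; nra.
Qed.

Let cexpk x : continuous (fun v => expR (- x * k v)).
Proof.
move=> v; apply: continuous_cvg; first exact: continuous_expR.
by apply: cvgM; [exact: cvg_cst|exact: ck].
Qed.

Let ccosl x : continuous (fun v => cos (x * l v)).
Proof.
move=> v; apply: (@continuous_comp _ _ _ (fun v => x * l v) cos).
  by apply: cvgM; [exact: cvg_cst|exact: cl].
exact: continuous_cos.
Qed.

Let cPhi x : continuous (Phi x).
Proof. by move=> v; apply: cvgM; [exact: cexpk|exact: ccosl]. Qed.

Let G_ge0 y v : 0 <= G y v.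
Proof. by rewrite /G !mulr_ge0 ?addr_ge0 ?expR_ge0. Qed.

Let G_int y : 0 < y -> mu.-integrable setT (fun v => (G y v)%:E).
Proof.
move=> y0; have [M M0 GM] := decay y0.
apply: (@integrable_EFin_le _ _ _ mu setT measurableT _ (fun v => M * (ch v)^-1)).
- apply: continuous_measurable_fun => v; apply: cvgM; first exact: cexpk.
  apply: cvgM; first exact: continuous_expR.
  by apply: cvgD; [exact: cvg_cst|exact: continuous_expR].
- by move=> v _; rewrite ger0_norm ?GM ?G_ge0.
- by apply: integrable_EFinZl => //; exact: integrable_sech.
Qed.

Let Phi_le x v : `|Phi x v| <= expR (- x * k v).
Proof.
by rewrite /Phi normrM (ger0_norm (expR_ge0 _)) ler_piMr ?expR_ge0 ?cos_max.
Qed.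

Let ePhi_le x v : expR v * `|Phi x v| <= G x v.
Proof.
rewrite /G mulrCA ler_wpM2l ?expR_ge0//.
rewrite -[X in X <= _]mulr1 ler_pM//.
by rewrite lerDl expR_ge0.
Qed.

(** The inversion integral along the imaginary axis in the variable [v = ln r]. *)
Definition explicit_w x t :=
  2 / pi * \int[mu]_(v in [set: R]) (sin (t * expR v) * Phi x v).

Let csin t : continuous (fun v : R => sin (t * expR v)).
Proof.
move=> v; apply: (@continuous_comp _ _ _ (fun v => t * expR v) sin).
  by apply: cvgM; [exact: cvg_cst|exact: continuous_expR].
exact: continuous_sin.
Qed.

Let sinPhi_int x t : 0 < x ->
  mu.-integrable setT (fun v => (sin (t * expR v) * Phi x v)%:E).
Proof.
move=> x0.
apply: (@integrable_EFin_le _ _ _ mu setT measurableT _ (fun v => `|t| * G x v)).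
- apply: continuous_measurable_fun => v.
  by apply: cvgM; [exact: csin|exact: cPhi].
- move=> v _; rewrite normrM.
  apply: le_trans (_ : `|t| * expR v * `|Phi x v| <= _).
    rewrite ler_wpM2r// (le_trans (sin_le_norm _))// normrM.
    by rewrite (ger0_norm (expR_ge0 _)).
  by rewrite -mulrA ler_wpM2l.
- by apply: integrable_EFinZl => //; exact: G_int.
Qed.

Lemma explicit_w_derivable_t x t : 0 < x -> derivable (explicit_w x) t 1.
Proof.
move=> x0; apply: derivableM; first exact: derivable_cst.
pose f s v := sin (s * expR v) * Phi x v.
have df (s v : R) : is_derive s 1 (f ^~ v) (cos (s * expR v) * expR v * Phi x v).
  notypeclasses refine (is_derive1_eq (is_derive1M (is_derive1_sin (is_derive1M
    (is_derive1_id s) (is_derive1_cst (expR v) s))) (is_derive1_cst (Phi x v) s)) _).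
  by rewrite /=; ring.
apply: (@derivable_under_integral R _ _ mu f setT measurableT t (t - 1) (t + 1)
    _ _ _ (G x)).
- by rewrite /= in_itv/=; apply/andP; split; lra.
- by move=> s _; exact: sinPhi_int.
- by move=> s v _ _; have [] := df s v.
- exact: G_ge0.
- exact: G_int.
- move=> s v _ _; rewrite partial1of2E (@derive_val _ _ _ _ _ _ _ (df s v)).
  rewrite normrM; apply: le_trans (ePhi_le x v).
  rewrite [X in X * _]normrM (ger0_norm (expR_ge0 _)).
  by rewrite ler_wpM2r// ler_piMl ?expR_ge0 ?cos_max.
Qed.

Lemma explicit_w_derivable_x x t : 0 < x ->
  derivable (fun x' => explicit_w x' t) x 1.
Proof.
move=> x0; apply: derivableM; first exact: derivable_cst.
pose f y v := sin (t * expR v) * Phi y v.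
pose f' y v := sin (t * expR v) *
  (expR (- y * k v) * - k v * cos (y * l v) +
   expR (- y * k v) * (- sin (y * l v) * l v)).
have df (y v : R) : is_derive y 1 (f ^~ v) (f' y v).
  have d1 : is_derive y 1 (fun y : R => - y * k v) (- k v).
    notypeclasses refine (is_derive1_eq (is_derive1M (is_derive1N (is_derive1_id y))
      (is_derive1_cst (k v) y)) _).
    by rewrite /=; ring.
  have d2 : is_derive y 1 (fun y : R => y * l v) (l v).
    notypeclasses refine (is_derive1_eq (is_derive1M (is_derive1_id y)
      (is_derive1_cst (l v) y)) _).
    by rewrite /=; ring.
  notypeclasses refine (is_derive1_eq (is_derive1M (is_derive1_cst _ y)
    (is_derive1M (is_derive1_expR d1) (is_derive1_cos d2))) _).
  by rewrite /f' /=; ring.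
have x20 : 0 < x / 2 by rewrite divr_gt0.
have I_gt0 y : `]x / 2, x + 1[%classic y -> x / 2 < y.
  by rewrite /= in_itv/= => /andP[].
apply: (@derivable_under_integral R _ _ mu f setT measurableT x (x / 2) (x + 1)
    _ _ _ (fun v => `|t| * (2 * K) * G (x / 2) v)).
- by rewrite /= in_itv/=; apply/andP; split; lra.
- by move=> y /I_gt0 xy; apply: sinPhi_int; exact: lt_trans xy.
- by move=> y v _ _; have [] := df y v.
- by move=> v; rewrite !mulr_ge0.
- by apply: integrable_EFinZl => //; exact: G_int.
- move=> y v /I_gt0 xy _; rewrite partial1of2E (@derive_val _ _ _ _ _ _ _ (df y v)).
  have [Kk Kl] := kl_le v.
  have e0 := expR_gt0 v; have ey := expR_gt0 (- y * k v).
  have eyx : expR (- y * k v) <= expR (- (x / 2) * k v).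
    by rewrite ler_expR !mulNr lerN2 ler_wpM2r// ltW.
  have H1 : `|expR (- y * k v) * - k v * cos (y * l v) +
      expR (- y * k v) * (- sin (y * l v) * l v)| <=
      expR (- (x / 2) * k v) * (2 * (K * (1 + expR v))).
    apply: le_trans (ler_normD _ _) _.
    rewrite !normrM !normrN (ger0_norm (ltW ey)) -mulrA -mulrDr.
    apply: ler_pM => //; rewrite ?addr_ge0 ?mulr_ge0 ?(ltW ey)//.
    rewrite (mulr_natl _ 2) mulr2n lerD//.
      by rewrite (le_trans _ Kk)// ler_piMr ?cos_max.
    by rewrite (le_trans _ Kl)// ler_piMl ?sin_max.
  rewrite /f' normrM.
  apply: (@le_trans _ _ ((`|t| * expR v) *
      (expR (- (x / 2) * k v) * (2 * (K * (1 + expR v)))))).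
    apply: ler_pM => //.
    by rewrite (le_trans (sin_le_norm _))// normrM (ger0_norm (ltW e0)).
  by rewrite le_eqVlt; apply/orP; left; apply/eqP; rewrite /G; ring.
Qed.

(** The transform of [sin (t exp v)] is [exp v / (s ^ 2 + exp (2 v))], which is
    [1 / (2 s ch (v - ln s))]. *)
Lemma explicit_w_laplace x s : 0 < x -> 0 < s ->
  mu.-integrable Rpos (fun t => (expR (- s * t) * explicit_w x t)%:E) /\
  \int[mu]_(t in Rpos) (expR (- s * t) * explicit_w x t) =
    s^-1 * expR (- x * psi s).
Proof.
move=> x0 s0; have pi0 := pi_gt0 R.
have mpos : measurable (Rpos : set R) by exact: measurable_itv.
have s20 : 0 < s / 2 by rewrite divr_gt0.
pose E (r : R) := (fun t : R => expR (- r * t)) \_ Rpos.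
have E_in r t : 0 < t -> E r t = expR (- r * t).
  by move=> t0; rewrite /E patchE ifT// inE/= in_itv/= andbT.
have E_out r t : t <= 0 -> E r t = 0.
  move=> t0; rewrite /E patchE ifF//; apply/negbTE/negP.
  by rewrite inE/= in_itv/= andbT ltNge t0.
have E_ge0 r t : 0 <= E r t.
  by have [t0|t0] := ltP 0 t; [rewrite E_in// expR_ge0|rewrite E_out].
have E_int r : 0 < r -> mu.-integrable setT (fun t => (E r t)%:E).
  move=> r0; have := (integrable_mkcond (mu := mu)
    (fun t => (expR (- r * t))%:E) mpos).1 (integrable_expN r0).
  by rewrite restrict_EFin.
have E_le t y : `|E s t * sin (t * y)| <= 2 / s * E (s / 2) t * `|y|.
  have [t0|t0] := ltP 0 t; last by rewrite !E_out// mul0r normr0 mulr0 mul0r.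
  rewrite !E_in// normrM (ger0_norm (expR_ge0 _)).
  apply: (@le_trans _ _ (expR (- s * t) * (t * `|y|))).
    rewrite ler_wpM2l ?expR_ge0// (le_trans (sin_le_norm _))// normrM.
    by rewrite (gtr0_norm t0).
  rewrite mulrA ler_wpM2r//.
  have -> : - s * t = - (s / 2) * t + - (s / 2 * t) by field.
  rewrite expRD expRN -mulrA [leRHS]mulrC ler_wpM2l ?expR_ge0//.
  rewrite mulrC ler_pdivrMr ?expR_gt0//.
  have H : s / 2 * t <= expR (s / 2 * t).
    by apply: le_trans (expR_ge1Dx _); rewrite lerDr.
  apply: (@le_trans _ _ (2 / s * (s / 2 * t))).
    by rewrite le_eqVlt; apply/orP; left; apply/eqP; field; rewrite lt0r_neq0.
  by rewrite ler_wpM2l// divr_ge0// ltW.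
pose J t := \int[mu]_(v in [set: R]) (sin (t * expR v) * Phi x v).
pose F (z : R * R) := E s z.1 * (sin (z.1 * expR z.2) * Phi x z.2).
have mE : measurable_fun setT (E s).
  exact: (integrable_EFin_measurable (E_int s s0)).
have mF : measurable_fun [set: measurableTypeR R * measurableTypeR R] F.
  apply: measurable_funM; first exact: (measurableT_comp mE measurable_fst).
  apply: measurable_funM.
    apply: (measurableT_comp (continuous_measurable_fun (@continuous_sin R))).
    apply: measurable_funM; first exact: measurable_fst.
    apply: (measurableT_comp (continuous_measurable_fun (@continuous_expR R))).
    exact: measurable_snd.
  exact: (measurableT_comp (continuous_measurable_fun (cPhi (x := x))) measurable_snd).
have p_int : mu.-integrable setT (fun t => (2 / s * E (s / 2) t)%:E).
  by apply: integrable_EFinZl => //; exact: E_int.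
have p_ge0 t : 0 <= 2 / s * E (s / 2) t by rewrite mulr_ge0 ?divr_ge0 ?(ltW s0).
have F_le t v : `|F (t, v)| <= 2 / s * E (s / 2) t * G x v.
  rewrite /F /= mulrA normrM.
  apply: (@le_trans _ _ (2 / s * E (s / 2) t * expR v * `|Phi x v|)).
    rewrite ler_wpM2r//; have := E_le t (expR v).
    by rewrite (ger0_norm (expR_ge0 _)).
  by rewrite -[leLHS]mulrA ler_wpM2l.
have inner1 t : \int[mu]_(v in [set: R]) F (t, v) = E s t * J t.
  by rewrite /F /= RintegralZl//; exact: sinPhi_int.
have inner2 v : \int[mu]_(t in [set: R]) F (t, v) =
    (2 * s)^-1 * (Phi x v / ch (v - ln s)).
  have [L1 L2] := laplace_sin (expR v) s0.
  transitivity (\int[mu]_(t in Rpos) (Phi x v * (expR (- s * t) * sin (expR v * t)))).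
    rewrite [RHS]Rintegral_mkcond; apply: eq_Rintegral => t _.
    rewrite /F /= /E !patchE; case: ifP => _; last by rewrite mul0r.
    by rewrite (mulrC t (expR v)); ring.
  rewrite RintegralZl// L2 ch_shift_inv (_ : expR (2 * ln s) = s ^+ 2); last first.
    by rewrite expRM_natl lnK// posrE.
  rewrite expRM_natl lnK ?posrE//; have e0 := expR_gt0 v.
  have q0 : 0 < s * s + expR v * expR v by rewrite addr_gt0// mulr_gt0.
  move: (Phi x v) (expR v) e0 q0 => u e e0 q0.
  by field; rewrite !lt0r_neq0.
have [P1 P2] := poisson (ltW x0) (ln s).
have outer2 : \int[mu]_(v in [set: R]) (\int[mu]_(t in [set: R]) F (t, v)) =
    (2 * s)^-1 * (expR (- x * psi s) * pi).
  rewrite (@eq_Rintegral _ _ _ mu _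
    (fun v => (2 * s)^-1 * (Phi x v / ch (v - ln s)))); last first.
    by move=> v _; exact: inner2.
  by rewrite RintegralZl// P2 lnK// posrE.
have J_le t : 0 < t -> `|J t| <= t * \int[mu]_(v in [set: R]) G x v.
  move=> t0; apply: le_trans (le_normr_Rintegral measurableT (sinPhi_int t x0)) _.
  rewrite -RintegralZl//; last exact: G_int.
  apply: le_Rintegral => //.
  - by apply: integrable_EFin_norm; exact: sinPhi_int.
  - by apply: integrable_EFinZl => //; exact: G_int.
  - move=> v _; rewrite normrM; apply: le_trans (_ : t * expR v * `|Phi x v| <= _).
      rewrite ler_wpM2r// (le_trans (sin_le_norm _))// normrM.
      by rewrite (gtr0_norm t0) (ger0_norm (expR_ge0 _)).
    by rewrite -mulrA ler_wpM2l// ltW.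
have cW : continuous (explicit_w x).
  move=> t; apply/differentiable_continuous/derivable1_diffP.
  exact: explicit_w_derivable_t.
pose Q := \int[mu]_(v in [set: R]) G x v.
have Q0 : 0 <= Q by apply: Rintegral_ge0 => v _.
have c0 : 0 <= 2 / (pi : R) by rewrite divr_ge0// ltW.
have W_int : mu.-integrable Rpos (fun t => (expR (- s * t) * explicit_w x t)%:E).
  apply: (@integrable_EFin_le _ _ _ mu Rpos _ _
    (fun t => 2 / pi * Q * (2 / s) * expR (- (s / 2) * t))) => //.
  - apply: measurable_funTS; apply: continuous_measurable_fun => t.
    apply: cvgM; last exact: cW.
    apply: continuous_cvg; first exact: continuous_expR.
    by apply: cvgM; [exact: cvg_cst|exact: cvg_id].
  - move=> t; rewrite /= in_itv/= andbT => t0.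
    rewrite /explicit_w -/(J t) normrM (ger0_norm (expR_ge0 _)) normrM (ger0_norm c0).
    apply: (@le_trans _ _ (expR (- s * t) * (2 / pi * (t * Q)))).
      by rewrite ler_wpM2l ?expR_ge0// ler_wpM2l// J_le.
    have H : s / 2 * t <= expR (s / 2 * t).
      by apply: le_trans (expR_ge1Dx _); rewrite lerDr.
    have -> : - s * t = - (s / 2) * t + - (s / 2 * t) by field.
    rewrite expRD expRN.
    have e0 := expR_gt0 (s / 2 * t); have e1 := expR_gt0 (- (s / 2) * t).
    have -> : expR (- (s / 2) * t) / expR (s / 2 * t) * (2 / pi * (t * Q)) =
        (2 / pi * Q * (2 / s) * expR (- (s / 2) * t)) *
        (s / 2 * t / expR (s / 2 * t)).
      move: (2 / pi) => d.
      by field; rewrite !lt0r_neq0.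
    rewrite ler_piMr//.
      by rewrite !mulr_ge0 ?invr_ge0 ?(ltW e1) ?(ltW s0) ?(ltW pi0).
    by rewrite ler_pdivrMr// mul1r.
  - by apply: integrable_EFinZl => //; exact: integrable_expN.
split=> //.
have J_int : mu.-integrable Rpos (fun t => (expR (- s * t) * J t)%:E).
  apply: (@integrable_EFin_eq _ _ _ mu Rpos _
      (fun t => pi / 2 * (expR (- s * t) * explicit_w x t))) => //.
    move=> t _; rewrite /explicit_w -/(J t).
    by move: (@pi R) pi0 => p p0; field; rewrite lt0r_neq0.
  exact: integrable_EFinZl.
have -> : \int[mu]_(t in Rpos) (expR (- s * t) * explicit_w x t) =
    2 / pi * \int[mu]_(t in [set: R]) (\int[mu]_(v in [set: R]) F (t, v)).
  transitivity (\int[mu]_(t in Rpos) (2 / pi * (expR (- s * t) * J t))).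
    by apply: eq_Rintegral => t _; rewrite /explicit_w mulrCA.
  rewrite RintegralZl//; congr (_ * _); rewrite Rintegral_mkcond.
  apply: eq_Rintegral => t _; rewrite inner1 /E !patchE.
  by case: ifP => _; rewrite ?mul0r.
rewrite (@Rintegral_Fubini R F _ _ mF p_int (G_int x0) F_le) outer2; move: pi0; move: (@pi R) => p p0.
by field; rewrite !lt0r_neq0.
Qed.

End ExplicitSolution.

(** * Generalized derivatives in the classical cases *)
Section MonotoneWeakDerivative.
Context {R : realType}.
Notation mu := (@lebesgue_measure R).

(** Shifting the integration variable turns the increments of [p] into
    decrements of [g]. *)
Lemma nondecr_weak_derivative (g p p' : R -> R) (c d : R) : 0 < c -> c <= d ->
  (forall s t, 0 < s -> s < t -> g s <= g t) ->
  (forall t : R, is_derive t 1 p (p' t)) -> continuous p' ->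
  (forall t, 0 <= p t) -> (forall t, ~~ (c <= t <= d) -> p t = 0) ->
  \int[mu]_(t in [set: R]) (g t * p' t) <= 0.
Proof.
move=> c0 cd g_nd dp cp' p0 p_out.
have cp : continuous p.
  move=> t; apply/differentiable_continuous/derivable1_diffP.
  by have [] := dp t.
pose cl t := Num.max c (Num.min t d).
have cl_in t : c <= cl t <= d.
  by rewrite /cl le_max lexx/= ge_max cd ge_min lexx orbT.
have cl_id t : c <= t <= d -> cl t = t.
  by move=> /andP[ct td]; rewrite /cl (min_idPl td) (max_idPr ct).
have g_le s t : 0 < s -> s <= t -> g s <= g t.
  by move=> s0; rewrite le_eqVlt => /predU1P[->//|]; exact: g_nd.
pose gt t := g (cl t).
have gt_nd : {homo gt : s t / s <= t}.
  move=> s t st; apply: g_le; first by have /andP[/(lt_le_trans c0)] := cl_in s.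
  rewrite /cl ge_max !le_max lexx/=; apply/orP; right.
  by rewrite le_min !ge_min st lexx orbT.
have mgt : measurable_fun setT gt by exact: nondecreasing_measurable.
pose B := `|g c| + `|g d|.
have gtB t : `|gt t| <= B.
  have /andP[c1 c2] := cl_in t.
  have H1 : g c <= gt t by exact: g_le.
  have H2 : gt t <= g d by apply: g_le => //; exact: lt_le_trans c1.
  have := ler_norm (g d); have := ler_norm (- g c); rewrite normrN.
  have := normr_ge0 (g c); have := normr_ge0 (g d).
  by rewrite ler_norml /B => ? ? ? ?; apply/andP; split; lra.
have B0 : 0 <= B by rewrite addr_ge0.
have p'_out t : ~~ (c <= t <= d) -> p' t = 0.
  move=> tcd; have dt := dp t.
  have near0 : {near t, (fun _ => 0) =1 p}.
    have : open (~` `[c, d]%classic : set R).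
      by rewrite openC; exact: itv_closed.
    move=> /(_ t) H; have := H _; rewrite /setC/= in_itv/= => /(_ (negP tcd)).
    by apply: filterS => x /= /negP xcd; rewrite p_out// -in_itv.
  rewrite -(@derive_val _ _ _ _ _ _ _ dt) -(near_eq_derive _ near0).
  exact: derive_cst.
have -> : \int[mu]_(t in [set: R]) (g t * p' t) =
    \int[mu]_(t in [set: R]) (gt t * p' t).
  apply: eq_Rintegral => t _.
  have [tcd|tcd] := boolP (c <= t <= d); first by rewrite /gt cl_id.
  by rewrite p'_out// !mulr0.
have [M M0 p'M] : exists2 M, 0 <= M & forall t, `|p' t| <= M.
  have : bounded_set (p' @` `[c, d]).
    apply/compact_bounded/continuous_compact; last exact: segment_compact.
    exact: continuous_subspaceT.
  move=> [M0 [_ HM]]; exists `|M0 + 1|; first exact: normr_ge0.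
  move=> t; have [tcd|tcd] := boolP (c <= t <= d); last by rewrite p'_out// normr0.
  apply: (HM `|M0 + 1|).
    by rewrite (lt_le_trans _ (ler_norm _))// ltrDl.
  by exists t => //=; rewrite in_itv.
pose hn (n : nat) : R := n.+1%:R^-1.
have hn0 n : 0 < hn n by rewrite invr_gt0.
have hn1 n : hn n <= 1 by rewrite invf_le1// ler1n.
pose box := `[c - 1, d]%classic : set R.
have mbox : measurable box by exact: measurable_itv.
pose dq n t := (hn n)^-1 * (p (t + hn n) - p t).
have dq_le n t : `|dq n t| <= M * \1_box t.
  rewrite /dq normrM (gtr0_norm (_ : 0 < (hn n)^-1)) ?invr_gt0//.
  rewrite ler_pdivrMl// indicE; case: (boolP (t \in box)) => tb.
    rewrite mulr1.
    have tt : t < t + hn n by rewrite ltrDl.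
    have cpw : {within `[t, t + hn n], continuous p} by exact: continuous_subspaceT.
    have [y _ ->] := MVT tt (fun y _ => dp y) cpw.
    by rewrite addrAC subrr add0r normrM (gtr0_norm (hn0 n)) mulrC ler_wpM2l// ltW.
  have tout : (t < c - 1) || (d < t).
    by move: tb; rewrite notin_setE /box/= in_itv/= => /negP; rewrite negb_and -!ltNge.
  have := hn0 n; have := hn1 n => ? ?.
  rewrite !p_out; first by rewrite subrr normr0 !mulr0.
    by rewrite negb_and -!ltNge; case/orP: tout => ?; apply/orP; [left|right]; lra.
  by rewrite negb_and -!ltNge; case/orP: tout => ?; apply/orP; [left|right]; lra.
have ibox : mu.-integrable setT (fun t => (B * M * \1_box t)%:E).
  by apply: integrable_EFinZl => //; exact: (@integrable_indic_itv R (c - 1) d true false).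
have mdq n : measurable_fun setT (dq n).
  apply: continuous_measurable_fun => t; apply: cvgM; first exact: cvg_cst.
  apply: cvgB; last exact: cp.
  by apply: (@continuous_comp _ _ _ (fun t => t + hn n) p);
    [apply: cvgD; [exact: cvg_id|exact: cvg_cst]|exact: cp].
have gdq_le n t : `|gt t * dq n t| <= B * M * \1_box t.
  by rewrite normrM -mulrA ler_pM.
have lim : \int[mu]_(t in [set: R]) (gt t * dq n t) @[n --> \oo] -->
    \int[mu]_(t in [set: R]) (gt t * p' t).
  rewrite /Rintegral; apply: fine_cvg.
  have ip' : mu.-integrable setT (fun t => (gt t * p' t)%:E).
    apply: (@integrable_EFin_le _ _ _ mu setT measurableT _
      (fun t => B * M * \1_box t)) => //.
      by apply: measurable_funM => //; exact: continuous_measurable_fun.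
    move=> t _; rewrite normrM -mulrA ler_pM//.
    rewrite indicE; case: (boolP (t \in box)) => tb; first by rewrite mulr1.
    rewrite mulr0 p'_out ?normr0//; apply: contra tb => /andP[ct td].
    by rewrite inE /box/= in_itv/= td andbT (le_trans _ ct)// gerBl.
  rewrite fineK; last exact: integrable_fin_num.
  apply: (@dominated_cvg _ _ _ mu setT measurableT _ _ (fun t => (B * M * \1_box t)%:E)).
  - by move=> n; apply/measurable_EFinP; apply: measurable_funM; [exact: mgt|exact: mdq].
  - move=> t _; apply: cvg_EFin; first exact: nearW.
    apply: cvgM; first exact: cvg_cst.
    have [/cvg_ex[/= l pl] _] := dp t.
    have lE : l = p' t.
      by have := @derive_val _ _ _ _ _ _ _ (dp t); rewrite /derive (cvg_lim _ pl).
    rewrite -lE; move: pl => /cvgr_dnbhsP/(_ hn).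
    have H0 : (forall n, hn n != 0) /\ hn n @[n --> \oo] --> 0.
      by split=> [n|]; [rewrite gt_eqF|exact: (@cvg_harmonic R)].
    move=> /(_ H0); apply: cvg_trans; apply: near_eq_cvg; apply: nearW => n.
    by rewrite /dq /= /GRing.scale/= mulr1 [hn n + t]addrC.
  - by [].
  - exact: ibox.
  - by move=> n t _; rewrite lee_fin.
apply: (cvgr_to_le lim); apply: nearW => n.
have [Mp pM] : exists Mp, forall t, `|p t| <= Mp * \1_(`[c, d]%classic : set R) t.
  have : bounded_set (p @` `[c, d]).
    apply/compact_bounded/continuous_compact; last exact: segment_compact.
    exact: continuous_subspaceT.
  move=> [M1 [_ HM]]; exists `|M1 + 1|.
  move=> t; rewrite indicE; case: (boolP (t \in _)) => tcd.
    rewrite mulr1; apply: (HM `|M1 + 1|).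
      by rewrite (lt_le_trans _ (ler_norm _))// ltrDl.
    by exists t => //; rewrite inE in tcd.
  rewrite mulr0 p_out ?normr0//; apply: contra tcd.
  by rewrite inE /= in_itv.
have int_p (q : R -> R) : measurable_fun setT q -> (forall t, `|q t| <= B) ->
    mu.-integrable setT (fun t => (q t * p t)%:E).
  move=> mq qB; apply: (@integrable_EFin_le _ _ _ mu setT measurableT _
    (fun t => B * Mp * \1_(`[c, d]%classic : set R) t)).
  - by apply: measurable_funM => //; exact: continuous_measurable_fun.
  - by move=> t _; rewrite normrM -mulrA ler_pM.
  - by apply: integrable_EFinZl => //; exact: (@integrable_indic_itv R c d true false).
pose h := hn n; have h0 : 0 < h := hn0 n.
pose gh t := gt (t - h).
have mgh : measurable_fun setT gh.
  apply: nondecreasing_measurable => // s t st; apply: gt_nd.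
  by rewrite lerD2r.
have i1 := int_p gh mgh (fun t => gtB _); have i2 := int_p gt mgt gtB.
have i1' : mu.-integrable setT (fun t => (gt t * p (t + h))%:E).
  apply: (@integrable_EFin_eq _ _ _ mu setT measurableT (fun t : R => gh (t + h) * p (t + h))).
    by move=> t _; rewrite /gh addrK.
  exact: (@integrable_shift R (fun t => gh t * p t) h i1).
have -> : \int[mu]_(t in [set: R]) (gt t * dq n t) =
    h^-1 * (\int[mu]_(t in [set: R]) (gh t * p t - gt t * p t)).
  rewrite RintegralB// -(@Rintegral_shift R (fun t => gh t * p t) h i1).
  rewrite (@eq_Rintegral _ _ _ mu _ (fun t => gt t * p (t + h)) (fun t : R => gh (t + h) * p (t + h))).
    rewrite -RintegralB// -RintegralZl//; last exact: integrable_EFinB.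
    by apply: eq_Rintegral => t _; rewrite /dq; ring.
  by move=> t _; rewrite /gh addrK.
rewrite mulr_ge0_le0 ?invr_ge0 ?(ltW h0)//.
rewrite -oppr_ge0 -mulN1r -RintegralZl//; last exact: integrable_EFinB.
apply: Rintegral_ge0 => t _; rewrite mulN1r opprB -mulrBl mulr_ge0// subr_ge0.
by apply: gt_nd; rewrite gerBl ltW.
Qed.

End MonotoneWeakDerivative.

Section Quadrant.
Context {R : realType}.
Notation mu := (@lebesgue_measure R).
Notation R2 := (measurableTypeR R * measurableTypeR R)%type.

(** An open set is a countable union of open squares with rational data. *)
Lemma open_measurable2 (O : set (R * R)) : open O -> measurable (O : set R2).
Proof.
move=> oO.
pose box (p q r : rat) : set R2 :=
  `]ratr p - ratr r, ratr p + ratr r[%classic `*`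
  `]ratr q - ratr r, ratr q + ratr r[%classic.
pose F (p q r : rat) : set R2 := if `[< box p q r `<=` O >] then box p q r else set0.
have -> : O = \bigcup_p \bigcup_q \bigcup_r F p q r.
  apply/seteqP; split => [[x y] Oxy|[x y]]; last first.
    by move=> [p _ [q _ [r _]]]; rewrite /F; case: ifPn => // /asboolP; apply.
  have /nbhs_ballP[e /= e0 He] : nbhs (x, y) O by exact: open_nbhs_nbhs.
  have e20 : 0 < e / 2 by rewrite divr_gt0.
  have /rat_in_itvoo[r] := e20; rewrite inE /= => /itvP rI.
  have r0 : 0 < ratr r :> R by rewrite rI.
  have re : ratr r < e / 2 by rewrite rI.
  have near_rat (a : R) : exists p : rat, ratr p - ratr r < a < ratr p + ratr r.
    have /rat_in_itvoo[p] : a - ratr r < a + ratr r by lra.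
    rewrite inE /= => /itvP pI; exists p.
    have p1 : a - ratr r < ratr p by rewrite pI.
    have p2 : ratr p < a + ratr r by rewrite pI.
    by apply/andP; split; lra.
  have [p px] := near_rat x; have [q qy] := near_rat y.
  exists p => //; exists q => //; exists r => //.
  rewrite /F ifT; first by split; rewrite /= in_itv/=.
  apply/asboolP => -[a b] [/=]; rewrite !in_itv/= => apr bqr.
  apply: He; split => /=; rewrite /ball/= ltr_norml.
    by move: px apr => /andP[? ?] /andP[? ?]; apply/andP; split; lra.
  by move: qy bqr => /andP[? ?] /andP[? ?]; apply/andP; split; lra.
apply: bigcupT_measurable_rat => p; apply: bigcupT_measurable_rat => q.
apply: bigcupT_measurable_rat => r; rewrite /F; case: ifPn => // _.
by apply: measurableX; exact: measurable_itv.
Qed.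

Lemma compact_measurable2 (K : set (R * R)) : compact K -> measurable (K : set R2).
Proof.
move=> cK; rewrite -[K]setCK; apply: measurableC; apply: open_measurable2.
by rewrite openC; apply: compact_closed.
Qed.

Lemma compact_bound (K : set (R * R)) (f : R * R -> R) : compact K ->
  (forall z, K z -> {for z, continuous f}) ->
  exists2 M, 0 < M & forall z, K z -> `|f z| <= M.
Proof.
move=> cK cf.
have cont : {within K, continuous f}.
  by apply: continuous_in_subspaceT => z; rewrite inE; exact: cf.
have [M [_ HM]] := compact_bounded (continuous_compact cont cK).
exists (`|M| + 1); first by rewrite ltr_wpDl.
move=> z Kz; apply: (HM (`|M| + 1)); last by exists z.
by rewrite (le_lt_trans (ler_norm _))// ltrDl.
Qed.

Lemma compact_quadrant_box (K : set (R * R)) : compact K ->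
  K `<=` @open_quadrant R -> exists2 N, 0 < N &
  forall z, K z -> N^-1 <= z.1 <= N /\ N^-1 <= z.2 <= N.
Proof.
move=> cK KQ.
have [M1 M10 H1] := compact_bound cK (fun z _ => @contfst R z).
have [M2 M20 H2] := compact_bound cK (fun z _ => @contsnd R z).
have [M3 M30 H3] : exists2 M, 0 < M & forall z, K z -> `|(z.1)^-1| <= M.
  apply: compact_bound => // z /KQ[z1 _].
  by apply: (contV (f := fst)); [rewrite gt_eqF|exact: contfst].
have [M4 M40 H4] : exists2 M, 0 < M & forall z, K z -> `|(z.2)^-1| <= M.
  apply: compact_bound => // z /KQ[_ z2].
  by apply: (contV (f := snd)); [rewrite gt_eqF|exact: contsnd].
pose N := M1 + M2 + M3 + M4.
have N0 : 0 < N by rewrite /N !addr_gt0.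
exists N => // z Kz; have [z1 z2] := KQ z Kz.
have inv_le (a M : R) : 0 < a -> `|a^-1| <= M -> M <= N -> N^-1 <= a.
  move=> a0; rewrite (gtr0_norm (_ : 0 < a^-1)) ?invr_gt0// => aM MN.
  by rewrite -[leRHS]invrK lef_pV2 ?posrE ?invr_gt0// (le_trans aM).
have := H1 z Kz; have := H2 z Kz; rewrite !gtr0_norm// => zM2 zM1.
split; apply/andP; split.
- by apply: (inv_le _ M3) => //; [exact: H3|rewrite /N; lra].
- by rewrite /N; lra.
- by apply: (inv_le _ M4) => //; [exact: H4|rewrite /N; lra].
- by rewrite /N; lra.
Qed.

Lemma slice_t (phi : R * R -> R) (x t : R) : derivable phi (x, t) (dir_t R) ->
  is_derive t 1 (fun t' => phi (x, t')) ('D_(dir_t R) phi (x, t)).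
Proof.
have E : (fun h : R => h^-1 *: ((phi \o shift (x, t)) (h *: dir_t R) - phi (x, t))) =
    (fun h : R => h^-1 *: (((fun t' => phi (x, t')) \o shift t) (h *: (1 : R)) - phi (x, t))).
  apply/funext => h /=; congr (_ *: (_ - _)).
  transitivity (phi (h *: (0 : R) + x, h *: (1 : R) + t)); first by [].
  by rewrite scaler0 add0r.
move=> H; split; first by rewrite /derivable -E.
by rewrite /derive -E.
Qed.

Lemma slice_x (phi : R * R -> R) (x t : R) : derivable phi (x, t) (dir_x R) ->
  is_derive x 1 (fun x' => phi (x', t)) ('D_(dir_x R) phi (x, t)).
Proof.
have E : (fun h : R => h^-1 *: ((phi \o shift (x, t)) (h *: dir_x R) - phi (x, t))) =
    (fun h : R => h^-1 *: (((fun x' => phi (x', t)) \o shift x) (h *: (1 : R)) - phi (x, t))).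
  apply/funext => h /=; congr (_ *: (_ - _)).
  transitivity (phi (h *: (1 : R) + x, h *: (0 : R) + t)); first by [].
  by rewrite scaler0 add0r.
move=> H; split; first by rewrite /derivable -E.
by rewrite /derive -E.
Qed.

Lemma pair_continuous1 (x : R) : continuous (fun t : R => (x, t)).
Proof.
move=> t A [[B C] [/= nB nC] BC]; apply: filterS nC => t' Ct'.
by apply: BC; split => //=; exact: nbhs_singleton.
Qed.

Lemma pair_continuous2 (t : R) : continuous (fun x : R => (x, t)).
Proof.
move=> x A [[B C] [/= nB nC] BC]; apply: filterS nB => x' Bx'.
by apply: BC; split => //=; exact: nbhs_singleton.
Qed.

Lemma quadrantE : @open_quadrant R = `]0%R, +oo[%classic `*` `]0%R, +oo[%classic.
Proof.
by apply/seteqP; split => z; rewrite /open_quadrant /= !in_itv/= !andbT.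
Qed.

Lemma measurable_quadrant : measurable (@open_quadrant R : set R2).
Proof. by rewrite quadrantE; apply: measurableX; exact: measurable_itv. Qed.

Section Monotone.
Variable w : R -> R -> R.
Hypotheses
  (w_x : forall x x' t, 0 < x -> x < x' -> 0 < t -> w x' t <= w x t)
  (w_t : forall x t t', 0 < x -> 0 < t -> t < t' -> w x t <= w x t')
  (w_cont : forall x t, 0 < x -> 0 < t -> w x t' @[t' --> t^'+] --> w x t).

Let u (z : R2) := w z.1 z.2.

Let w_x' x x' t : 0 < x -> x <= x' -> 0 < t -> w x' t <= w x t.
Proof. by move=> x0; rewrite le_eqVlt => /predU1P[->//|]; exact: w_x. Qed.

Let w_t' x t t' : 0 < x -> 0 < t -> t <= t' -> w x t <= w x t'.
Proof. by move=> x0 t0; rewrite le_eqVlt => /predU1P[->//|]; exact: w_t. Qed.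

(** Rounding [t] up to a multiple of [1 / n] replaces [w] by functions which
    are measurable because they are monotone in [x] on countably many strips;
    right continuity in [t] makes them converge to [w]. *)
Lemma measurable_monotone2 : measurable_fun (@open_quadrant R : set R2) u.
Proof.
pose eps n : R := n.+1%:R^-1.
have eps0 n : 0 < eps n by rewrite invr_gt0.
pose q n (t : R) : R := (Num.truncn (n.+1%:R * t)).+1%:R * eps n.
pose wn n (z : R2) := w (Num.max z.1 (eps n)) (q n z.2).
have trunc_itv n t : 0 < t -> (Num.truncn (n.+1%:R * t))%:R <= n.+1%:R * t <
    ((Num.truncn (n.+1%:R * t)).+1%:R : R).
  by move=> t0; apply: truncn_itv; rewrite mulr_ge0// ltW.
apply: (@measurable_fun_cvg _ _ _ _ wn); last first.
  move=> [x t] [/= x0 t0]; rewrite /u /wn /=.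
  have qt n : t < q n t /\ q n t <= t + eps n.
    have /andP[T1 T2] := trunc_itv n t t0.
    have n0 : 0 < n.+1%:R :> R by [].
    rewrite /q /eps; split; first by rewrite ltr_pdivlMr// mulrC.
    by rewrite ler_pdivrMr// mulrDl mulVf ?lt0r_neq0// -[leLHS]natr1 lerD2r [t * _]mulrC.
  have lim : w x (q n t) @[n --> \oo] --> w x t.
    have /cvg_at_rightP := w_cont x0 t0; apply; split.
      by move=> i; exact: (qt i).1.
    apply: (@squeeze_cvgr _ _ _ _ (fun=> t) (fun n => t + eps n)).
    - by apply: nearW => n; rewrite (qt n).2 (ltW (qt n).1).
    - exact: cvg_cst.
    - rewrite -[X in _ --> X]addr0; apply: cvgD; first exact: cvg_cst.
      exact: (@cvg_harmonic R).
  move: lim; apply: cvg_trans; apply: near_eq_cvg; near=> n.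
  have : eps n < x.
    by near: n; exact: (cvgr_lt _ (@cvg_harmonic R)).
  by move=> /ltW /max_idPl ->.
move=> n mQ Y mY.
pose hn (i : nat) (x : R) := w (Num.max x (eps n)) (i.+1%:R * eps n).
pose T (i : nat) := `[i%:R * eps n, i.+1%:R * eps n[%classic : set R.
have -> : @open_quadrant R `&` wn n @^-1` Y =
    \bigcup_i (@open_quadrant R `&` ((hn i @^-1` Y) `*` T i)).
  apply/seteqP; split => -[x t].
    move=> [[/= x0 t0] Yw]; exists (Num.truncn (n.+1%:R * t)) => //.
    split=> //; split=> //=; rewrite /T /= in_itv/=.
    have /andP[T1 T2] := trunc_itv n t t0.
    by rewrite ler_pdivrMr// ltr_pdivlMr// [t * _]mulrC T1 T2.
  move=> [i _ [[/= x0 t0] [/= Yh]]]; rewrite /T /= in_itv/= => /andP[T1 T2].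
  split=> //=; rewrite /wn /q /= (_ : Num.truncn _ = i)//.
  apply: truncn_def; rewrite ler_pdivrMr// in T1; rewrite ltr_pdivlMr// in T2.
  by rewrite mulrC T1 T2.
apply: bigcupT_measurable => i; apply: measurableI => //.
apply: measurableX; last exact: measurable_itv.
have hn_ni : {homo hn i : x y /~ x <= y}.
  move=> x y yx; apply: w_x'; last by rewrite mulr_gt0.
    by rewrite lt_max eps0 orbT.
  by rewrite ge_max !le_max yx/= lexx orbT.
have mh : measurable_fun setT (hn i).
  by apply: nonincreasing_measurable => // x y xy; exact: hn_ni.
by rewrite -[X in measurable X]setTI; exact: mh.
Unshelve. all: by end_near. Qed.

Lemma monotone2_bound (K : set (R * R)) : compact K -> K `<=` @open_quadrant R ->
  exists B, forall z, K z -> `|u z| <= B.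
Proof.
move=> cK KQ; have [N N0 HN] := compact_quadrant_box cK KQ.
have NV0 : 0 < N^-1 by rewrite invr_gt0.
exists (`|w N^-1 N| + `|w N N^-1|) => z Kz.
have [/andP[x1 x2] /andP[t1 t2]] := HN z Kz; rewrite /u.
have up : w z.1 z.2 <= w N^-1 N.
  apply: (@le_trans _ _ (w N^-1 z.2)); first by apply: w_x' => //; exact: lt_le_trans t1.
  by apply: w_t' => //; exact: lt_le_trans t1.
have lo : w N N^-1 <= w z.1 z.2.
  apply: (@le_trans _ _ (w z.1 N^-1)); first by apply: w_x' => //; exact: lt_le_trans x1.
  by apply: w_t' => //; exact: lt_le_trans x1.
have := ler_norm (w N^-1 N); have := ler_norm (- w N N^-1); rewrite normrN.
have := normr_ge0 (w N^-1 N); have := normr_ge0 (w N N^-1).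
by rewrite ler_norml => ? ? ? ?; apply/andP; split; lra.
Qed.

Lemma locally_integrable_monotone2 :
  locally_integrable2 (fun z : R * R => w z.1 z.2).
Proof.
move=> K cK KQ; have [N N0 HN] := compact_quadrant_box cK KQ.
have [B HB] := monotone2_bound cK KQ.
have mK : measurable (K : set R2) by exact: compact_measurable2.
apply: (@measurable_bounded_integrable _ _ _ (@lebesgue2 R) u K mK).
- pose I : set R := `[N^-1, N]%classic.
  have mI : measurable I by exact: measurable_itv.
  apply: (@le_lt_trans _ _ (@lebesgue2 R (I `*` I))).
    apply: le_measure; first by rewrite inE.
      by rewrite inE; exact: measurableX.
    by move=> z /HN[? ?]; split; rewrite /I /= in_itv.
  have -> : @lebesgue2 R (I `*` I) = (mu I * mu I)%E by exact: product_measure1E.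
  rewrite /I lebesgue_measure_itv/=; case: ifP => _; last by rewrite mul0e ltry.
  by rewrite -EFinB -EFinM ltry.
- by apply: measurable_funS measurable_monotone2 => //; exact: measurable_quadrant.
- exists B; split; first exact: num_real.
  by move=> M BM z Kz; apply: le_trans (HB z Kz) (ltW BM).
Qed.

(* phi is a test function supported in K, and D one of its derivatives. *)
Section TestFunction.
Variables (phi D : R * R -> R) (K : set (R * R)) (N : R).
Hypotheses (phi_ge0 : forall z, 0 <= phi z) (D_cont : continuous D)
  (cK : compact K) (KQ : K `<=` @open_quadrant R)
  (phi_out : forall z, ~ K z -> phi z = 0) (D_out : forall z, ~ K z -> D z = 0)
  (N_gt0 : 0 < N)
  (K_box : forall z, K z -> N^-1 <= z.1 <= N /\ N^-1 <= z.2 <= N).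

Let f (z : R2) := u z * D z.
Let I : set R := `[N^-1, N]%classic.

Let mf : measurable_fun [set: R2] f.
Proof.
rewrite -(setvU (@open_quadrant R)); apply/measurable_funU.
- by apply: measurableC; exact: measurable_quadrant.
- exact: measurable_quadrant.
split.
  apply: (@eq_measurable_fun _ _ R2 (measurableTypeR R) _ (cst (0 : R))); last exact: measurable_cst.
  by move=> z; rewrite inE => nQz; rewrite /f D_out ?mulr0// => /KQ.
apply: measurable_funM; first exact: measurable_monotone2.
apply: measurable_funTS; apply: (measurability _ (RGenOpens.measurableE R)).
move=> _ [_ [a [b ->] <-]]; rewrite setTI; apply: open_measurable2.
by apply: open_comp => [z _|]; [exact: D_cont|exact: interval_open].
Qed.

Let f_bound : exists2 B, 0 <= B & forall x t, `|f (x, t)| <= B * \1_I x * \1_I t.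
Proof.
have [B HB] := monotone2_bound cK KQ.
have [M M0 HM] := compact_bound cK (fun z _ => @D_cont z).
exists (`|B| * M); first by rewrite mulr_ge0// ltW.
move=> x t; have [Kxt|nK] := pselect (K (x, t)); last first.
  by rewrite /f D_out// mulr0 normr0 !mulr_ge0// ltW.
have [/= xI tI] := K_box Kxt.
rewrite !indicE !mem_set /I/= ?in_itv// !mulr1 /f normrM ler_pM//; last exact: HM.
by rewrite (le_trans (HB _ Kxt))// ler_norm.
Qed.

Let iI : mu.-integrable setT (fun x => (\1_I x)%:E).
Proof. exact: (@integrable_indic_itv R _ _ true false). Qed.

Let Rintegral_quadrant :
  \int[@lebesgue2 R]_(z in @open_quadrant R) f z = \int[@lebesgue2 R]_z f z.
Proof.
rewrite /Rintegral [in LHS]integral_mkcond; congr fine.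
apply: eq_integral => z _; rewrite patchE; case: ifPn => // /negP nQ.
by rewrite /f D_out ?mulr0// => /KQ Qz; apply: nQ; rewrite inE.
Qed.

Let box_out x t : ~~ (N^-1 <= t <= N) -> ~ K (x, t) /\ ~ K (t, x).
Proof. by move=> /negP nt; split => /K_box[/= ? ?]. Qed.

Let NVN : N^-1 <= N \/ K = set0.
Proof.
have [[z Kz]|K0] := pselect (exists z, K z).
  by have [/andP[h1 h2] _] := K_box Kz; left; exact: le_trans h1 h2.
by right; apply/seteqP; split => // z Kz; case: K0; exists z.
Qed.

Let Rintegral_le0 (h : R -> R) : (forall x, h x <= 0) -> \int[mu]_x h x <= 0.
Proof.
move=> h0; rewrite /Rintegral.
have -> : (\int[mu]_x (h x)%:E = - \int[mu]_x (- h x)%:E)%E.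
  rewrite -integral_ge0N; last by move=> x _; rewrite lee_fin oppr_ge0.
  by apply: eq_integral => x _; rewrite -EFinN opprK.
rewrite fineN oppr_le0 fine_ge0// integral_ge0// => x _.
by rewrite lee_fin oppr_ge0.
Qed.

(** Fubini's theorem and [nondecr_weak_derivative] on the lines [x] constant. *)
Lemma pairing_t_le0 : (forall x t, is_derive (t : R) 1 (fun t : R => phi (x, t)) (D (x, t))) ->
  \int[@lebesgue2 R]_(z in @open_quadrant R) (u z * D z) <= 0.
Proof.
move=> dphi; rewrite Rintegral_quadrant; have [B B0 fB] := f_bound.
have [NN|K0] := NVN; last first.
  rewrite (@eq_Rintegral _ _ _ _ _ (cst 0)) ?Rintegral_cst ?mul0r//.
  by move=> z _; rewrite /f D_out ?mulr0// K0.
rewrite [leLHS](@Rintegral_prod1 R f (fun x => B * \1_I x) (\1_I) mf)//; last exact: integrable_EFinZl.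
apply: Rintegral_le0 => x; have [x0|x0] := ltP 0 x; last first.
  rewrite (@eq_Rintegral _ _ _ _ _ (cst 0)) ?Rintegral_cst ?mul0r//.
  by move=> t _; rewrite /f D_out ?mulr0// => /KQ[/=]; rewrite ltNge x0.
apply: (@nondecr_weak_derivative R (w x) (fun t => phi (x, t)) (fun t => D (x, t)) N^-1 N) => //.
- by rewrite invr_gt0.
- by move=> s t; exact: w_t.
- by move=> t; exact: (@continuous_comp _ _ _ (fun t : R => (x, t)) D t (@pair_continuous1 x t) (@D_cont (x, t))).
- by move=> t /(box_out x)[/phi_out].
Qed.

(** The same with [- w], which is non-decreasing in [x]. *)
Lemma pairing_x_ge0 : (forall x t, is_derive (x : R) 1 (fun x : R => phi (x, t)) (D (x, t))) ->
  0 <= \int[@lebesgue2 R]_(z in @open_quadrant R) (u z * D z).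
Proof.
move=> dphi; rewrite Rintegral_quadrant; have [B B0 fB] := f_bound.
have [NN|K0] := NVN; last first.
  rewrite (@eq_Rintegral _ _ _ _ _ (cst 0)) ?Rintegral_cst ?mul0r//.
  by move=> z _; rewrite /f D_out ?mulr0// K0.
have fi : (@lebesgue2 R).-integrable setT (fun z => (f z)%:E).
  apply: (@integrable_prod_dominated R f (fun x => B * \1_I x) (\1_I) mf) => //.
  exact: integrable_EFinZl.
rewrite -oppr_le0 -mulN1r -RintegralZl//.
rewrite [leLHS](@Rintegral_prod2 R (fun z => -1 * f z) (fun x => B * \1_I x) (\1_I))//; last 3 first.
- by apply: measurable_funM.
- exact: integrable_EFinZl.
- by move=> x t; rewrite mulN1r normrN.
apply: Rintegral_le0 => t; have [t0|t0] := ltP 0 t; last first.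
  rewrite (@eq_Rintegral _ _ _ _ _ (cst 0)) ?Rintegral_cst ?mul0r//.
  by move=> x _; rewrite /f D_out ?mulr0// => /KQ[/= _]; rewrite ltNge t0.
rewrite [leLHS](_ : _ = \int[mu]_x (- w x t * D (x, t))); last first.
  by apply: eq_Rintegral => x _; rewrite /f /u /= mulN1r mulNr.
apply: (@nondecr_weak_derivative R (fun x => - w x t) (fun x => phi (x, t))
  (fun x => D (x, t)) N^-1 N) => //.
- by rewrite invr_gt0.
- by move=> x x' x0 xx'; rewrite lerN2; exact: w_x.
- by move=> x; exact: (@continuous_comp _ _ _ (fun x : R => (x, t)) D x (@pair_continuous2 t x) (@D_cont (x, t))).
- by move=> x /(box_out t)[_ /phi_out].
Qed.

End TestFunction.

Let test_deriv_out (phi : R * R -> R) (K : set (R * R)) v z : compact K ->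
  (forall z, ~ K z -> phi z = 0) -> ~ K z -> 'D_v phi z = 0.
Proof.
move=> cK phi_out nKz.
have nz : \forall z' \near z, phi z' = cst 0 z'.
  have : nbhs z (~` K).
    by apply: open_nbhs_nbhs; split => //; rewrite openC; exact: compact_closed.
  by apply: filterS => z' /phi_out.
by rewrite (near_eq_derive v nz) derive_cst.
Qed.

Lemma gen_deriv_t_nonneg :
  gen_nonneg (gen_deriv (fun z : R * R => w z.1 z.2) (dir_t R)).
Proof.
move=> phi [phi_smooth [K [cK KQ phi_out]]] phi_ge0.
have [_ dphi _ cD] := phi_smooth 1%N; have [N N0 HN] := compact_quadrant_box cK KQ.
rewrite /gen_deriv oppr_ge0.
apply: (@pairing_t_le0 phi _ K N) => //.
  by move=> z; exact: test_deriv_out.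
by move=> x t; exact: slice_t.
Qed.

Lemma gen_deriv_x_nonpos :
  gen_nonneg (fun phi => - gen_deriv (fun z : R * R => w z.1 z.2) (dir_x R) phi).
Proof.
move=> phi [phi_smooth [K [cK KQ phi_out]]] phi_ge0.
have [dphi _ cD _] := phi_smooth 1%N; have [N N0 HN] := compact_quadrant_box cK KQ.
rewrite /gen_deriv opprK.
apply: (@pairing_x_ge0 phi _ K N) => //.
  by move=> z; exact: test_deriv_out.
by move=> x t; exact: slice_x.
Qed.

End Monotone.

End Quadrant.

(** * The theorem *)
Section Derivatives.
Context {R : realType}.
Notation mu := (@lebesgue_measure R).
Notation Rpos := `]0%R, +oo[%classic.

(** Both differences have the completely monotone transform [0]. *)
Lemma laplace_unique (f g F : R -> R) :
  (forall t, 0 < t -> f t' @[t' --> t^'+] --> f t) ->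
  (forall t, 0 < t -> g t' @[t' --> t^'+] --> g t) ->
  (forall s, 0 < s ->
    mu.-integrable Rpos (fun t => (expR (- s * t) * f t)%:E) /\
    \int[mu]_(t in Rpos) (expR (- s * t) * f t) = F s) ->
  (forall s, 0 < s ->
    mu.-integrable Rpos (fun t => (expR (- s * t) * g t)%:E) /\
    \int[mu]_(t in Rpos) (expR (- s * t) * g t) = F s) ->
  forall t, 0 < t -> f t = g t.
Proof.
have le (f' g' : R -> R) :
    (forall t, 0 < t -> f' t' @[t' --> t^'+] --> f' t) ->
    (forall t, 0 < t -> g' t' @[t' --> t^'+] --> g' t) ->
    (forall s, 0 < s ->
      mu.-integrable Rpos (fun t => (expR (- s * t) * f' t)%:E) /\
      \int[mu]_(t in Rpos) (expR (- s * t) * f' t) = F s) ->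
    (forall s, 0 < s ->
      mu.-integrable Rpos (fun t => (expR (- s * t) * g' t)%:E) /\
      \int[mu]_(t in Rpos) (expR (- s * t) * g' t) = F s) ->
    forall t, 0 < t -> f' t <= g' t.
  move=> cf cg lf lg t t0; rewrite -subr_ge0.
  have mP : measurable (Rpos : set R) by exact: measurable_itv.
  apply: (@laplace_ge0 R (fun t => g' t - f' t) (fun=> 0) t t0).
  - by apply: cvgB; [exact: cg|exact: cf].
  - move=> s s0; have [fi _] := lf s s0; have [gi _] := lg s s0.
    apply: (@integrable_EFin_eq _ _ _ mu _ mP
      (fun t => expR (- s * t) * g' t - expR (- s * t) * f' t)).
      by move=> x _; rewrite mulrBr.
    exact: integrable_EFinB.
  - move=> s s0; have [fi fF] := lf s s0; have [gi gF] := lg s s0.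
    under eq_Rintegral do rewrite mulrBr.
    by rewrite RintegralB// gF fF subrr.
  - by move=> n; exact: cmn_cst.
by move=> cf cg lf lg t t0; apply/le_anti/andP; split; exact: le.
Qed.

Lemma derive1_nondecr (f : R -> R) t : 0 < t ->
  (forall s s', 0 < s -> s < s' -> f s <= f s') -> derivable f t 1 ->
  0 <= derive1 f t.
Proof.
move=> t0 f_nd df; rewrite derive1E.
have lim : h^-1 *: ((f \o shift t) (h *: 1) - f t) @[h --> (0 : R)^'] --> 'D_1 f t.
  exact: df.
apply: (cvgr_to_ge lim); near=> h.
have th : 0 < h + t.
  have : `|h| < t by near: h; apply: dnbhs0_lt.
  by rewrite ltr_norml => /andP[? _]; lra.
rewrite /shift /= /GRing.scale /= mulr1.
have [h0|h0|h0] := ltgtP h 0.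
- rewrite mulr_le0 ?invr_le0 ?(ltW h0)// subr_le0; apply: f_nd => //.
  by rewrite gtrDr.
- rewrite mulr_ge0 ?invr_ge0 ?(ltW h0)// subr_ge0; apply: f_nd => //.
  by rewrite ltrDr.
- by rewrite h0 invr0 mul0r.
Unshelve. all: by end_near. Qed.

Lemma derivable_eq_pos (f g : R -> R) t : 0 < t ->
  (forall s, 0 < s -> f s = g s) -> derivable f t 1 -> derivable g t 1.
Proof.
move=> t0 fg; apply: near_eq_derivable; near=> s; apply: fg.
by near: s; exact: lt_nbhsr.
Unshelve. all: by end_near. Qed.

End Derivatives.

Theorem theorem2p2 (R : realType) (alpha c : R) (m : nat) (a cs : 'I_m -> R)
    (w : R -> R -> R)
    (alpha_bounds : 1 < alpha <= 2)
    (a_lt_alpha : forall j : 'I_m, a j < alpha)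
    (a_decr : forall i j : 'I_m, (i < j)%N -> a j < a i)
    (a_gt0 : forall j : 'I_m, 0 < a j)
    (a_last : forall j : 'I_m, j.+1 = m -> alpha - a j <= 1)
    (c_gt0 : 0 < c)
    (cs_gt0 : forall j : 'I_m, 0 < cs j)
    (w_prop : is_propagation_function alpha c a cs w) :
  [/\ forall x t : R, 0 < x -> 0 < t -> 0 <= w x t,
      ~ classical_case alpha a ->
        forall x t : R, 0 < x -> 0 < t ->
          (derivable (fun t' : R => w x t') t 1 /\
           0 <= derive1 (fun t' : R => w x t') t) /\
          (derivable (fun x' : R => w x' t) x 1 /\
           0 <= - derive1 (fun x' : R => w x' t) x) &
      classical_case alpha a ->
        [/\ locally_integrable2 (fun z : R * R => w z.1 z.2),
            gen_nonneg (gen_deriv (fun z : R * R => w z.1 z.2) (dir_t R)) &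
            gen_nonneg
              (fun phi => - gen_deriv (fun z : R * R => w z.1 z.2) (dir_x R) phi)]].
Proof.
have [alpha1 alpha2] := andP alpha_bounds.
(* lo is the smallest exponent, which is alpha itself when m = 0 *)
have [lo [lo0 lo_alpha lo_a alpha_lo]] : exists lo, [/\ 0 < lo, lo <= alpha,
    forall j, lo <= a j & alpha - lo <= 1].
  case: m a cs a_lt_alpha a_decr a_gt0 a_last {cs_gt0 w_prop} => [|n] a cs a_lt a_decr a_gt0 a_last.
    by exists alpha; split => [|//|[]//|]; lra.
  exists (a ord_max); split => //; [exact: ltW|move=> j|exact: a_last].
  have [->//|jn] := eqVneq j ord_max.
  by apply/ltW/a_decr; rewrite ltn_neqAle -ltnS ltn_ord andbT.
pose psi s := Num.sqrt (symbol_g alpha c a cs s).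
have psi_ge0 s : 0 < s -> 0 <= psi s by rewrite sqrtr_ge0.
have psi_cm y : 0 < y -> cm (fun s => (1 + y * psi s)^-1) /\
    cm (fun s => (1 - (1 + y * psi s)^-1) / s).
  by move=> y0; exact: (@inv_1psi_cm R c m a cs c_gt0 cs_gt0 a_gt0 alpha lo).
have w_cont x t : 0 < x -> 0 < t -> w x t' @[t' --> t^'+] --> w x t.
  by move=> x0; exact: (w_prop x x0).1.
have w_int x s : 0 < x -> 0 < s ->
    (@lebesgue_measure R).-integrable `]0%R, +oo[
      (fun t => (expR (- s * t) * w x t)%:E).
  by move=> x0 s0; exact: ((w_prop x x0).2 s s0).1.
have w_lap x s : 0 < x -> 0 < s ->
    \int[@lebesgue_measure R]_(t in `]0%R, +oo[%classic) (expR (- s * t) * w x t) =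
    s^-1 * expR (- x * psi s).
  by move=> x0 s0; rewrite /Rintegral ((w_prop x x0).2 s s0).2.
have w_ge0 := propagation_ge0 psi_ge0 psi_cm w_cont w_int w_lap.
have w_x := propagation_nonincr_x psi_ge0 psi_cm w_cont w_int w_lap.
have w_t := propagation_nondecr_t psi_ge0 psi_cm w_cont w_int w_lap.
split; [exact: w_ge0| |by move=> _; split;
  [exact: locally_integrable_monotone2|exact: gen_deriv_t_nonneg
  |exact: gen_deriv_x_nonpos]].
move=> ncl.
(* If alpha = 2 the exponent is alpha_1: it exists, is at least 1, and can be equal
   to 1 only when m = 1, the case excluded by ncl. *)
have [i0 Ai0] : exists i0 : 'I_m.+1, 1 < fam alpha a i0 < 2.
  have [alpha_lt2|alpha_ge2] := ltP alpha 2.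
    by exists ord0; rewrite fam0 alpha1.
  have alphaE : alpha = 2 by apply/le_anti/andP.
  have m0 : (0 < m)%N.
    by rewrite lt0n; apply/eqP => m0; apply: ncl; split => //; left.
  pose j0 : 'I_m := Ordinal m0.
  exists (lift ord0 j0); rewrite /fam liftK /= -alphaE a_lt_alpha andbT.
  have [m1|m1] := eqVneq m 1%N; last first.
    have lt_m : (m.-1 < m)%N by rewrite ltn_predL.
    pose j1 : 'I_m := Ordinal lt_m.
    have : a j1 < a j0 by apply: a_decr; rewrite /= -ltnS prednK// ltn_neqAle eq_sym m1.
    by have : alpha - a j1 <= 1 by [apply: a_last; rewrite /= prednK]; lra.
  have : alpha - a j0 <= 1 by apply: a_last.
  rewrite alphaE => aj0; rewrite lt_neqAle; apply/andP; split; last by lra.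
  apply/eqP => aj0E; apply: ncl; split => //; right; split => // j.
  rewrite aj0E; congr a; apply: val_inj => /=.
  by have := leq_trans (ltn_ord j) (eq_leq m1); case: (nat_of_ord j).
have [k [l [[ck cl] k_ge0 [K K0 kl_le] [b b0 k_ge] poisson]]] :=
  @boundary_values R 'I_m.+1 (fam c cs) (fam alpha a) i0 lo alpha
    (fam_ind (P := fun z => 0 < z) c_gt0 cs_gt0) lo0 (fam_ind (P := fun z => lo <= z) lo_alpha lo_a)
    (fam_ind (P := fun z => z <= alpha) (lexx alpha) (fun j => ltW (a_lt_alpha j))) alpha_lo alpha2 Ai0.
have gam0 : 0 < fam alpha a i0 - 1 by case/andP: Ai0; lra.
pose W := explicit_w k l.
have W_t x t : 0 < x -> derivable (W x) t 1.
  exact: (explicit_w_derivable_t ck cl k_ge0 b0 gam0 k_ge).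
have W_x x t : 0 < x -> derivable (W ^~ t) x 1.
  exact: (explicit_w_derivable_x ck cl k_ge0 K0 kl_le b0 gam0 k_ge).
have wW x t : 0 < x -> 0 < t -> W x t = w x t.
  move=> x0; apply: (@laplace_unique R (W x) (w x) (fun s => s^-1 * expR (- x * psi s))).
  - move=> t' _; apply: cvg_at_right_filter; apply: differentiable_continuous.
    by apply/derivable1_diffP; exact: W_t.
  - by move=> t' t'0; exact: w_cont.
  - move=> s s0; rewrite /psi symbol_fam.
    exact: (explicit_w_laplace
      (psi := fun s => Num.sqrt (\sum_i fam c cs i * s `^ fam alpha a i)) ck cl k_ge0 b0 gam0 k_ge poisson x0 s0).
  - by move=> s s0; split; [exact: w_int|exact: w_lap].
move=> x t x0 t0.
have dt : derivable (fun t' => w x t') t 1.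
  by apply: (derivable_eq_pos t0 _ (W_t x t x0)) => s s0; exact: wW.
have dx : derivable (fun x' => w x' t) x 1.
  by apply: (derivable_eq_pos x0 _ (W_x x t x0)) => s s0; exact: wW.
split; split; [exact: dt| |exact: dx|].
  apply: (derive1_nondecr t0 _ dt) => s s'; exact: w_t.
have dN : derivable (fun x' => - w x' t) x 1 by exact: derivableN.
rewrite derive1E -deriveN// -derive1E.
apply: (derive1_nondecr x0 _ dN) => s s' s0 ss'.
by rewrite lerN2; exact: w_x.
Qed.
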